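(* If $(k,\ell)$ is a $p$-adic exponent pair, then so are $$A(k,\ell)=\left(\frac{k}{2(k+1)},\frac{k+\ell+1}{2(k+1)}\right)\quad\text{and}\quad B(k,\ell)=\left(\ell-\frac12,\,k+\frac12\right).$$
   Context: Notation. $\mathbb N=\{1,2,\dots\}$, $\mathbb Q^+$ is the set of positive rationals, $\mathbb R^+_0=[0,\infty)$, $P$ is the set of primes. For a prime $p$: $\rho_p=1/(p-1)$; $e(x)=e^{2\pi i x}$, also extended from $\mathbb Z[1/p]$ to the unique $\mathbb Z_p$-periodic function on $\mathbb Q_p$. For $y\in\mathbb Q^+$: $\iota(y)=\max(0,-\mathrm{ord}_p y)$, $\iota'(y)=\max(0,\mathrm{ord}_p y)$ (these depend on $p$); $\iota,\iota'$ stand for $\iota(y),\iota'(y)$ when $y$ is clear. Power series. $\mathbf I_0(\mathbb Z_p)$ is the set of power series $\sum_{k\ge0}a_kt^k$ with $a_k\in\mathbb Z_p$ and $|a_k|_p\to0$; for real $\lambda\ge 0$, $\mathbf I_0[\lambda](\mathbb Z_p)=\{a\in\mathbf I_0(\mathbb Z_p):\mathrm{ord}_pa_k\ge\lceil k\lambda\rceil\ \forall k\ge0\}$. $(1+x)^y=\sum_k\binom yk x^k$. Class $\mathbf F$. Let $w\in\mathbb Z$, $u,\kappa\in\mathbb N$ with $\kappa\ge1+\iota'(2)$, $\lambda\in\rho_p\mathbb N$, $y\in\mathbb Q^+$, $\omega,\omega'\in\mathbb Z_p^\times$. A power series $f\in\mathbb Q_p^\times\mathbf I_0(\mathbb Z_p)$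 belongs to $\mathbf F(w,y,\kappa,\lambda,u,\omega,\omega')$ if $$f'(t)=p^w\omega'(1+p^{\iota+\kappa}\omega t)^{-y}+p^w\gamma_0+p^{u+w}g(t)$$ for some $\gamma_0\in\mathbb Z_p$ and $g\in\mathbf I_0[\lambda](\mathbb Z_p)$. $f\in\mathbf F(w,y,\kappa,\lambda,u)$ means $f\in\mathbf F(w,y,\kappa,\lambda,u,\omega,\omega')$ for some $\omega,\omega'\in\mathbb Z_p^\times$. Parameter functions. For a set $Y$, $\mathbf J(Y)$ is the set of functions $g:\mathbb Q^+\times P\to Y$ such that for every $y$ there are a finite $P_0(y)\subset P$ and a function $g_0:P\setminus P_0(y)\to Y$ with $g(y,p)=g_0(p)$ for all $p\in P\setminus P_0(y)$. Similarly $\mathbf J_1(Y)$ is the set of functions $g(y,p,\kappa,\lambda)\in Y$ defined for $y\in\mathbb Q^+$, $p\in P$, $\kappa\in\iota'(2)+\mathbb N$, $\lambda\in\rho_p\mathbb N$, such that for every $y$ there are a finite $P_0(y)\subset P$ and a function $g_0$ on $(P\setminus P_0(y))\times X$, $X=\mathbb N\times\mathbb R^+$, with $g(y,p,\kappa,\lambda)=g_0(p,\kappa,\lambda)$ for all $p\in P\setminus P_0(y)$ and all admissible $\kappa,\lambda$. $p$-adic exponent data and pairs. Let $q=(k,\ell,r,\delta,(n_0,u_0,\kappa_0,\lambda_0))$ with $k,\ell\in\mathbb R$, $0\le k\le\frac12\le\ell\le1$, $r\in\mathbf J_1(\mathbb R)$, $\delta\in\mathbb R_0^+$, $n_0,u_0\in\mathbf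 J_1(\mathbb N)$, $\kappa_0\in\mathbf J(\mathbb N)$, $\lambda_0\in\mathbf J(\mathbb R_0^+)$, and $n_0(y,p,\kappa,\lambda)>\kappa+\iota'(y)$. Such $q$ is a $p$-adic exponent datum if, for every $p\in P$, $y\in\mathbb Q^+$, $w\in\mathbb Z$, $\kappa\in\mathbb N$ with $\kappa\ge1+\iota'(2)$, $\lambda\in\rho_p\mathbb N$, $n,u\in\mathbb N$ with $$\kappa\ge\kappa_0(y,p),\quad\lambda\ge\lambda_0(y,p),\quad n\ge w+n_0(y,p,\kappa,\lambda),\quad u\ge u_0(y,p,\kappa,\lambda),$$ and for every $f\in\mathbf F(w,y,\kappa,\lambda,u)$, $M\in\mathbb Z$, and $0<B\le p^{n-w-\kappa-\iota'}$, $$\sum_{M<m\le M+B}e\left(\frac{f(m)}{p^n}\right)\ll p^{r}\left(\frac{p^{n-w-\kappa-\iota'}}B\right)^kB^{\ell}\big(\log p^{n-w-\kappa-\iota'}\big)^{\delta},$$ where $r=r(y,p,\kappa,\lambda)$ and the implied constant depends only on the datum $q$. A pair $(k,\ell)$ of non-negative numbers is a $p$-adic exponent pair if it is the pair of first two entries of some $p$-adic exponent datum. (The prime $p$ is not fixed in these notions: the estimate is uniform over all primes.) *)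

(* Defs.v *)
From HB Require Import structures.
From mathcomp Require Import all_boot all_order all_algebra.
From mathcomp Require Import all_classical all_reals all_analysis.
From mathcomp Require Import complex zify ring.
Set Implicit Arguments.
Unset Strict Implicit.
Unset Printing Implicit Defensive.
Import Order.TTheory GRing.Theory Num.Theory.
Import numFieldNormedType.Exports.
Local Open Scope classical_set_scope.
Local Open Scope ring_scope.

Definition prime_nat := {p : nat | prime p}.
Coercion prime_nat_val (p : prime_nat) : nat := sval p.

Lemma prime_nat_prime (p : prime_nat) : prime p.
Proof. by case: p. Qed.

(* Z_p is the inverse limit of the rings Z/p^nZ: [x] is the sequence of the
   reductions of a p-adic integer modulo p^n, each represented by its least
   nonnegative residue. *)
Definition coherent (p : prime_nat) (x : nat -> int) :=
  forall n, x n = (x n.+1 %% p%:Z ^+ n)%Z.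

Record padic_int (p : prime_nat) := PadicInt {
  residue :> nat -> int;
  residue_coherent : coherent p residue }.

HB.instance Definition _ (p : prime_nat) := gen_eqMixin (padic_int p).
HB.instance Definition _ (p : prime_nat) := gen_choiceMixin (padic_int p).

Section PadicInt.
Variable p : prime_nat.
Implicit Types x y z : padic_int p.

Lemma padic_int_eq x y : (forall n, x n = y n) -> x = y.
Proof.
case: x y => [x hx] [y hy] /= /funext exy; case: _ / exy hy => hy.
by rewrite (Prop_irrelevance hx hy).
Qed.

Lemma modz_modX (a : int) n : ((a %% p%:Z ^+ n.+1)%Z %% p%:Z ^+ n)%Z = (a %% p%:Z ^+ n)%Z.
Proof.
by rewrite [in RHS](divz_eq a (p%:Z ^+ n.+1)) exprS mulrA modzMDl.
Qed.

Lemma residue_modS x n : (x n.+1 = x n %[mod p%:Z ^+ n])%Z.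
Proof. by rewrite [x n]residue_coherent modz_mod. Qed.

Lemma residue_mod x n : (x n %% p%:Z ^+ n)%Z = x n.
Proof. by rewrite [x n]residue_coherent modz_mod. Qed.

Lemma of_seq_subproof (f : nat -> int) :
  (forall n, (f n.+1 = f n %[mod p%:Z ^+ n])%Z) ->
  coherent p (fun n => (f n %% p%:Z ^+ n)%Z).
Proof. by move=> fS n; rewrite modz_modX fS. Qed.

Definition padic_of_seq f fS := PadicInt (@of_seq_subproof f fS).

Lemma padic_of_const_subproof (a : int) n :
  ((fun=> a) n.+1 = (fun=> a) n %[mod p%:Z ^+ n])%Z.
Proof. by []. Qed.

Lemma padic_add_subproof x y n :
  ((fun m => x m + y m) n.+1 = (fun m => x m + y m) n %[mod p%:Z ^+ n])%Z.
Proof. by rewrite /= -modzDm !residue_modS modzDm. Qed.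

Lemma padic_opp_subproof x n :
  ((fun m => - x m) n.+1 = (fun m => - x m) n %[mod p%:Z ^+ n])%Z.
Proof. by rewrite /= -modzNm residue_modS modzNm. Qed.

Lemma padic_mul_subproof x y n :
  ((fun m => x m * y m) n.+1 = (fun m => x m * y m) n %[mod p%:Z ^+ n])%Z.
Proof. by rewrite /= -modzMm !residue_modS modzMm. Qed.

Definition padic_of_int (a : int) := padic_of_seq (padic_of_const_subproof a).
Definition padic_add x y := padic_of_seq (padic_add_subproof x y).
Definition padic_opp x := padic_of_seq (padic_opp_subproof x).
Definition padic_mul x y := padic_of_seq (padic_mul_subproof x y).

Fact padic_addA : associative padic_add.
Proof.
by move=> x y z; apply: padic_int_eq => n /=; rewrite modzDmr modzDml addrA.
Qed.

Fact padic_addC : commutative padic_add.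
Proof. by move=> x y; apply: padic_int_eq => n /=; rewrite addrC. Qed.

Fact padic_add0 : left_id (padic_of_int 0) padic_add.
Proof.
by move=> x; apply: padic_int_eq => n /=; rewrite modzDml add0r residue_mod.
Qed.

Fact padic_addN : left_inverse (padic_of_int 0) padic_opp padic_add.
Proof.
by move=> x; apply: padic_int_eq => n /=; rewrite modzDml addNr.
Qed.

HB.instance Definition _ :=
  GRing.isZmodule.Build (padic_int p) padic_addA padic_addC padic_add0 padic_addN.

Fact padic_mulA : associative padic_mul.
Proof.
by move=> x y z; apply: padic_int_eq => n /=; rewrite modzMmr modzMml mulrA.
Qed.

Fact padic_mulC : commutative padic_mul.
Proof. by move=> x y; apply: padic_int_eq => n /=; rewrite mulrC. Qed.

Fact padic_mul1 : left_id (padic_of_int 1) padic_mul.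
Proof.
by move=> x; apply: padic_int_eq => n /=; rewrite modzMml mul1r residue_mod.
Qed.

Fact padic_mulDl : left_distributive padic_mul padic_add.
Proof.
by move=> x y z; apply: padic_int_eq => n /=; rewrite modzMml modzDm mulrDl.
Qed.

Fact padic_1neq0 : padic_of_int 1 != 0.
Proof.
apply/eqP => /(congr1 (fun x : padic_int p => x 1%N)) /=.
by rewrite expr1 mod0z modz_small // ltz_nat prime_gt1 ?prime_nat_prime.
Qed.

HB.instance Definition _ :=
  GRing.Zmodule_isComNzRing.Build (padic_int p)
    padic_mulA padic_mulC padic_mul1 padic_mulDl padic_1neq0.

Definition padic_unit : {pred padic_int p} := [pred x | `[< exists y, y * x = 1 >]].
Definition padic_inv x : padic_int p :=
  if x \in padic_unit then xget 0 [set y | y * x = 1] else x.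

Fact padic_mulV : {in padic_unit, left_inverse 1 padic_inv *%R}.
Proof.
move=> x ux; rewrite /padic_inv ux; move: ux => /asboolP yx.
exact: (@xgetPex _ 0 [set y | y * x = 1]) yx.
Qed.

Fact padic_unitP x y : y * x = 1 -> padic_unit x.
Proof. by move=> yx; apply/asboolP; exists y. Qed.

Fact padic_inv_out : {in [predC padic_unit], padic_inv =1 id}.
Proof. by move=> x; rewrite /padic_inv inE /= => /negPf ->. Qed.

HB.instance Definition _ :=
  GRing.ComNzRing_hasMulInverse.Build (padic_int p)
    padic_mulV padic_unitP padic_inv_out.

Lemma residue_modle x m n : (m <= n)%N -> (p%:Z ^+ m %| x n - x m)%Z.
Proof.
elim: n => [|n IHn]; first by rewrite leqn0 => /eqP ->; rewrite subrr dvdz0.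
rewrite leq_eqVlt => /predU1P[->|]; first by rewrite subrr dvdz0.
rewrite ltnS => mn; rewrite -(subrK (x n) (x n.+1)) -addrA rpredD ?IHn//.
apply: (@dvdz_trans (p%:Z ^+ n)); first exact: dvdz_exp2l.
by rewrite -eqz_mod_dvd residue_modS.
Qed.

Fact padic_mulf_eq0 x y : x * y = 0 -> (x == 0) || (y == 0).
Proof.
have nz z : z != 0 -> exists n, forall m, (n <= m)%N -> ~~ (p ^ n %| `|z m|)%N.
  move=> /eqP zN0; have : exists n, z n != 0.
    apply/not_existsP => z0; apply: zN0; apply: padic_int_eq => n.
    by move: (z0 n) => /negP; rewrite negbK => /eqP ->; rewrite /= mod0z.
  case=> n zn; exists n => m nm; apply: contra zn => dz.
  have : (p%:Z ^+ n %| z n)%Z.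
    rewrite -[z n](subKr (z m)) rpredB ?residue_modle//.
  by rewrite dvdzE abszX.
  by move=> /dvdz_mod0P; rewrite residue_mod => ->.
move=> xy0; apply: contraT; rewrite negb_or => /andP[/nz[a xa] /nz[b yb]].
have := congr1 (fun x : padic_int p => x (a + b)%N) xy0.
rewrite /= mod0z => /dvdz_mod0P; rewrite dvdzE abszX abszM /= => dxy.
have {}xa := xa _ (leq_addr b a); have {}yb := yb _ (leq_addl a b).
have pp := prime_nat_prime p.
have x0 : (0 < `|x (a + b)%N|)%N by rewrite lt0n; apply: contraNneq xa => ->.
have y0 : (0 < `|y (a + b)%N|)%N by rewrite lt0n; apply: contraNneq yb => ->.
move: dxy xa yb; rewrite !pfactor_dvdn// ?muln_gt0 ?x0// lognM//.
by rewrite -!ltnNge; lia.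
Qed.

HB.instance Definition _ :=
  GRing.ComUnitRing_isIntegral.Build (padic_int p) padic_mulf_eq0.

End PadicInt.

Notation padic p := {fraction (padic_int p)}.

Definition in_Zp (p : prime_nat) (x : padic p) :=
  exists z : padic_int p, x = tofrac z.

(* [padic_ord 0 = +oo]; otherwise [x = p ^ v * z] for a unique [v] and [z]
   (see [padic_ordP] and [padic_ordE]). *)
Definition padic_ord (p : prime_nat) (x : padic p) : \bar int :=
  if x == 0 then +oo%E
  else (xget 0 [set v : int | exists2 z : padic_int p,
          z \is a GRing.unit & x = p%:R ^ v * tofrac z])%:E.

Definition padic_abs (R : realType) (p : prime_nat) (x : padic p) : R :=
  if padic_ord x is v%:E then p%:R ^ (- v) else 0.

Definition padic_cvg (R : realType) (p : prime_nat) (u : nat -> padic p)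
    (l : padic p) :=
  (fun n => padic_abs R (u n - l)) @ \oo --> (0 : R).

Definition expi (R : realType) (x : R) : R[i] :=
  (cos (2 * pi * x) +i* sin (2 * pi * x))%C.

Definition in_Zinvp (p : prime_nat) (r : rat) :=
  exists (a : int) (n : nat), r = a%:~R / p%:R ^+ n.

(* The value at [x] is that of [e] at any element of Z[1/p] congruent to [x]
   modulo Z_p (see [padic_eE]). *)
Definition padic_e (R : realType) (p : prime_nat) (x : padic p) : R[i] :=
  expi (ratr (xget 0 [set r : rat | in_Zinvp p r /\ in_Zp (x - ratr r)])).

Section PadicTheory.
Variable p : prime_nat.
Implicit Types (x y z : padic_int p) (n m : nat).

Let p_gt1 : (1 < p)%N. Proof. exact/prime_gt1/prime_nat_prime. Qed.

Lemma natr_residue (a m : nat) : (a%:R : padic_int p) m = (a %% p%:Z ^+ m)%Z.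
Proof.
elim: a => [|a IHa]; first by rewrite /= !mod0z.
have -> : (a.+1%:R : padic_int p) = padic_add a%:R (padic_of_int p 1).
  by rewrite -addn1 natrD.
by rewrite /= IHa modzDm -addn1 PoszD.
Qed.

Lemma natrX_residue n x m :
  ((p%:R ^+ n * x : padic_int p) m = p%:Z ^+ n * x m %[mod p%:Z ^+ m])%Z.
Proof.
rewrite -natrX; have -> : (p ^ n)%:R * x = padic_mul (p ^ n)%:R x by [].
by rewrite /= natr_residue modz_mod modzMml -[Posz (expn _ _)]natz natrX natz.
Qed.

Lemma residue0 x : x 0%N = 0.
Proof. by rewrite [LHS]residue_coherent expr0 modz1. Qed.

Lemma residue_eq0 x n : x n = 0 <-> exists z, x = p%:R ^+ n * z.
Proof.
have pn0 k : p%:Z ^+ k != 0 by rewrite expf_neq0// eqz_nat -lt0n ltnW.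
split=> [xn|[z ->]]; last first.
  by rewrite -residue_mod natrX_residue modzMr.
pose f m := (x (m + n)%N %/ p%:Z ^+ n)%Z.
have fE m : p%:Z ^+ n * f m = x (m + n)%N.
  rewrite mulrC divzK// -[x _]subr0 -xn; apply: residue_modle.
  exact: leq_addl.
have fS m : (f m.+1 = f m %[mod p%:Z ^+ m])%Z.
  apply/eqP; rewrite eqz_mod_dvd -(dvdz_mul2l (p := p%:Z ^+ n)) ?pn0//.
  by rewrite mulrBr !fE -exprD (addnC n m) residue_modle// addSn.
exists (padic_of_seq fS); apply: padic_int_eq => m.
rewrite -[LHS]residue_mod -[RHS]residue_mod natrX_residue /= modzMmr fE.
by apply/esym/eqP; rewrite eqz_mod_dvd residue_modle// leq_addr.
Qed.

Lemma padic_unitE x : x 1%N != 0 -> x \is a GRing.unit.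
Proof.
move=> x1; have cop m : coprimez (p%:Z ^+ m) (x m).
  rewrite coprimezE abszX; case: m => [|m]; first by rewrite expn0 coprime1n.
  rewrite coprimeXl ?prime_coprime ?prime_nat_prime//; apply: contra x1 => px.
  rewrite -residue_mod; apply/eqP/dvdz_mod0P; rewrite expr1.
  rewrite -[x 1%N](subKr (x m.+1)) rpredB//.
  by rewrite -[X in (X %| _)%Z]expr1 residue_modle.
have /choice[f fP] m : exists u, (p%:Z ^+ m %| u * x m - 1)%Z.
  have /coprimezP[[u v] /= uv] := cop m; exists v.
  by rewrite -uv opprD addrCA subrr addr0 -mulNr dvdz_mull.
have fS m : (f m.+1 = f m %[mod p%:Z ^+ m])%Z.
  apply/eqP; rewrite eqz_mod_dvd -(Gauss_dvdzl _ (cop m)).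
  have -> : (f m.+1 - f m) * x m = (f m.+1 * x m.+1 - 1) - (f m * x m - 1)
      - f m.+1 * (x m.+1 - x m) by ring.
  apply: rpredB; last by rewrite dvdz_mull ?residue_modle.
  by apply: rpredB => //; apply: dvdz_trans (fP m.+1); apply: dvdz_exp2l.
suff /padic_unitP : padic_of_seq fS * x = 1 by [].
apply: padic_int_eq => m; rewrite /= modzMml.
by apply/eqP; rewrite eqz_mod_dvd fP.
Qed.

Lemma padic_intP x : x != 0 ->
  exists n z, z \is a GRing.unit /\ x = p%:R ^+ n * z.
Proof.
move=> x0; have ex : exists n, x n.+1 != 0.
  apply/not_existsP => xn; move/eqP: x0; apply; apply: padic_int_eq => -[|n].
    by rewrite !residue0.
  by move: (xn n) => /negP; rewrite negbK => /eqP ->; rewrite /= mod0z.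
case: (ex_minnP ex) => n xn minn; have [z xE] : exists z, x = p%:R ^+ n * z.
  apply/residue_eq0; case: n {xn} minn => [|n] minn; first exact: residue0.
  by apply/eqP; apply: contraT => /minn; rewrite ltnn.
exists n, z; split=> //; apply: padic_unitE; apply: contra xn => /eqP.
move=> /residue_eq0[z' zE]; apply/eqP/residue_eq0; exists z'.
by rewrite xE zE mulrA -exprD addn1.
Qed.

Let pK0 : (p%:R : padic p) != 0.
Proof.
rewrite -(rmorph_nat (@tofrac (padic_int p))) tofrac_eq0; apply/eqP.
move=> /(congr1 (fun x : padic_int p => x 2%N)); rewrite natr_residue /=.
rewrite mod0z => /dvdz_mod0P; rewrite dvdzE abszX /= => /(dvdn_leq (ltnW p_gt1)).
by rewrite leqNgt -{1}[p : nat]expn1 ltn_exp2l.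
Qed.

Lemma padic_fracP (x : padic p) : exists a b, b != 0 /\ x * tofrac b = tofrac a.
Proof.
elim/quotP: x => y _; exists (frac y).1, (frac y).2; split; first exact: denom_ratioP.
unlock tofrac; rewrite -[LHS]FracField.pi_mul; apply/eqmodP.
rewrite /= FracField.equivfE /FracField.mulf.
by rewrite !numden_Ratio ?mulf_neq0 ?oner_eq0 ?denom_ratioP ?mulr1 1?mulrC.
Qed.

Lemma padic_ordP (x : padic p) : x != 0 ->
  exists v : int, exists2 z, z \is a GRing.unit & x = p%:R ^ v * tofrac z.
Proof.
move=> x0; have [a [b [b0 xE]]] := padic_fracP x.
have a0 : a != 0 by rewrite -tofrac_eq0 -xE mulf_neq0 ?tofrac_eq0.
have [m [y [yu aE]]] := padic_intP a0; have [n [z [zu bE]]] := padic_intP b0.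
exists (m%:Z - n%:Z), (y * z^-1); first by rewrite unitrM yu unitrV.
have {}b0 : tofrac b != 0 by rewrite tofrac_eq0.
apply: (mulIf b0); rewrite xE aE bE !rmorphM !rmorphXn !rmorph_nat /=.
rewrite expfzDr// -exprnN -!exprnP.
have zz : tofrac (z^-1) * tofrac z = 1 by rewrite -rmorphM mulVr// rmorph1.
have pn : (p%:R : padic p) ^+ n != 0 by rewrite expf_neq0.
transitivity (p%:R ^+ m * tofrac y * (p%:R ^+ n * p%:R ^- n)
  * (tofrac z^-1 * tofrac z)); first by rewrite zz divff ?mulr1.
by move: (_ ^- n) => q; ring.
Qed.

Lemma padic_expz_int (v w : int) z z' : z \is a GRing.unit -> v <= w ->
  p%:R ^ v * tofrac z = p%:R ^ w * tofrac z' -> v = w.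
Proof.
move=> zu vw e; apply/eqP; rewrite eq_le vw /= leNgt; apply/negP => lt_vw.
have [k wE] : exists k : nat, w = v + k.+1%:Z.
  by exists (absz (w - v - 1)%R); lia.
have /residue_eq0 z1 : exists y, z = p%:R ^+ 1 * y.
  exists (p%:R ^+ k * z'); apply/eqP; rewrite -tofrac_eq; apply/eqP.
  apply: (mulfI (expfz_neq0 v pK0)); rewrite e wE expfzDr// -exprnP exprS.
  by rewrite expr1 !rmorphM rmorphXn rmorph_nat !mulrA.
have := congr1 (fun x : padic_int p => x 1%N) (mulrV zu).
have -> : z * z^-1 = padic_mul z z^-1 by [].
by rewrite /= z1 mul0r mod0z expr1 modz_small // ltz_nat p_gt1.
Qed.

Lemma padic_ordE (v : int) z : z \is a GRing.unit ->
  padic_ord (p%:R ^ v * tofrac z : padic p) = v%:E.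
Proof.
move=> zu; have x0 : p%:R ^ v * tofrac z != 0 :> padic p.
  rewrite mulf_neq0 ?expfz_neq0// tofrac_eq0.
  by apply: contraTneq zu => ->; rewrite unitr0.
rewrite /padic_ord (negPf x0); case: xgetP => [w _ [z' zu' e]|/(_ v)]; last first.
  by case; exists z.
by congr _%:E; case: (leP v w) => [vw|/ltW vw];
  [apply/esym; apply: padic_expz_int e | apply: padic_expz_int (esym e)].
Qed.

Lemma padic_intr_eq0 (a : int) : ((a%:~R : padic p) == 0) = (a == 0).
Proof.
have natP k : ((k%:R : padic p) == 0) = (k == 0%N).
  rewrite -(rmorph_nat (@tofrac (padic_int p))) tofrac_eq0.
  apply/eqP/eqP => [/(congr1 (fun x : padic_int p => x k))|->//].
  rewrite natr_residue /= mod0z => /dvdz_mod0P; rewrite dvdzE abszX /= => dk.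
  apply/eqP; rewrite -leqn0 leqNgt; apply/negP => k0.
  by move: (dvdn_leq k0 dk); rewrite leqNgt ltn_expl.
by case: a => a; [rewrite -pmulrn | rewrite NegzE mulrNz !oppr_eq0 -pmulrn];
  rewrite natP.
Qed.

Lemma padic_ratrE (a : int) n :
  ratr (a%:~R / p%:R ^+ n) = a%:~R / p%:R ^+ n :> padic p.
Proof.
set r := _ / _ : rat; rewrite /ratr; apply/eqP.
have pn0 : (p%:R : rat) ^+ n != 0 by rewrite expf_neq0 // pnatr_eq0 -lt0n ltnW.
rewrite eqr_div ?expf_neq0 ?padic_intr_eq0 ?denq_eq0//.
have : (numq r)%:~R * p%:R ^+ n = a%:~R * (denq r)%:~R :> rat.
  apply/eqP; rewrite -eqr_div ?intr_eq0 ?denq_eq0// divq_num_den; exact/eqP.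
rewrite -[p%:R]/(p%:Z%:~R) -rmorphXn -!rmorphM => /intr_inj e.
by rewrite -[p%:R]/(p%:Z%:~R) -rmorphXn -!rmorphM e.
Qed.

Lemma padic_frac_part (x : padic p) : exists a n, in_Zp (x - a%:~R / p%:R ^+ n).
Proof.
have [->|x0] := eqVneq x 0.
  by exists 0, 0%N; exists 0; rewrite mul0r subr0 rmorph0.
have [[n|n] [z zu ->]] := padic_ordP x0.
  exists 0, 0%N; exists (p%:R ^+ n * z).
  by rewrite mul0r subr0 rmorphM rmorphXn rmorph_nat.
exists (z n.+1), n.+1.
have pn : (p%:R : padic p) ^+ n.+1 != 0 by rewrite expf_neq0.
have [y yE] : exists y, z - (z n.+1)%:~R = p%:R ^+ n.+1 * y.
  apply/residue_eq0; case zn: (z n.+1) => [k|k].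
    have -> : z - (Posz k)%:~R = padic_add z (padic_opp k%:R) by [].
    by rewrite /= natr_residue zn modzNm modzDmr subrr mod0z.
  have : 0 <= z n.+1 by rewrite -residue_mod modz_ge0// expf_neq0// eqz_nat -lt0n ltnW.
  by rewrite zn.
exists y; apply: (mulfI pn); rewrite mulrBr NegzE -exprnN mulrA divff// mul1r.
rewrite [X in _ - X]mulrCA divff// mulr1.
rewrite -(rmorph_nat (@tofrac (padic_int p))) -rmorphXn -rmorphM -yE rmorphB.
by rewrite rmorph_int.
Qed.

Lemma padic_Zinvp_int (a : int) n : in_Zp (a%:~R / p%:R ^+ n : padic p) ->
  exists b : int, a%:~R / p%:R ^+ n = b%:~R :> rat.
Proof.
have pn0 : (p%:R : rat) ^+ n != 0 by rewrite expf_neq0 // pnatr_eq0 -lt0n ltnW.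
move=> [z zE]; suff /dvdzP[b ->] : (p%:Z ^+ n %| a)%Z.
  by exists b; rewrite rmorphM rmorphXn /= mulfK.
have pn : (p%:R : padic p) ^+ n != 0 by rewrite expf_neq0.
have aE : a%:~R = p%:R ^+ n * z.
  apply/eqP; rewrite -tofrac_eq rmorph_int rmorphM rmorphXn rmorph_nat /= -zE.
  by rewrite mulrCA divff// mulr1.
have /residue_eq0 : exists z, a%:~R = p%:R ^+ n * z by exists z.
case: a {zE aE} => k.
  by rewrite -[_%:~R]/(k%:R) natr_residue => /dvdz_mod0P.
have -> : (Negz k)%:~R = padic_opp k.+1%:R by [].
by rewrite /= natr_residue modzNm NegzE => /dvdz_mod0P.
Qed.
End PadicTheory.

Lemma expiDn (R : realType) (x : R) (n : nat) : expi (x + n%:R) = expi x.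
Proof.
elim: n => [|n <-]; first by rewrite addr0.
rewrite /expi -[n.+1%:R]natr1 addrA mulrDr mulr1; set t := 2 * pi * _.
have -> : t + 2 * pi = t + pi + pi by ring.
by rewrite !(cosDpi, sinDpi) !opprK.
Qed.

Lemma expiDz (R : realType) (x : R) (b : int) : expi (x + b%:~R) = expi x.
Proof.
case: b => n; first exact: expiDn.
by rewrite NegzE mulrNz -[LHS](expiDn _ n.+1) subrK.
Qed.

Lemma padic_eE (R : realType) (p : prime_nat) (x : padic p) (r : rat) :
  in_Zinvp p r -> in_Zp (x - ratr r) -> padic_e R x = expi (ratr r).
Proof.
move=> rP rx; rewrite /padic_e; case: xgetP => [s _ [sP sx]|/(_ r)]; last first.
  by case.
case: rP rx => a [n ->]; case: sP sx => b [m ->]; rewrite !padic_ratrE.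
move=> [y yE] [z zE].
pose c := b * p%:Z ^+ n - a * p%:Z ^+ m.
have cE (F : fieldType) : (p%:R : F) != 0 ->
    b%:~R / p%:R ^+ m - a%:~R / p%:R ^+ n = c%:~R / p%:R ^+ (m + n) :> F.
  move=> pF; rewrite /c rmorphB !rmorphM !rmorphXn /= -[p%:Z%:~R]/(p%:R) exprD.
  by field; rewrite !expf_neq0.
have pQ : (p%:R : rat) != 0.
  by rewrite pnatr_eq0 -lt0n prime_gt0 ?prime_nat_prime.
have [|d dE] := @padic_Zinvp_int p c (m + n)%N.
  exists (z - y); rewrite -cE; last first.
    by rewrite -[p%:R]/(p%:Z%:~R) padic_intr_eq0 eqz_nat -lt0n prime_gt0 ?prime_nat_prime.
  by rewrite rmorphB /= -yE -zE; ring.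
move: dE; rewrite -cE// => /eqP; rewrite subr_eq => /eqP ->.
by rewrite rmorphD /= ratr_int addrC expiDz.
Qed.

Lemma padic_e_ex (p : prime_nat) (x : padic p) :
  exists2 r, in_Zinvp p r & in_Zp (x - ratr r).
Proof.
have [a [n xan]] := padic_frac_part x.
by exists (a%:~R / p%:R ^+ n); rewrite ?padic_ratrE//; exists a, n.
Qed.

Section PowerSeries.
Variables (R : realType) (p : prime_nat).
Implicit Types (f g : nat -> padic p) (lambda : R).

Definition I0 : set (nat -> padic p) :=
  [set a | (forall k, in_Zp (a k)) /\
           (fun k => padic_abs R (a k)) @ \oo --> (0 : R)].

Definition I0_ lambda : set (nat -> padic p) :=
  [set a | I0 a /\
           forall k, ((Num.ceil (k%:R * lambda))%:E <= padic_ord (a k))%E].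

Definition scaled_I0 : set (nat -> padic p) :=
  [set f | exists c g, [/\ c != 0, I0 g & forall k, f k = c * g k]].

Definition deriv_series f : nat -> padic p := fun k => f k.+1 *+ k.+1.

Definition gbinom (y : rat) (k : nat) : rat :=
  (\prod_(i < k) (y - i%:R)) / (k`!)%:R.

(* (1 + c t)^y *)
Definition binom_series (y : rat) (c : padic p) : nat -> padic p :=
  fun k => ratr (gbinom y k) * c ^+ k.

Definition const_series (c : padic p) : nat -> padic p :=
  fun k => if k == 0%N then c else 0.

(* The junk value 0 is only used when the series diverges. *)
Definition eval_series f (x : padic p) : padic p :=
  xget 0 [set l | padic_cvg R (fun N => \sum_(k < N) f k * x ^+ k) l].

End PowerSeries.

Definition rat_ord (p : nat) (y : rat) : int :=
  (logn p `|numq y|)%:Z - (logn p `|denq y|)%:Z.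

Definition iota_neg (p : nat) (y : rat) : nat := absz (Num.max 0 (- rat_ord p y))%R.

Definition iota_pos (p : nat) (y : rat) : nat := absz (Num.max 0 (rat_ord p y))%R.

Definition rho (R : realType) (p : nat) : R := (p%:R - 1)^-1.

(* [kappa] belongs to iota'(2) + {1, 2, ...} *)
Definition kappa_admissible (p kappa : nat) := (1 + iota_pos p 2 <= kappa)%N.

(* [lambda] belongs to rho_p {1, 2, ...} *)
Definition lambda_admissible (R : realType) (p : nat) (lambda : R) :=
  exists2 j : nat, (0 < j)%N & lambda = rho R p * j%:R.

Definition classF_param (R : realType) (p : prime_nat) (w : int) (y : rat)
    (kappa : nat) (lambda : R) (u : nat) (omega omega' : padic_int p) :
    set (nat -> padic p) :=
  [set f | scaled_I0 R f /\
    exists (gamma0 : padic_int p) (g : nat -> padic p), I0_ lambda g /\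
      forall k, deriv_series f k =
        p%:R ^ w * tofrac omega' *
          binom_series (- y) (p%:R ^+ (iota_neg p y + kappa) * tofrac omega) k
        + const_series (p%:R ^ w * tofrac gamma0) k
        + p%:R ^ (u%:Z + w) * g k].

Definition classF (R : realType) (p : prime_nat) (w : int) (y : rat)
    (kappa : nat) (lambda : R) (u : nat) : set (nat -> padic p) :=
  [set f | exists omega omega' : padic_int p,
    [/\ omega \is a GRing.unit, omega' \is a GRing.unit &
        classF_param w y kappa lambda u omega omega' f]].

(* Functions are total on [rat], [nat] and [R], but only their values at
   positive [y] and admissible [kappa], [lambda] matter.  The function [g0] does
   not depend on [y]: for all but finitely many primes (the exceptions depending
   on [y]) the value of [g] is independent of [y]. *)
Definition J (T : Type) (Y : set T) : set (rat -> prime_nat -> T) :=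
  [set g | (forall y p, 0 < y -> Y (g y p)) /\
    exists g0 : prime_nat -> T, forall y, 0 < y ->
      exists2 P0 : set prime_nat, finite_set P0 &
        forall p, ~ P0 p -> g y p = g0 p].

Definition J1 (R : realType) (T : Type) (Y : set T) :
    set (rat -> prime_nat -> nat -> R -> T) :=
  [set g |
    (forall y (p : prime_nat) kappa lambda, 0 < y ->
       kappa_admissible p kappa -> lambda_admissible p lambda ->
       Y (g y p kappa lambda)) /\
    exists g0 : prime_nat -> nat -> R -> T, forall y, 0 < y ->
      exists2 P0 : set prime_nat, finite_set P0 &
        forall (p : prime_nat) kappa lambda, ~ P0 p ->
          kappa_admissible p kappa -> lambda_admissible p lambda ->
          g y p kappa lambda = g0 p kappa lambda].

Record datum (R : realType) := Datum {
  dat_k : R;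
  dat_l : R;
  dat_r : rat -> prime_nat -> nat -> R -> R;
  dat_delta : R;
  dat_n0 : rat -> prime_nat -> nat -> R -> nat;
  dat_u0 : rat -> prime_nat -> nat -> R -> nat;
  dat_kappa0 : rat -> prime_nat -> nat;
  dat_lambda0 : rat -> prime_nat -> R }.

Definition well_formed_datum (R : realType) (q : datum R) :=
  [/\ 0 <= dat_k q <= 1 / 2 /\ 1 / 2 <= dat_l q <= 1,
      J1 setT (dat_r q) /\ 0 <= dat_delta q,
      J1 [set n | (0 < n)%N] (dat_n0 q) /\ J1 [set n | (0 < n)%N] (dat_u0 q),
      J [set n | (0 < n)%N] (dat_kappa0 q) /\ J [set x | 0 <= x] (dat_lambda0 q) &
      forall y (p : prime_nat) kappa lambda, 0 < y ->
        kappa_admissible p kappa -> lambda_admissible p lambda ->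
        (kappa + iota_pos p y < dat_n0 q y p kappa lambda)%N].

Definition exp_sum (R : realType) (p : prime_nat) (f : nat -> padic p) (n : nat)
    (M : int) (B : R) : R[i] :=
  \sum_(m \in [set m : int | (M < m) && (m%:~R <= M%:~R + B)])
    padic_e R (eval_series R f m%:~R / p%:R ^+ n).

Definition exponent_datum (R : realType) (q : datum R) :=
  well_formed_datum q /\
  exists C : R,
    forall (p : prime_nat) (y : rat) (w : int) (kappa : nat) (lambda : R)
           (n u : nat),
      0 < y -> kappa_admissible p kappa -> lambda_admissible p lambda ->
      (0 < n)%N -> (0 < u)%N ->
      (dat_kappa0 q y p <= kappa)%N -> dat_lambda0 q y p <= lambda ->
      w + (dat_n0 q y p kappa lambda)%:Z <= n%:Z ->
      (dat_u0 q y p kappa lambda <= u)%N ->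
    forall (f : nat -> padic p) (M : int) (B : R),
      let T : R := p%:R ^ (n%:Z - w - kappa%:Z - (iota_pos p y)%:Z) in
      classF w y kappa lambda u f -> 0 < B -> B <= T ->
      `| exp_sum f n M B | <=
        (C * (p%:R `^ dat_r q y p kappa lambda * (T / B) `^ dat_k q
              * B `^ dat_l q * ln T `^ dat_delta q))%:C%C.

Definition exponent_pair (R : realType) (kl : R * R) :=
  exists2 q : datum R, exponent_datum q & kl = (dat_k q, dat_l q).

(* Main.v *)
(* Write [T = p ^ t] with [t = n - w - kappa - iota'].  Every [f] in [F] is, up to
   an additive constant and a linear term, a power series whose derivative is close
   to [p ^ w (1 + c x) ^ (- y)].

   B.  Expand [e (f (m) / p ^ n)], which is [T]-periodic up to a linear phase, in a
   Fourier series mod [T].  Since [f'] is injective mod [p ^ t], p-adic stationary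
   phase evaluates each coefficient: it is a Gauss sum of size about [T ^ (1/2)]
   independent of the frequency [j], times the phase of the Legendre transform
   of [f] at [j].  The derivative of the latter is the inverse power series of [f'],
   close to [((1 + d j) ^ (- 1/y) - 1) / c], so it is again in [F], with [1/y] in place
   of [y].  Only about [T / B] frequencies matter; partial summation over blocks of
   that length feeds the dual sums to the pair [(k, l)].

   A.  Van der Corput's inequality with shifts [p ^ chi h]: the difference
   [f (m + p ^ chi h) - f (m)] is in [F] with [y + 1] in place of [y] and modulus
   smaller by [p ^ (chi + ord h)].  The shift is chosen so that [p ^ chi] balances the
   diagonal against the differenced sums.  When [B ^ (l + 1) > T] the pair
   [B (0, 1) = (1/2, 1/2)] already gives the required bound.

   The real weight [lambda] is weakened to an integer [mu], so that [p ^ mu] makes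
   sense and [classF] becomes a condition on powers of [p]. *)
Require Import Defs.
From mathcomp Require Import all_boot all_order all_algebra.
From mathcomp Require Import all_classical all_reals all_analysis.
From mathcomp Require Import complex zify ring lra.
Set Implicit Arguments.
Unset Strict Implicit.
Unset Printing Implicit Defensive.
Import Order.TTheory GRing.Theory Num.Theory.
Import numFieldNormedType.Exports.
Local Open Scope classical_set_scope.
Local Open Scope ring_scope.

(** The implied constant must be uniform in p, but fixed powers of p are free, since r may depend on
    y, p, kappa and lambda. So every loss (halving at p = 2, factorials, rounding to a power of p,
    the trivial bound of a Gauss sum) is estimated crudely for all p alike and put into p^r. The new
    parameters are those of q at 1/y or y + 1, corrected by iota'; as iota' vanishes at all but
    finitely many primes, they stay in J and J_1. Values of series are limits picked by choice, so
    identities of power series are proved on polynomial truncations: in low degrees as exact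
    congruences modulo X^D, in high degrees by divisibility of the coefficients. The latter rests on
    weights: the shape p^(-mu) Q(p^mu x) with Q integral is kept by composition, and by inversion
    when the linear coefficient is a unit. Hence inverting a p^v-perturbation of a binomial series
    gives a p^v-perturbation of the inverse binomial series. Taking mu >= 4 makes all terms of the
    phase of degree 3 or more divisible by p^2, the error that stationary phase tolerates. *)

Lemma ratrD_frac (F : fieldType) (a b c d : F) : b != 0 -> d != 0 ->
  (a * d + c * b) / (b * d) = a / b + c / d.
Proof. by move=> b0 d0; field; rewrite b0 d0. Qed.

(** * Divisibility and valuations in Q_p *)

Section Divisibility.
Variable p : prime_nat.
Implicit Types (x y : padic p) (c d : int).

Lemma prime_nat_gt1 : (1 < p)%N. Proof. exact/prime_gt1/prime_nat_prime. Qed.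
Lemma prime_nat_gt0 : (0 < p)%N. Proof. exact: ltnW prime_nat_gt1. Qed.
Hint Resolve prime_nat_gt1 prime_nat_gt0 : core.

Lemma padic_natr_eq0 n : ((n%:R : padic p) == 0) = (n == 0%N).
Proof. by rewrite -[n%:R]/((n : int)%:~R) padic_intr_eq0. Qed.

Lemma padic_p_neq0 : (p%:R : padic p) != 0.
Proof. by rewrite padic_natr_eq0 -lt0n. Qed.
Hint Resolve padic_p_neq0 : core.

Lemma padic_pX_neq0 c : (p%:R : padic p) ^ c != 0.
Proof. exact: expfz_neq0. Qed.
Hint Resolve padic_pX_neq0 : core.

Lemma padic_pXn_neq0 n : (p%:R : padic p) ^+ n != 0.
Proof. exact: (expf_neq0 n padic_p_neq0). Qed.

(** Membership in the fractional ideal p^c Z_p, with [c] of either sign. It replaces inequalities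
    for [padic_ord], whose value +oo at 0 would force case distinctions in sums and products. *)
Definition pdvd c x := exists z : padic_int p, x = p%:R ^ c * tofrac z.

Lemma pdvd0 c : pdvd c 0.
Proof. by exists 0; rewrite rmorph0 mulr0. Qed.

Lemma pdvdD c x y : pdvd c x -> pdvd c y -> pdvd c (x + y).
Proof. by move=> [z ->] [w ->]; exists (z + w); rewrite rmorphD mulrDr. Qed.

Lemma pdvdN c x : pdvd c x -> pdvd c (- x).
Proof. by move=> [z ->]; exists (- z); rewrite rmorphN mulrN. Qed.

Lemma pdvdB c x y : pdvd c x -> pdvd c y -> pdvd c (x - y).
Proof. by move=> cx cy; apply/pdvdD/pdvdN. Qed.

Lemma pdvd_sum c I (r : seq I) (P : pred I) (F : I -> padic p) :
  (forall i, P i -> pdvd c (F i)) -> pdvd c (\sum_(i <- r | P i) F i).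
Proof. by move=> cF; elim/big_ind: _ => //; [exact: pdvd0|exact: pdvdD]. Qed.

Lemma pdvdM c d x y : pdvd c x -> pdvd d y -> pdvd (c + d) (x * y).
Proof.
by move=> [z ->] [w ->]; exists (z * w); rewrite rmorphM expfzDr//; ring.
Qed.

Lemma pdvdX c n x : pdvd c x -> pdvd (c *+ n) (x ^+ n).
Proof.
move=> cx; elim: n => [|n IHn]; first by exists 1; rewrite rmorph1 mulr1.
by rewrite exprS mulrS; apply: pdvdM.
Qed.

Lemma pdvd_tofrac (z : padic_int p) : pdvd 0 (tofrac z).
Proof. by exists z; rewrite expr0z mul1r. Qed.

Lemma pdvd_pX c : pdvd c (p%:R ^ c).
Proof. by exists 1; rewrite rmorph1 mulr1. Qed.

Lemma pdvd_int (m : int) : pdvd 0 m%:~R.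
Proof. by rewrite -(rmorph_int (@tofrac (padic_int p))); apply: pdvd_tofrac. Qed.

Lemma pdvd_nat (m : nat) : pdvd 0 m%:R.
Proof. exact: (pdvd_int m). Qed.

Lemma pdvd_1 : pdvd 0 1. Proof. exact: (pdvd_nat 1). Qed.

Lemma pdvd_pM c d x : pdvd (c + d) (p%:R ^ c * x) <-> pdvd d x.
Proof.
split=> [[z]|]; last by apply: pdvdM; exact: pdvd_pX.
rewrite expfzDr// -mulrA => /(mulfI (padic_pX_neq0 c)) ->; by exists z.
Qed.

Lemma pdvd_pMl c d x : pdvd d (p%:R ^ c * x) <-> pdvd (d - c) x.
Proof. by rewrite -(pdvd_pM c (d - c)) addrC subrK. Qed.

Lemma pdvd_divX c x (t : nat) : pdvd c (x / p%:R ^+ t) <-> pdvd (c + t%:Z) x.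
Proof.
have -> : x / p%:R ^+ t = p%:R ^ (- t%:Z) * x by rewrite mulrC exprnN.
by rewrite pdvd_pMl opprK.
Qed.

Lemma pdvdMl d x y : pdvd 0 x -> pdvd d y -> pdvd d (x * y).
Proof. by move=> x0 dy; rewrite -[d]add0r; apply: pdvdM. Qed.

Lemma pdvdMr d x y : pdvd d x -> pdvd 0 y -> pdvd d (x * y).
Proof. by move=> x0 dy; rewrite -[d]addr0; apply: pdvdM. Qed.

Lemma pdvd_le c d x : c <= d -> pdvd d x -> pdvd c x.
Proof.
move=> cd [z ->]; have -> : d = c + `|d - c|%N by lia.
exists (p%:R ^+ `|d - c|%N * z).
by rewrite expfzDr// rmorphM rmorphXn rmorph_nat mulrA.
Qed.

Lemma pdvdMle c d e x y : e <= c + d -> pdvd c x -> pdvd d y -> pdvd e (x * y).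
Proof. by move=> le_e cx dy; apply: pdvd_le le_e (pdvdM cx dy). Qed.

Lemma in_Zp_pdvd x : in_Zp x <-> pdvd 0 x.
Proof. by split=> -[z ->]; exists z; rewrite expr0z mul1r. Qed.

Lemma pdvd_Mn c x n : pdvd c x -> pdvd c (x *+ n).
Proof. by move=> cx; rewrite -mulr_natr; apply: pdvdMr => //; apply: pdvd_nat. Qed.

Lemma pdvd_ord c x : (c%:E <= padic_ord x)%E <-> pdvd c x.
Proof.
have [->|/padic_ordP[v [z zu xE]]] := eqVneq x 0.
  by rewrite /padic_ord eqxx leey; split=> // _; apply: pdvd0.
rewrite {1}xE padic_ordE// lee_fin; split=> [cv|cx].
  by rewrite xE; apply: pdvd_le cv _; exists z.
rewrite leNgt; apply/negP => lt_vc; case: cx => w.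
by rewrite xE => /(padic_expz_int zu (ltW lt_vc)) vc; rewrite vc ltxx in lt_vc.
Qed.

(** The exact valuation; it excludes 0, so such an [x] may be inverted or cancelled. *)
Definition pval c x := exists2 z : padic_int p, z \is a GRing.unit &
  x = p%:R ^ c * tofrac z.

Lemma pval_dvd c x : pval c x -> pdvd c x.
Proof. by move=> [z _ ->]; exists z. Qed.

Lemma tofrac_unit_neq0 (z : padic_int p) : z \is a GRing.unit -> tofrac z != 0.
Proof. by move=> zu; rewrite tofrac_eq0; apply: contraTneq zu => ->; rewrite unitr0. Qed.

Lemma pval_neq0 c x : pval c x -> x != 0.
Proof.
move=> [z zu ->]; apply: mulf_neq0; first exact: padic_pX_neq0.
exact: tofrac_unit_neq0.
Qed.

Lemma pvalM c d x y : pval c x -> pval d y -> pval (c + d) (x * y).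
Proof.
move=> [z zu ->] [w wu ->]; exists (z * w); first by rewrite unitrM zu.
by rewrite rmorphM expfzDr//; ring.
Qed.

Lemma tofracV (z : padic_int p) : z \is a GRing.unit -> tofrac z^-1 = (tofrac z)^-1.
Proof.
move=> zu; apply: (mulfI (tofrac_unit_neq0 zu)).
by rewrite -rmorphM divrr// rmorph1 divff// tofrac_unit_neq0.
Qed.

Lemma pvalV c x : pval c x -> pval (- c) x^-1.
Proof.
move=> [z zu ->]; exists z^-1; first by rewrite unitrV.
by rewrite tofracV// invfM invr_expz.
Qed.

Lemma pval_pX c : pval c (p%:R ^ c).
Proof. by exists 1; rewrite ?unitr1// rmorph1 mulr1. Qed.

Lemma pval_tofrac (z : padic_int p) : z \is a GRing.unit -> pval 0 (tofrac z).
Proof. by move=> zu; exists z => //; rewrite expr0z mul1r. Qed.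

Lemma pval_dvdM c d x y : pval c x -> pdvd d (x * y) -> pdvd (d - c) y.
Proof.
move=> cx dxy; rewrite -(mulKf (pval_neq0 cx) y) addrC.
by apply: pdvdM dxy; apply/pval_dvd/pvalV.
Qed.

Lemma pval_dvd_le c d x : pval c x -> pdvd d x -> d <= c.
Proof.
move=> cx dx; rewrite leNgt; apply/negP => lt_cd.
case: cx dx => z zu -> [w] /(padic_expz_int zu (ltW lt_cd)) e.
by rewrite e ltxx in lt_cd.
Qed.

Lemma pval_uniq c d x : pval c x -> pval d x -> c = d.
Proof.
move=> cx dx; apply/eqP; rewrite eq_le.
by rewrite (pval_dvd_le dx (pval_dvd cx)) (pval_dvd_le cx (pval_dvd dx)).
Qed.

(** Equality case of the ultrametric inequality: x + y = x (1 + y/x), and 1 + p Z_p consists of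
    units because a unit is recognised by its residue modulo p. *)
Lemma pvalD c x y : pval c x -> pdvd (c + 1) y -> pval c (x + y).
Proof.
move=> cx cy; have x0 := pval_neq0 cx.
suff [z zu zE] : pval 0 (1 + y / x).
  have -> : x + y = x * (1 + y / x) by rewrite mulrDr mulr1 mulrCA divff// mulr1.
  rewrite -[c in pval c _]addr0; apply: pvalM; first exact: cx.
  by exists z.
have : pdvd 1 (y / x).
  have -> : 1 = c + 1 - c by lia.
  by apply: pdvdM => //; apply/pval_dvd/pvalV.
case=> w wE; exists (1 + p%:R * w); last first.
  by rewrite expr0z mul1r rmorphD rmorph1 rmorphM rmorph_nat /= wE.
apply: padic_unitE; rewrite -[_ + _]/(padic_add _ _) /= natr_residue.
by rewrite modzDm -modzDmr modzMml expr1 modzMr addr0 modz_small.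
Qed.

Lemma pval_ord x : x != 0 -> exists c, pval c x.
Proof. by move=> /padic_ordP[c [z zu xE]]; exists c, z. Qed.

Lemma pval_nat n : (0 < n)%N -> pval (logn p n) n%:R.
Proof.
move=> n0; have pp := prime_nat_prime p.
have [m copm nE] := pfactor_coprime pp n0; rewrite {2}nE.
exists m%:R; last by rewrite natrM natrX rmorph_nat mulrC.
apply: padic_unitE; rewrite natr_residue expr1; apply/negP => /eqP/dvdz_mod0P.
by rewrite dvdzE /= => pm; move: copm; rewrite prime_coprime// pm.
Qed.

Lemma pvalN c x : pval c x -> pval c (- x).
Proof. by move=> [z zu ->]; exists (- z); rewrite ?unitrN// rmorphN mulrN. Qed.

Lemma pval_int (m : int) : m != 0 -> pval (logn p `|m|) m%:~R.
Proof.
case: m => n; first by rewrite -lt0n => n0; apply: pval_nat.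
by move=> _; rewrite NegzE mulrNz abszN; apply/pvalN/pval_nat.
Qed.

Lemma padic_ratr_int (a b : int) : b != 0 -> ratr (a%:~R / b%:~R) = a%:~R / b%:~R :> padic p.
Proof.
move=> b0; set r := _ / _ : rat; rewrite /ratr; apply/eqP.
rewrite eqr_div ?padic_intr_eq0 ?denq_eq0//.
have : (numq r)%:~R * b%:~R = a%:~R * (denq r)%:~R :> rat.
  apply/eqP; rewrite -eqr_div ?intr_eq0 ?denq_eq0// divq_num_den; exact/eqP.
by rewrite -!intrM => /intr_inj ->.
Qed.

Lemma padic_ratrD (a b : rat) : ratr (a + b) = ratr a + ratr b :> padic p.
Proof.
have [d1 d2] := (denq_neq0 a, denq_neq0 b).
have -> : a + b = (numq a * denq b + numq b * denq a)%:~R / (denq a * denq b)%:~R.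
  rewrite rmorphD !rmorphM /= ratrD_frac ?intr_eq0//.
  by rewrite !divq_num_den.
rewrite padic_ratr_int; last exact: mulf_neq0.
by rewrite /ratr intrD !intrM ratrD_frac ?padic_intr_eq0.
Qed.

Lemma padic_ratrM (a b : rat) : ratr (a * b) = ratr a * ratr b :> padic p.
Proof.
have [d1 d2] := (denq_neq0 a, denq_neq0 b).
have -> : a * b = (numq a * numq b)%:~R / (denq a * denq b)%:~R.
  by rewrite !rmorphM -mulf_div !divq_num_den.
rewrite padic_ratr_int; last exact: mulf_neq0.
by rewrite /ratr !intrM mulf_div.
Qed.

Lemma padic_ratrz (a : int) : ratr a%:~R = a%:~R :> padic p.
Proof. by have := @padic_ratr_int a 1; rewrite !divr1; apply. Qed.

Lemma padic_ratr_nat (a : nat) : ratr a%:R = a%:R :> padic p.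
Proof. exact: (padic_ratrz a). Qed.

Lemma padic_ratrN (a : rat) : ratr (- a) = - ratr a :> padic p.
Proof. by rewrite -[- a]mulN1r padic_ratrM (padic_ratrz (-1)) mulN1r. Qed.

Lemma padic_ratr_prod (I : Type) (r : seq I) (P : pred I) (F : I -> rat) :
  ratr (\prod_(i <- r | P i) F i) = \prod_(i <- r | P i) ratr (F i) :> padic p.
Proof.
elim/big_rec2: _ => [|i x y _ <-]; first exact: (padic_ratrz 1).
by rewrite padic_ratrM.
Qed.

Lemma padic_ratrV (a : rat) : ratr a^-1 = (ratr a)^-1 :> padic p.
Proof.
have [->|a0] := eqVneq a 0; first by rewrite invr0 (padic_ratrz 0) invr0.
have e : ratr a * ratr a^-1 = 1 :> padic p.
  by rewrite -padic_ratrM divff// (padic_ratrz 1).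
have a1 : ratr a != 0 :> padic p by apply: contra_eq_neq e => ->; rewrite mul0r eq_sym oner_neq0.
by apply: (mulfI a1); rewrite e divff.
Qed.

Lemma pval_ratr (y : rat) : y != 0 -> pval (rat_ord p y) (ratr y).
Proof.
move=> y0; rewrite /ratr /rat_ord; apply: pvalM.
  by apply: pval_int; rewrite numq_eq0.
by apply/pvalV/pval_int/denq_neq0.
Qed.

End Divisibility.
#[export] Hint Resolve padic_p_neq0 padic_pX_neq0 prime_nat_gt1 prime_nat_gt0 pdvd0 pdvd_int pdvd_nat pdvd_1 pdvd_tofrac : core.

(** * Additive characters *)

Section Expi.
Variable R : realType.
Implicit Types (x y : R) (z : R[i]).

Lemma expiD x y : expi (x + y) = expi x * expi y.
Proof.
rewrite /expi !mulrDr cosD sinD; apply/eqP; rewrite eq_complex /= eqxx /=.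
by apply/eqP; rewrite addrC [X in _ + X]mulrC addrC; ring.
Qed.

Lemma expi0 : expi 0 = 1 :> R[i].
Proof. by rewrite /expi mulr0 cos0 sin0. Qed.

Lemma expiMn x n : expi (x *+ n) = expi x ^+ n.
Proof.
elim: n => [|n IHn]; first by rewrite mulr0n expi0.
by rewrite mulrS expiD IHn exprS.
Qed.

Lemma expiN x : expi (- x) = (expi x)^-1.
Proof.
have e : expi x * expi (- x) = 1 by rewrite -expiD subrr expi0.
have x0 : expi x != 0 by apply: contra_eq_neq e => ->; rewrite mul0r eq_sym oner_neq0.
by apply: (mulfI x0); rewrite e divff.
Qed.

Lemma normc_expi x : ComplexField.Normc.normc (expi x) = 1.
Proof. by rewrite /expi /= cos2Dsin2 sqrtr1. Qed.

Lemma expi_conj x : (expi x)^*%C = expi (- x).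
Proof. by rewrite /expi mulrN cosN sinN. Qed.

(* [2 pi x] reduced to [0, 2 pi[ has cosine 1 only if it is 0. *)
Lemma expi_eq1 x : expi x = 1 -> exists m : int, x = m%:~R.
Proof.
move=> e1; exists (Num.floor x); set m := Num.floor x.
have xm : 0 <= x - m%:~R < 1.
  have /andP[h1 h2] := floor_itv x; rewrite -/m in h1 h2.
  by rewrite subr_ge0 h1 ltrBlDl -[1]/(1%:~R) -rmorphD.
have : expi (x - m%:~R) = 1 by rewrite -mulrNz expiDz.
set y := x - _ in xm *; have /andP[y0 y1] := xm.
move=> /(congr1 (@complex.Re _)); rewrite /expi /= => cos1.
apply/eqP; rewrite -subr_eq0 -/y; apply: contraT => yn0.
have yp : 0 < y by rewrite lt_neqAle eq_sym yn0.
have : 0 < sin (pi * y).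
  apply: sin_gt0_pi; rewrite mulr_gt0 ?pi_gt0//=.
  by rewrite -[ltRHS]mulr1 ltr_pM2l ?pi_gt0.
have : cos (2 * pi * y) = 1 - sin (pi * y) ^+ 2 *+ 2.
  have -> : 2 * pi * y = pi * y *+ 2 by rewrite -mulrA mulr_natl.
  by rewrite cos_mulr2n cos2sin2; ring.
rewrite cos1 => e s0; have := exprn_gt0 2 s0; lra.
Qed.

End Expi.

Section Character.
Variables (R : realType) (p : prime_nat).
Implicit Types (x y : padic p).
Local Notation psi := (@padic_e R p).

Let p0 : (p%:R : rat) != 0. Proof. by rewrite pnatr_eq0 -lt0n. Qed.

Lemma in_ZinvpD r s : in_Zinvp p r -> in_Zinvp p s -> in_Zinvp p (r + s).
Proof.
move=> [a [n ->]] [b [m ->]]; exists (a * p%:Z ^+ m + b * p%:Z ^+ n), (n + m)%N.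
rewrite -ratrD_frac ?expf_neq0//.
by rewrite rmorphD !rmorphM !rmorphXn /= -[p%:Z%:~R]/(p%:R) exprD.
Qed.

Lemma in_ZinvpMz r (m : int) : in_Zinvp p r -> in_Zinvp p (m%:~R * r).
Proof. by move=> [a [n ->]]; exists (m * a), n; rewrite mulrA rmorphM. Qed.

Lemma psiD x y : psi (x + y) = psi x * psi y.
Proof.
have [r rp rx] := padic_e_ex x; have [s sp sy] := padic_e_ex y.
rewrite (padic_eE R rp rx) (padic_eE R sp sy) -expiD -rmorphD.
apply: padic_eE; first exact: in_ZinvpD.
rewrite padic_ratrD opprD addrACA; apply/in_Zp_pdvd/pdvdD.
  exact/in_Zp_pdvd.
exact/in_Zp_pdvd.
Qed.

Lemma psi_Zp x : pdvd 0 x -> psi x = 1.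
Proof.
move=> x0; rewrite (@padic_eE R p x 0); first by rewrite rmorph0 expi0.
  by exists 0, 0%N; rewrite mul0r.
by apply/in_Zp_pdvd; rewrite (padic_ratrz p 0) subr0.
Qed.

(** One real [a] serves all integers [m], so a linear p-adic phase becomes a shift of the real
    frequencies in the completed sum. *)
Lemma psi_lift x : exists a : R, forall m : int, psi (m%:~R * x) = expi (m%:~R * a).
Proof.
have [r rp rx] := padic_e_ex x; exists (ratr r) => m.
rewrite (@padic_eE R p _ (m%:~R * r)).
- by rewrite rmorphM /= ratr_int.
- exact: in_ZinvpMz.
apply/in_Zp_pdvd; rewrite padic_ratrM padic_ratrz -mulrBr.
by apply: pdvdMl; [exact: pdvd_int|apply/in_Zp_pdvd].
Qed.

Lemma psi_frac (m : int) t : psi (m%:~R / p%:R ^+ t) = expi (m%:~R / p%:R ^+ t).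
Proof.
have mp : in_Zinvp p (m%:~R / p%:R ^+ t) by exists m, t.
rewrite (padic_eE R mp); last first.
  by apply/in_Zp_pdvd; rewrite padic_ratrE subrr; apply: pdvd0.
by rewrite fmorph_div rmorph_int rmorphXn /= ratr_nat.
Qed.

Lemma psi_eq x y : pdvd 0 (x - y) -> psi x = psi y.
Proof. by move=> xy; rewrite -(subrK y x) psiD psi_Zp// mul1r. Qed.

Lemma normc_psi x : ComplexField.Normc.normc (psi x) = 1.
Proof. by have [r rp rx] := padic_e_ex x; rewrite (padic_eE R rp rx) normc_expi. Qed.

Lemma psi_eq1 x : psi x = 1 -> pdvd 0 x.
Proof.
have [r rp rx] := padic_e_ex x; rewrite (padic_eE R rp rx) => /expi_eq1[m /eqP].
rewrite -ratr_int => /eqP /fmorph_inj rm; move/in_Zp_pdvd: rx.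
rewrite rm padic_ratrz => xm; rewrite -(subrK m%:~R x).
by apply: pdvdD xm _; apply: pdvd_int.
Qed.

Lemma psi_sum x n : psi x ^+ n = psi (n%:R * x).
Proof.
elim: n => [|n IHn]; first by rewrite expr0 mul0r psi_Zp//; apply: pdvd0.
by rewrite exprS IHn -psiD -[in RHS](add1n n) natrD mulrDl mul1r.
Qed.

Lemma psi0 : psi 0 = 1. Proof. by apply: psi_Zp; apply: pdvd0. Qed.

Lemma psiN x : psi (- x) = (psi x)^-1.
Proof.
have e : psi x * psi (- x) = 1 by rewrite -psiD subrr psi0.
have x0 : psi x != 0 by apply: contra_eq_neq e => ->; rewrite mul0r eq_sym oner_neq0.
by apply: (mulfI x0); rewrite e divff.
Qed.

Lemma psi_conj x : (psi x)^*%C = psi (- x).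
Proof.
have [r rp rx] := padic_e_ex x; rewrite psiN (padic_eE R rp rx).
by rewrite expi_conj expiN.
Qed.

(** A geometric sum: the hypothesis makes p^s x integral, so the sum vanishes unless psi x = 1, and
    by [psi_eq1] that happens only on Z_p. *)
Lemma psi_orthogonality x s : pdvd (- s%:Z) x -> \sum_(v < p ^ s) psi (v%:R * x) =
  (if `[< pdvd 0 x >] then (p ^ s)%:R else 0).
Proof.
move=> xs; case: asboolP => x0.
  rewrite (eq_bigr (fun=> 1)); first by rewrite sumr_const card_ord.
  by move=> v _; apply: psi_Zp; apply: pdvdMl => //; apply: pdvd_nat.
under eq_bigr do rewrite -psi_sum.
have x1 : psi x - 1 != 0 by rewrite subr_eq0; apply: contra_not_neq x0 => /psi_eq1.
apply: (mulfI x1); rewrite -subrX1 mulr0 psi_sum psi_Zp ?subrr//.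
by rewrite natrX exprnP; apply/pdvd_pMl; rewrite sub0r.
Qed.

Lemma psi_orthogonality_residue (m x : int) t :
  \sum_(j < p ^ t) psi (j%:R * ((m - x)%:~R / p%:R ^+ t)) =
  (if (m == x %[mod p%:Z ^+ t])%Z then (p ^ t)%:R else 0).
Proof.
rewrite psi_orthogonality; last first.
  by apply/pdvd_divX; rewrite addNr; apply: pdvd_int.
congr (if _ then _ else _); apply/asboolP/idP.
  move=> /in_Zp_pdvd /padic_Zinvp_int[b e]; rewrite eqz_mod_dvd.
  have : (m - x)%:~R = (b * p%:Z ^+ t)%:~R :> rat.
    by rewrite rmorphM rmorphXn /= -e divfK// expf_neq0.
  by move=> /intr_inj ->; apply: dvdz_mull.
rewrite eqz_mod_dvd => /dvdzP[b ->].
have -> : (b * p%:Z ^+ t)%:~R = b%:~R * p%:R ^+ t :> padic p.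
  by rewrite intrM -!rmorphXn /= -[RHS]/(_ * (p ^ t)%:R).
rewrite mulfK; first exact: pdvd_int.
exact: padic_pXn_neq0.
Qed.

End Character.

Import ComplexField.Normc.

(** * Values of p-adic power series and their polynomial truncations *)

Definition trunc_series (F : nzRingType) D (f : nat -> F) : {poly F} := \poly_(i < D) f i.

Section Evaluation.
Variables (R : realType) (p : prime_nat).
Implicit Types (x y : padic p) (f g : nat -> padic p) (N D : nat) (z : padic_int p).

Let pR_gt1 : (1 : R) < p%:R. Proof. by rewrite ltr1n prime_nat_gt1. Qed.
Let pR_gt0 : (0 : R) < p%:R. Proof. by rewrite ltr0n. Qed.

Lemma padic_abs_le N x : pdvd N x <-> padic_abs R x <= p%:R ^- N.
Proof.
rewrite -pdvd_ord /padic_abs; case E: (padic_ord x) => [v||].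
- rewrite lee_fin exprnN; split=> [Nv|].
    by rewrite ler_eXz2l//; lia.
  by rewrite ler_eXz2l// => ?; lia.
- by rewrite leey invr_ge0 exprn_ge0// ltW.
- by move: E; rewrite /padic_ord; case: ifP.
Qed.

Lemma padic_abs_ge0 x : 0 <= padic_abs R x.
Proof. by rewrite /padic_abs; case: (padic_ord x) => // v; rewrite exprz_ge0// ltW. Qed.

Lemma cvg_padicP (u : nat -> padic p) :
  (fun k => padic_abs R (u k)) @ \oo --> (0 : R) <->
  forall N : nat, exists D : nat, forall k : nat, (D <= k)%N -> pdvd N (u k).
Proof.
split=> [/cvgrPdist_le u0 N|u0].
  have /u0[D _ uD] : 0 < (p%:R : R) ^- N by rewrite invr_gt0 exprn_gt0.
  exists D => k Dk; apply/padic_abs_le; have := uD k Dk.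
  by rewrite /= sub0r normrN ger0_norm// padic_abs_ge0.
apply/cvgrPdist_le => e e0.
have [N Ne] : exists N, (p%:R : R) ^- N <= e.
  exists (Num.truncn e^-1).+1.
  rewrite -[leRHS]invrK lef_pV2 ?posrE ?invr_gt0 ?exprn_gt0//.
  have : e^-1 < (Num.truncn e^-1).+1%:R by rewrite truncnS_gt.
  move=> /ltW /le_trans; apply; rewrite -natrX ler_nat ltnW//.
  by apply: ltn_expl; exact: prime_nat_gt1.
have [D uD] := u0 N; exists D => // k /= Dk; rewrite sub0r normrN ger0_norm ?padic_abs_ge0//.
by apply: le_trans Ne; apply/padic_abs_le/uD.
Qed.

Lemma pdvd_residue N z : pdvd N (tofrac z) <-> z N = 0.
Proof.
rewrite residue_eq0; split=> -[y yE]; exists y; last first.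
  by rewrite yE rmorphM rmorphXn rmorph_nat.
apply/eqP; rewrite -tofrac_eq; apply/eqP.
by rewrite yE -exprnP rmorphM rmorphXn rmorph_nat.
Qed.

Lemma residueB z w N : (z - w) N = 0 -> z N = w N.
Proof.
rewrite -[z - w]/(padic_add z (padic_opp w)) /= modzDmr => /dvdz_mod0P.
by rewrite -eqz_mod_dvd !residue_mod => /eqP.
Qed.

(** Each residue modulo p^N is eventually constant, and the eventual residues form a coherent
    sequence, which is the limit. *)
Lemma padic_complete (z : nat -> padic_int p) :
  (forall N : nat, exists D : nat, forall m n : nat, (D <= m)%N -> (D <= n)%N ->
     pdvd N (tofrac (z m - z n))) ->
  exists l, forall N : nat, exists D : nat, forall n : nat, (D <= n)%N ->
    pdvd N (tofrac (z n - l)).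
Proof.
move=> /choice[D DP].
have DE N m n : (D N <= m)%N -> (D N <= n)%N -> z m N = z n N.
  by move=> Nm Nn; apply: residueB; apply/pdvd_residue; apply: DP.
have lS N : (z (D N.+1) N.+1 = z (D N) N %[mod p%:Z ^+ N])%Z.
  rewrite (DE N.+1 _ (maxn (D N) (D N.+1))) ?leq_maxr// residue_modS.
  by rewrite (DE N _ (D N))// leq_maxl.
exists (padic_of_seq lS) => N; exists (D N) => n Nn; apply/pdvd_residue.
rewrite -[_ - _]/(padic_add _ (padic_opp _)) /= modzNm modzDmr.
by apply/dvdz_mod0P; rewrite -eqz_mod_dvd !residue_mod (DE N n (D N)).
Qed.

Lemma tofracB z w : tofrac (z - w) = tofrac z - tofrac w.
Proof. exact: rmorphB. Qed.

Lemma I0_series_pdvd f N : I0 R f -> exists D : nat, forall k : nat, (D <= k)%N -> pdvd N (f k).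
Proof. by move=> [_ /cvg_padicP]. Qed.

Lemma scaled_I0_pdvd f N : scaled_I0 R f ->
  exists D : nat, forall k : nat, (D <= k)%N -> pdvd N (f k).
Proof.
move=> [c [g [/pval_ord[v cv] /I0_series_pdvd g0 fE]]].
have [D gD] := g0 (absz (Num.max 0 (N%:Z - v))%R); exists D => k /gD gk.
by rewrite fE; apply: pdvdMle (pval_dvd cv) gk; lia.
Qed.

Lemma I0P f : (forall k, pdvd 0 (f k)) ->
  (forall N : nat, exists D : nat, forall k : nat, (D <= k)%N -> pdvd N (f k)) -> I0 R f.
Proof. by move=> f0 fN; split=> [k|]; [exact/in_Zp_pdvd|exact/cvg_padicP]. Qed.

Lemma eval_series_cvg f x : scaled_I0 R f -> pdvd 0 x ->
  exists l, padic_cvg R (fun N => \sum_(k < N) f k * x ^+ k) l.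
Proof.
move=> [c [g [c0 gI fE]]] x0; have [h hE] : exists h, forall k, g k = tofrac (h k).
  have [/choice[h hE] _] := gI; by exists h.
have [y yE] : exists y : padic_int p, x = tofrac y by case: x0 => y ->; exists y; rewrite expr0z mul1r.
pose z N := \sum_(k < N) h k * y ^+ k.
have zE N : \sum_(k < N) f k * x ^+ k = c * tofrac (z N).
  rewrite rmorph_sum mulr_sumr; apply: eq_bigr => k _.
  by rewrite fE hE yE rmorphM rmorphXn mulrA.
have [|l lP] := @padic_complete z.
  move=> N; have [D gD] := I0_series_pdvd N gI; exists D.
  suff gDn m n : (D <= m)%N -> (m <= n)%N -> pdvd N (tofrac (z n - z m)).
    move=> m n Dm Dn; case: (leqP n m) => [|/ltnW] mn; first exact: gDn.
    by rewrite -opprB rmorphN; apply/pdvdN/gDn.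
  move=> Dm mn; rewrite -(subnKC mn) /z -!(big_mkord xpredT (fun k => h k * y ^+ k)).
  rewrite (@big_cat_nat _ _ _ m) ?leq_addr//= addrAC subrr add0r rmorph_sum /=.
  rewrite big_seq; apply: pdvd_sum => k; rewrite mem_index_iota => /andP[mk _].
  have -> : tofrac (h k * y ^+ k) = g k * x ^+ k by rewrite hE yE rmorphM rmorphXn.
  apply: pdvdMr; first by apply: gD; apply: leq_trans mk.
  by rewrite -[0](mul0rn _ k); apply: pdvdX.
have [v cv] := pval_ord c0.
exists (c * tofrac l); apply/cvg_padicP => N.
have [D zD] := lP (absz (Num.max 0 (N%:Z - v))%R); exists D => n /zD zn.
rewrite zE -mulrBr -tofracB.
by apply: pdvdMle (pval_dvd cv) zn; lia.
Qed.

Lemma trunc_seriesE D f x : (trunc_series D f).[x] = \sum_(k < D) f k * x ^+ k.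
Proof. by rewrite horner_poly. Qed.

(** The convergence is uniform on Z_p, so one [D0] serves all [x]. The later arguments about values
    of series reach polynomials through this lemma. *)
Lemma eval_series_trunc f N : scaled_I0 R f ->
  exists D0, forall D, (D0 <= D)%N -> forall x, pdvd 0 x ->
    pdvd N (eval_series R f x - (trunc_series D f).[x]).
Proof.
move=> fI; have [D0 fD] := scaled_I0_pdvd N fI; exists D0 => D DD x x0.
rewrite /eval_series; case: xgetP => [l _ /cvg_padicP lP|nex]; last first.
  by have [l /nex] := eval_series_cvg fI x0.
have [D1 lD] := lP N; have lD1 := lD (maxn D D1) (leq_maxr _ _).
rewrite trunc_seriesE.
have -> : l - \sum_(k < D) f k * x ^+ k =
   (\sum_(k < maxn D D1) f k * x ^+ k - \sum_(k < D) f k * x ^+ k)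
   - (\sum_(k < maxn D D1) f k * x ^+ k - l) by ring.
apply: pdvdB lD1; rewrite -!(big_mkord xpredT (fun k => f k * x ^+ k)).
rewrite (@big_cat_nat _ _ _ D) ?leq_maxl//= addrAC subrr add0r.
rewrite big_seq; apply: pdvd_sum => k; rewrite mem_index_iota => /andP[Dk _].
apply: pdvdMr; first by apply: fD; apply: leq_trans Dk.
by rewrite -[0](mul0rn _ k); apply: pdvdX.
Qed.

End Evaluation.

(** * Truncated power series and their inverses *)

Section FormalSeries.
Variable F : fieldType.
Implicit Types (P Q A B S : {poly F}) (f g : nat -> F).

(** Truncations stand for formal power series. The explicit cofactor makes compatibility with
    products and compositions a ring identity; [eqmodXP] gives the coefficientwise reading. *)
Definition eqmodX D P Q := exists S, P = Q + 'X^D * S.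

Lemma eqmodXP D P Q : eqmodX D P Q <-> forall i, (i < D)%N -> P`_i = Q`_i.
Proof.
split=> [[S ->] i iD|PQ]; first by rewrite coefD coefXnM iD addr0.
exists (drop_poly D (P - Q)); rewrite mulrC.
apply/eqP; rewrite addrC -subr_eq; apply/eqP.
rewrite -[LHS](poly_take_drop D) [take_poly _ _](_ : _ = 0) ?add0r//.
apply/polyP => i; rewrite coef_take_poly coefB coef0.
by case: ifP => // iD; rewrite PQ// subrr.
Qed.

Lemma eqmodX_refl D P : eqmodX D P P.
Proof. by exists 0; rewrite mulr0 addr0. Qed.

Lemma eqmodX_sym D P Q : eqmodX D P Q -> eqmodX D Q P.
Proof. by move=> /eqmodXP PQ; apply/eqmodXP => i iD; rewrite PQ. Qed.

Lemma eqmodX_trans D P Q S : eqmodX D P Q -> eqmodX D Q S -> eqmodX D P S.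
Proof. by move=> [U ->] [V ->]; exists (U + V); ring. Qed.

Lemma eqmodXD D P Q A B : eqmodX D P Q -> eqmodX D A B -> eqmodX D (P + A) (Q + B).
Proof. by move=> [U ->] [V ->]; exists (U + V); ring. Qed.

Lemma eqmodXN D P Q : eqmodX D P Q -> eqmodX D (- P) (- Q).
Proof. by move=> [U ->]; exists (- U); ring. Qed.

Lemma eqmodXB D P Q A B : eqmodX D P Q -> eqmodX D A B -> eqmodX D (P - A) (Q - B).
Proof. by move=> PQ AB; apply/eqmodXD/eqmodXN. Qed.

Lemma eqmodXM D P Q A B : eqmodX D P Q -> eqmodX D A B -> eqmodX D (P * A) (Q * B).
Proof. by move=> [U ->] [V ->]; exists (U * B + Q * V + 'X^D * U * V); ring. Qed.

Lemma eqmodXZ D c P Q : eqmodX D P Q -> eqmodX D (c *: P) (c *: Q).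
Proof. by move=> PQ; rewrite -!mul_polyC; apply: eqmodXM => //; apply: eqmodX_refl. Qed.

Lemma coef0_divX P : P`_0 = 0 -> exists S, P = 'X * S.
Proof.
move=> P0; have [|S ->] := (eqmodXP 1 P 0).2; last by exists S; rewrite add0r expr1.
by move=> [|//] _; rewrite P0 coef0.
Qed.

Lemma eqmodX_comp D P Q A B : A`_0 = 0 -> eqmodX D P Q -> eqmodX D A B ->
  eqmodX D (P \Po A) (Q \Po B).
Proof.
move=> /coef0_divX[A1 AE] [S ->] AB; apply: (@eqmodX_trans _ _ (Q \Po A)).
  rewrite comp_polyD comp_polyM comp_Xn_poly AE exprMn.
  by exists (A1 ^+ D * (S \Po ('X * A1))); ring.
elim/poly_ind: Q => [|q c IHq]; first by rewrite !comp_poly0; apply: eqmodX_refl.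
rewrite !comp_polyD !comp_polyM !comp_polyX !comp_polyC.
by apply: eqmodXD; [exact: eqmodXM|exact: eqmodX_refl].
Qed.

Lemma eqmodX_trunc D E f : (D <= E)%N -> eqmodX D (trunc_series E f) (trunc_series D f).
Proof.
move=> DE; apply/eqmodXP => i iD; rewrite !coef_poly iD.
by rewrite (leq_trans iD DE).
Qed.

Lemma trunc_seriesS D f : trunc_series D.+1 f = trunc_series D f + f D *: 'X^D.
Proof.
apply/polyP => i; rewrite coefD coefZ coefXn !coef_poly ltnS leq_eqVlt.
by case: ltngtP => //= [_|_|->]; rewrite ?mulr0 ?addr0 ?mulr1 ?add0r.
Qed.

Lemma coef_comp_scaleX P c i : (P \Po (c *: 'X))`_i = P`_i * c ^+ i.
Proof.
elim/poly_ind: P i => [|q k IHq] i; first by rewrite comp_poly0 coef0 mul0r.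
rewrite comp_polyD comp_polyM comp_polyX comp_polyC -scalerAr !coefD coefZ !coefMX !coefC.
case: i => [|i] /=; first by rewrite mulr0 !add0r mulr1.
by rewrite IHq exprS !addr0; ring.
Qed.

Lemma coef0_trunc D f : f 0%N = 0 -> (trunc_series D f)`_0 = 0.
Proof. by move=> f0; rewrite coef_poly; case: ifP. Qed.

Lemma eqmodX_comp_top P A D c : A`_0 = 0 -> (0 < D)%N ->
  eqmodX D.+1 (P \Po (A + c *: 'X^D)) (P \Po A + (P`_1 * c) *: 'X^D).
Proof.
move=> A0 D0; have [A1 AE] := coef0_divX A0.
elim/poly_ind: P => [|q k IHq].
  by rewrite !comp_poly0 coef0 mul0r scale0r addr0; apply: eqmodX_refl.
rewrite !comp_polyD !comp_polyM !comp_polyX !comp_polyC.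
have -> : (q * 'X + k%:P)`_1 = q`_0 by rewrite coefD coefMX coefC addr0.
have [S SE] : exists S, q \Po A = (q`_0)%:P + 'X * S.
  have /coef0_divX[S SE] : (q \Po A - (q`_0)%:P)`_0 = 0.
    rewrite coefB coefC eqxx -!horner_coef0 horner_comp.
    by rewrite [A.[0]]horner_coef0 A0 subrr.
  by exists S; rewrite -SE addrC subrK.
have [T TE] := IHq; rewrite TE -!mul_polyC.
case: D D0 {IHq TE} => // D _.
exists (T * (A + c%:P * ('X * 'X^D)) + S * c%:P + (q`_1 * c)%:P * A1
   + (q`_1 * c)%:P * c%:P * 'X^D).
by rewrite SE !polyCM AE !exprS; ring.
Qed.

(** The compositional inverse, one coefficient at a time: the new coefficient is the defect of f(g)
    = X in degree E divided by [f 1]. By [eqmodX_comp_top] this repairs degree E and leaves lower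
    degrees alone. *)
Fixpoint inverse_poly f D : {poly F} :=
  if D is E.+1 then inverse_poly f E +
    ((('X - (trunc_series E.+1 f \Po inverse_poly f E))`_E) / f 1%N) *: 'X^E
  else 0.

Definition inverse_series f : nat -> F := fun k => (inverse_poly f k.+1)`_k.

Lemma size_inverse_poly f D : (size (inverse_poly f D) <= D)%N.
Proof.
elim: D => [|D IHD] /=; first by rewrite size_poly0.
apply: leq_trans (size_polyD _ _) _; rewrite geq_max (leq_trans IHD)//=.
by apply: leq_trans (size_scale_leq _ _) _; rewrite size_polyXn.
Qed.

Lemma trunc_inverse f D : trunc_series D (inverse_series f) = inverse_poly f D.
Proof.
elim: D => [|D IHD]; first by apply/polyP => i; rewrite coef_poly coef0.
rewrite trunc_seriesS IHD {1}/inverse_series /= coefD coefZ coefXn eqxx mulr1.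
by rewrite nth_default ?add0r// size_inverse_poly.
Qed.

Lemma inverse_seriesE f D : inverse_series f D =
  ('X - (trunc_series D.+1 f \Po trunc_series D (inverse_series f)))`_D / f 1%N.
Proof.
rewrite {1}/inverse_series /= coefD coefZ coefXn eqxx mulr1 trunc_inverse.
by rewrite nth_default ?add0r// size_inverse_poly.
Qed.

Lemma inverse_series0 f : f 0%N = 0 -> inverse_series f 0 = 0.
Proof.
move=> f0; rewrite inverse_seriesE coefB coefX /= -horner_coef0 horner_comp.
by rewrite !horner_poly big_ord0 big_ord1 f0 !mul0r subrr mul0r.
Qed.

Lemma comp_inverse_series f D : f 0%N = 0 -> f 1%N != 0 ->
  eqmodX D (trunc_series D f \Po trunc_series D (inverse_series f)) 'X.
Proof.
move=> f0 f1; elim: D => [|[|D] IHD].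
- by apply/eqmodXP.
- apply/eqmodXP => -[|//] _; rewrite coefX /= -horner_coef0 horner_comp.
  by rewrite !horner_poly !big_ord1 f0 !mul0r.
have X0 : (trunc_series D.+1 (inverse_series f))`_0 = 0.
  exact/coef0_trunc/inverse_series0.
rewrite (trunc_seriesS D.+1 (inverse_series f)).
apply: eqmodX_trans (eqmodX_comp_top _ _ X0 _) _ => //.
apply/eqmodXP => i; rewrite ltnS leq_eqVlt => /predU1P[->|iD].
  rewrite coefD coefZ coefXn eqxx mulr1 coef_poly /= inverse_seriesE.
  by rewrite mulrCA divff// mulr1 coefB addrC subrK.
rewrite coefD coefZ coefXn (ltn_eqF iD) mulr0 addr0.
have /eqmodXP/(_ i iD) <- := IHD.
have /eqmodXP -> // : eqmodX D.+1 (trunc_series D.+2 f \Po trunc_series D.+1 (inverse_series f))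
   (trunc_series D.+1 f \Po trunc_series D.+1 (inverse_series f)).
apply: eqmodX_comp => //; last exact: eqmodX_refl.
exact: eqmodX_trunc.
Qed.

(* Reading off the coefficient of ['X^D] in [f (g ('X)) = 'X]. *)
Lemma right_inverse_coef f g D : f 1%N != 0 -> g 0%N = 0 -> (0 < D)%N ->
  eqmodX D.+1 (trunc_series D.+1 f \Po trunc_series D.+1 g) 'X ->
  f 1%N * g D = ('X - (trunc_series D.+1 f \Po trunc_series D g))`_D.
Proof.
move=> f1 g0 D0; rewrite (trunc_seriesS D g) => /eqmodXP/(_ D (leqnn _)).
have /eqmodXP -> // := @eqmodX_comp_top (trunc_series D.+1 f) (trunc_series D g) D (g D)
   (coef0_trunc D g0) D0.
rewrite coefB coefD coefZ [('X^D)`_D]coefXn eqxx mulr1 => <-.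
by rewrite coef_poly ltnS D0 addrC addKr.
Qed.

(** The right-hand side contains only [Y D], truncations below degree D and the difference of [f]
    and [h]; this is the induction step by which closeness of two series passes to their
    inverses. *)
Lemma inverse_sub_coef f h X Y D :
  f 1%N * X D = ('X - (trunc_series D.+1 f \Po trunc_series D X))`_D ->
  h 1%N * Y D = ('X - (trunc_series D.+1 h \Po trunc_series D Y))`_D ->
  f 1%N * (X D - Y D) = - ((f 1%N - h 1%N) * Y D)
    - (((trunc_series D.+1 f \Po trunc_series D X)
        - (trunc_series D.+1 f \Po trunc_series D Y))`_D
       + (trunc_series D.+1 (fun k => f k - h k) \Po trunc_series D Y)`_D).
Proof.
move=> eX eY.
have -> : trunc_series D.+1 (fun k => f k - h k) = trunc_series D.+1 f - trunc_series D.+1 h.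
  by apply/polyP => j; rewrite coefB !coef_poly; case: ifP; rewrite ?subrr.
have -> : f 1%N * (X D - Y D) = f 1%N * X D - h 1%N * Y D - (f 1%N - h 1%N) * Y D by ring.
by rewrite eX eY comp_polyB !coefB; ring.
Qed.

Section Binomial.
Hypothesis natF : forall n, (n.+1%:R : F) != 0.

Definition binom_coef (b : F) k : F := (\prod_(i < k) (b - i%:R)) / k`!%:R.

Lemma binom_coef0 b : binom_coef b 0 = 1.
Proof. by rewrite /binom_coef big_ord0 fact0 divr1. Qed.

Lemma binom_coefS b k : binom_coef b k.+1 *+ k.+1 = binom_coef b k * (b - k%:R).
Proof.
have kF : (k`!%:R : F) != 0 by case: k`! (fact_gt0 k) => // n _.
rewrite /binom_coef big_ord_recr /= factS natrM -mulr_natr.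
by field; rewrite kF ?natr1 ?nat1r natF.
Qed.

Lemma binom_coef_pred b k : binom_coef b k.+1 *+ k.+1 = b * binom_coef (b - 1) k.
Proof.
have kF : (k`!%:R : F) != 0 by case: k`! (fact_gt0 k) => // n _.
rewrite /binom_coef big_ord_recl /= mulr0n subr0 factS natrM -mulr_natr.
have -> : \prod_(i < k) (b - (bump 0 i)%:R) = \prod_(i < k) (b - 1 - i%:R).
  by apply: eq_bigr => i _; rewrite /bump /= natrD; ring.
by field; rewrite kF ?natr1 ?nat1r natF.
Qed.

Lemma binom_ode b D : eqmodX D ((1 + 'X) * (trunc_series D.+1 (binom_coef b))^`())
  (b *: trunc_series D.+1 (binom_coef b)).
Proof.
apply/eqmodXP => i iD; rewrite mulrDl mul1r coefD coefXM coefZ !coef_deriv !coef_poly.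
rewrite ltnS iD binom_coefS; case: i iD => [|i] iD /=.
  by rewrite addr0 subr0 mulrC.
by rewrite ltnS (ltnW iD) -[_ *+ i.+1]mulr_natr; ring.
Qed.

(** Both binomial series satisfy (1 + X) V' = b V. By the chain rule the composite Y satisfies (1 +
    X) Y' = Y with Y(0) = 1, and in characteristic 0 this equation determines Y = 1 + X. *)
Lemma binom_comp a b D : a * b = 1 ->
  eqmodX D.+1 (trunc_series D.+1 (binom_coef b) \Po (trunc_series D.+1 (binom_coef a) - 1))
    (1 + 'X).
Proof.
move=> ab; set V := trunc_series _ (binom_coef b); set U := trunc_series _ _ - 1.
have U0 : U`_0 = 0 by rewrite coefB coef1 coef_poly binom_coef0 subrr.
set Y := V \Po U; have odeU : eqmodX D ((1 + 'X) * U^`()) (a *: (1 + U)).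
  have -> : 1 + U = trunc_series D.+1 (binom_coef a) by rewrite /U addrC subrK.
  by rewrite /U derivB derivC subr0; apply: binom_ode.
have odeY : eqmodX D ((1 + 'X) * Y^`()) Y.
  rewrite deriv_comp mulrCA.
  apply: (@eqmodX_trans _ _ ((V^`() \Po U) * (a *: (1 + U)))).
    by apply: eqmodXM => //; apply: eqmodX_refl.
  have -> : (V^`() \Po U) * (a *: (1 + U)) = a *: (((1 + 'X) * V^`()) \Po U).
    by rewrite comp_polyM comp_polyD comp_polyX -[1]/(1%:P) comp_polyC -!mul_polyC; ring.
  have YE : Y = a *: (b *: Y) by rewrite scalerA ab scale1r.
  rewrite YE {YE}.
  apply: eqmodXZ; rewrite -comp_polyZ; apply: eqmodX_comp => //; first exact: (binom_ode b D).
  exact: eqmodX_refl.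
have Y0 : Y`_0 = 1.
  rewrite -horner_coef0 horner_comp [U.[0]]horner_coef0 U0 horner_coef0.
  by rewrite coef_poly binom_coef0.
(* Coefficientwise, (i + 1) Y_(i+1) = (1 - i) Y_i; the factor vanishes at i = 1, which kills all
   coefficients from degree 2 on. *)
have YS i : (i < D)%N -> Y`_i.+1 *+ i.+1 = Y`_i - Y`_i *+ i.
  move=> iD; have /eqmodXP/(_ i iD) := odeY.
  rewrite mulrDl mul1r coefD coefXM !coef_deriv => e.
  apply/eqP; rewrite eq_sym subr_eq -{1}e; apply/eqP.
  by case: i {iD e} => [|i] /=; rewrite ?mulr0n.
have Yhigh i : (i.+1 < D)%N -> Y`_i.+2 = 0.
  elim: i => [|i IHi] iD; have := YS _ iD; rewrite -mulr_natr.
    by rewrite mulr1n subrr => /eqP; rewrite mulf_eq0 (negPf (natF _)) orbF => /eqP.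
  rewrite IHi ?(ltnW iD)// mul0rn subrr => /eqP.
  by rewrite mulf_eq0 (negPf (natF _)) orbF => /eqP.
apply/eqmodXP => -[|[|i]] iD; rewrite coefD coef1 coefX /= ?addr0 ?add0r.
- exact: Y0.
- by have := YS 0%N iD; rewrite mulr1n mulr0n subr0 Y0.
exact: Yhigh.
Qed.

(* [A ((1 + c x)^b - 1)] and [((1 + z / A)^a - 1) / c] are mutually inverse
   when [a b = 1]. *)
Lemma binom_right_inverse a b (A c : F) D (f g : nat -> F) : a * b = 1 -> A != 0 -> c != 0 ->
  (forall k, f k = if k == 0%N then 0 else A * (binom_coef b k * c ^+ k)) ->
  (forall k, g k = if k == 0%N then 0 else binom_coef a k * A ^- k / c) ->
  eqmodX D.+1 (trunc_series D.+1 f \Po trunc_series D.+1 g) 'X.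
Proof.
move=> ab A0 c0 fE gE.
have -> : trunc_series D.+1 f =
    A *: ((trunc_series D.+1 (binom_coef b) \Po (c *: 'X)) - 1).
  apply/polyP => i; rewrite coefZ coefB coef1 coef_comp_scaleX !coef_poly fE.
  case: ltnP => iD; last by case: i iD => //= i _; rewrite mul0r subr0 mulr0.
  case: eqP => [->|_]; last by rewrite subr0.
  by rewrite binom_coef0 expr0 mulr1 subrr mulr0.
have -> : trunc_series D.+1 g =
    c^-1 *: ((trunc_series D.+1 (binom_coef a) - 1) \Po (A^-1 *: 'X)).
  apply/polyP => i; rewrite coefZ coef_comp_scaleX coefB coef1 !coef_poly gE.
  case: ltnP => iD; last by case: i iD => //= i _; rewrite subr0 mul0r mulr0.
  case: eqP => [->|_]; last by rewrite subr0 exprVn mulrC.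
  by rewrite binom_coef0 subrr mul0r mulr0.
rewrite comp_polyZ comp_polyB -comp_polyA comp_polyZ comp_polyX scalerA divff// scale1r.
rewrite [1 \Po _](_ : _ = 1); last by rewrite -[1]/(1%:P) comp_polyC.
rewrite comp_polyA.
have XE : 'X = A *: (((1 + 'X) \Po (A^-1 *: 'X)) - 1) :> {poly F}.
  rewrite comp_polyD comp_polyX -[1 in X in X \Po _]/(1%:P) comp_polyC addrAC subrr add0r.
  by rewrite scalerA divff// scale1r.
rewrite [X in eqmodX _ _ X]XE {XE}.
apply: eqmodXZ; apply: eqmodXB; last exact: eqmodX_refl.
apply: eqmodX_comp; last exact: eqmodX_refl.
  by rewrite coefZ coefX mulr0.
exact: binom_comp.
Qed.

End Binomial.
End FormalSeries.

(** * Antiderivatives, weighted coefficient bounds and the Legendre transform *)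

Definition int_series (F : fieldType) (f : nat -> F) : nat -> F :=
  fun k => if k is i.+1 then f i / k%:R else 0.

Section IntSeries.
Variable F : fieldType.
Hypothesis natF : forall n, (n.+1%:R : F) != 0.
Implicit Types (f : nat -> F) (P : {poly F}).

Lemma deriv_int_series f D : (trunc_series D.+1 (int_series f))^`() = trunc_series D f.
Proof.
apply/polyP => i; rewrite coef_deriv !coef_poly ltnS; case: ifP; last by rewrite mul0rn.
by move=> _ /=; rewrite -[LHS]mulr_natr divfK.
Qed.

Lemma eqmodX_int D P : P`_0 = 0 -> eqmodX D P^`() 0 -> eqmodX D.+1 P 0.
Proof.
move=> P0 /eqmodXP P'0; apply/eqmodXP => -[|i] iD; rewrite coef0//.
have := P'0 i iD; rewrite coef_deriv coef0 -mulr_natr => /eqP.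
by rewrite mulf_eq0 (negPf (natF _)) orbF => /eqP.
Qed.

Lemma comp_trunc_series f D (A : {poly F}) :
  trunc_series D f \Po A = \sum_(k < D) f k *: A ^+ k.
Proof.
rewrite /trunc_series poly_def raddf_sum /=.
by apply: eq_bigr => k _; rewrite comp_polyZ comp_Xn_poly.
Qed.

End IntSeries.

Section Weights.
Variables (p : prime_nat) (mu : nat).
Local Notation K := (padic p).
Implicit Types (f g : nat -> K) (c d v : int) (P Q A B : {poly K}).

Lemma padic_natS_neq0 n : (n.+1%:R : K) != 0.
Proof. by rewrite padic_natr_eq0. Qed.

(** From ord(k + 1) < p^ord(k + 1) <= k + 1. The bound is crude but uniform in p, and a weight of at
    least 2 absorbs it. *)
Lemma pdvd_divS c (x : K) k : pdvd c x -> pdvd (c - k%:Z) (x / k.+1%:R).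
Proof.
move=> cx; apply: pdvdMle cx (pval_dvd (pvalV (@pval_nat p k.+1 isT))).
have : (logn p k.+1 <= k)%N.
  rewrite -ltnS; apply: leq_trans (ltn_expl _ (prime_nat_gt1 p)) _.
  by apply: dvdn_leq => //; apply: pfactor_dvdnn.
by lia.
Qed.

Lemma pdvd_horner c P x : pdvd 0 x -> (forall i, pdvd c P`_i) -> pdvd c P.[x].
Proof.
move=> x0 Pc; rewrite horner_coef; apply: pdvd_sum => i _; apply: pdvdMr => //.
by rewrite -[0](mul0rn _ i); apply: pdvdX.
Qed.

(** That is, P(x) = p^c Q(p^mu x) with Q integral. Weight [- mu] is that of 'X, and series without
    constant term of this weight compose to such series. *)
Definition weighted c P := forall i, pdvd (mu%:Z * i%:Z + c) P`_i.

Lemma weightedM c d P Q : weighted c P -> weighted d Q -> weighted (c + d) (P * Q).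
Proof.
move=> cP dQ i; rewrite coefM; apply: pdvd_sum => j _.
apply: pdvdMle (cP j) (dQ (i - j)%N); have := ltn_ord j; nia.
Qed.

Lemma weighted1 : weighted 0 1.
Proof.
move=> i; rewrite coef1; case: eqP => [->|_]; last exact: pdvd0.
by rewrite mulr0; apply: pdvd_1.
Qed.

Lemma weightedX c P n : weighted c P -> weighted (c *+ n) (P ^+ n).
Proof.
move=> cP; elim: n => [|n IHn]; first exact: weighted1.
by rewrite exprS mulrS; apply: weightedM.
Qed.

Lemma weighted_sum c I (r : seq I) (Pr : pred I) (G : I -> {poly K}) :
  (forall i, Pr i -> weighted c (G i)) -> weighted c (\sum_(i <- r | Pr i) G i).
Proof. by move=> cG i; rewrite coef_sum; apply: pdvd_sum => j /cG. Qed.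

Lemma weightedZ c d (x : K) P : pdvd c x -> weighted d P -> weighted (c + d) (x *: P).
Proof.
move=> cx dP i; rewrite coefZ; apply: pdvdMle cx (dP i); lia.
Qed.

Lemma weighted_trunc c D f : (forall k, pdvd (mu%:Z * k%:Z + c) (f k)) ->
  weighted c (trunc_series D f).
Proof. by move=> cf i; rewrite coef_poly; case: ifP => // _; apply: pdvd0. Qed.

Lemma weighted_comp v f D A : weighted (- mu%:Z) A ->
  (forall k, pdvd (mu%:Z * k%:Z + v) (f k)) -> weighted v (trunc_series D f \Po A).
Proof.
move=> wA fv; rewrite comp_trunc_series; apply: weighted_sum => k _.
have -> : v = mu%:Z * (k : nat)%:Z + v + (- mu%:Z) *+ k.
  by rewrite -mulr_natr natz; ring.
by apply: weightedZ => //; apply: weightedX.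
Qed.

(** In A^k - B^k the factor A - B supplies [v]; each of the k - 1 other factors costs [mu], which
    the coefficient [f k] pays. *)
Lemma weighted_comp_sub v f D A B : (forall k, pdvd (mu%:Z * k%:Z - mu%:Z) (f k)) ->
  weighted (- mu%:Z) A -> weighted (- mu%:Z) B -> weighted v (A - B) ->
  weighted v ((trunc_series D f \Po A) - (trunc_series D f \Po B)).
Proof.
move=> fk wA wB wAB; rewrite !comp_trunc_series -sumrB; apply: weighted_sum => k _.
rewrite -scalerBr subrXX.
case: k => -[|k] kD /=; first by rewrite big_ord0 mulr0 scaler0 => i; rewrite coef0; apply: pdvd0.
have -> : v = (mu%:Z * k.+1%:Z - mu%:Z) + (v + (- mu%:Z) *+ k).
  by rewrite -mulr_natr natz (_ : k.+1%:Z = k%:Z + 1); [ring|lia].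
apply: weightedZ (fk _) _; apply: weightedM => //; apply: weighted_sum => i _.
have -> : (- mu%:Z) *+ k = (- mu%:Z) *+ (k - i) + (- mu%:Z) *+ i.
  by rewrite -mulrnDr; congr (_ *+ _); have := ltn_ord i; lia.
by apply: weightedM; apply: weightedX.
Qed.

Section Inverse.
Variable f : nat -> K.
Hypotheses (f0 : f 0%N = 0) (f1 : pval 0 (f 1%N)).
Hypothesis fk : forall k, pdvd (mu%:Z * k%:Z - mu%:Z) (f k).
Local Notation X := (inverse_series f).

Let f1_neq0 : f 1%N != 0. Proof. exact: pval_neq0 f1. Qed.

Lemma weighted_X : weighted (- mu%:Z) 'X.
Proof.
move=> i; rewrite coefX; case: eqP => [->|_]; last exact: pdvd0.
by rewrite mulr1 subrr; apply: pdvd_1.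
Qed.

Lemma weighted_inverse_trunc D : weighted (- mu%:Z) (trunc_series D X).
Proof.
elim: D => [|D IHD] i; first by rewrite coef_poly; apply: pdvd0.
rewrite coef_poly ltnS leq_eqVlt; case: (ltngtP i D) => //= [iD|->]; last first.
  rewrite inverse_seriesE coefB; rewrite -[X in pdvd X _]addr0.
  apply: pdvdM; last by apply/pval_dvd; rewrite -oppr0; apply: pvalV.
  apply: pdvdB; first exact: weighted_X.
  exact: weighted_comp.
by have := IHD i; rewrite coef_poly iD.
Qed.

Lemma pdvd_inverse_series k : pdvd (mu%:Z * k%:Z - mu%:Z) (X k).
Proof. by have := weighted_inverse_trunc k.+1 k; rewrite coef_poly leqnn. Qed.

(** Inversion does not increase the weighted distance. It is applied with [h] the binomial main
    term, whose inverse [Y] is known in closed form. *)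
Lemma pdvd_inverse_sub (v : int) (h Y : nat -> K) : h 0%N = 0 -> pval 0 (h 1%N) ->
  (forall k, pdvd (mu%:Z * k%:Z - mu%:Z) (h k)) ->
  (forall k, pdvd (mu%:Z * k%:Z + v) (f k - h k)) ->
  Y 0%N = 0 -> (forall k, pdvd (mu%:Z * k%:Z - mu%:Z) (Y k)) ->
  (forall D, eqmodX D.+1 (trunc_series D.+1 h \Po trunc_series D.+1 Y) 'X) ->
  forall k, pdvd (mu%:Z * k%:Z + v) (X k - Y k).
Proof.
move=> h0 h1 hk fhk Y0 Yk hY.
have X0 : X 0%N = 0 by exact: inverse_series0.
suff wXY D : weighted v (trunc_series D X - trunc_series D Y).
  by move=> k; have := wXY k.+1 k; rewrite coefB !coef_poly leqnn.
elim: D => [|D IHD] i; first by rewrite coefB !coef_poly subrr; apply: pdvd0.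
have := IHD i; rewrite !coefB !coef_poly !ltnS; case: (ltngtP i D) => // -> _.
case: D IHD => [|D] IHD; first by rewrite X0 Y0 subrr; apply: pdvd0.
have eX : f 1%N * X D.+1 = ('X - (trunc_series D.+2 f \Po trunc_series D.+1 X))`_D.+1.
  by rewrite [X D.+1]inverse_seriesE mulrCA divff// mulr1.
have eY := right_inverse_coef (pval_neq0 h1) Y0 (ltn0Sn D) (hY D.+1).
have wtX := weighted_inverse_trunc D.+1.
have wtY : weighted (- mu%:Z) (trunc_series D.+1 Y) by exact: weighted_trunc.
have key := inverse_sub_coef eX eY.
rewrite -[X in pdvd X _]subr0; apply: (pval_dvdM f1); rewrite key.
apply: pdvdB; first (apply: pdvdN; apply: pdvdMle (fhk 1%N) (Yk _); lia).
apply: pdvdD; first exact: weighted_comp_sub.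
exact: weighted_comp.
Qed.

(* [X] inverts [f], so [int_series f - j x] is stationary at [x = X j], and its
   critical value has derivative [- X j] in [j]. *)
Lemma legendre_transform (N : nat) : (1 < mu)%N -> exists D0, forall D, (D0 <= D)%N ->
  forall j : K, pdvd 0 j ->
  pdvd N ((trunc_series D (int_series f)).[(trunc_series D X).[j]]
    - j * (trunc_series D X).[j] - (trunc_series D (int_series (fun k => - X k))).[j]).
Proof.
move=> mu1; exists (N + mu.*2 + 2)%N => -[|D] DD j j0; first by lia.
set P := trunc_series D.+1 _; set Q := trunc_series D.+1 X; set S := trunc_series _ _.
have X0 : X 0%N = 0 by exact: inverse_series0.
have Q0 : Q`_0 = 0 by exact: coef0_trunc.
pose W := (P \Po Q) - 'X * Q - S.
have -> : P.[Q.[j]] - j * Q.[j] - S.[j] = W.[j] by rewrite /W !hornerE horner_comp.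
apply: pdvd_horner => // i.
have [iD|Di] := ltnP i D.+1.
  (* In low degrees the identity is exact: W has no constant term, and W' is (f(Q) - X) Q' up to a
     multiple of X^D. The terms in Q cancel because the phase is stationary at Q. *)
  suff /eqmodXP/(_ i iD) -> : eqmodX D.+1 W 0.
    by rewrite coef0; apply: pdvd0.
  apply: eqmodX_int; first exact: padic_natS_neq0.
    rewrite /W !coefB coefXM /= -horner_coef0 horner_comp [Q.[0]]horner_coef0 Q0.
    by rewrite horner_coef0 !coef_poly /= !subrr.
  have P' : P^`() = trunc_series D f by apply: deriv_int_series; exact: padic_natS_neq0.
  have S' : S^`() = - trunc_series D X.
    rewrite deriv_int_series; last exact: padic_natS_neq0.
    by apply/polyP => k; rewrite coefN !coef_poly; case: ifP; rewrite ?oppr0.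
  rewrite /W !derivB derivM derivX mul1r deriv_comp P' S' opprK.
  have -> : (trunc_series D f \Po Q) * Q^`() - (Q + 'X * Q^`()) + trunc_series D X =
     ((trunc_series D f \Po Q) - 'X) * Q^`() + (trunc_series D X - Q) by ring.
  have -> : 0 = 0 * Q^`() + 0 :> {poly K} by rewrite mul0r addr0.
  have QD : eqmodX D Q (trunc_series D X) by apply: eqmodX_trunc.
  apply: eqmodXD; last by rewrite -(subrr Q); apply: eqmodXB (eqmodX_sym QD) (eqmodX_refl _ _).
  apply: eqmodXM; last exact: eqmodX_refl.
  rewrite -(subrr 'X); apply: eqmodXB; last exact: eqmodX_refl.
  apply: eqmodX_trans (comp_inverse_series D f0 f1_neq0).
  by apply: eqmodX_comp => //; apply: eqmodX_refl.
have wQ : weighted (- mu%:Z) Q by exact: weighted_inverse_trunc.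
rewrite /W !coefB; apply: pdvdB; last first.
  by rewrite coef_poly ltnNge Di; apply: pdvd0.
apply: pdvdB; last first.
  rewrite coefXM; case: i Di => [//|i] Di /=.
  by apply: pdvd_le (wQ i); nia.
rewrite comp_trunc_series coef_sum; apply: pdvd_sum => -[[|k] kD] _ /=.
  by rewrite scale0r coef0; apply: pdvd0.
rewrite coefZ; apply: pdvdMle (pdvd_divS k (fk k)) (weightedX k.+1 wQ i).
by rewrite -mulr_natr natz; nia.
Qed.

End Inverse.
End Weights.

Lemma sum_periodic_shift (V : zmodType) (N : nat) (h : int -> V) (a : int) :
  (forall m, h (m + N%:Z) = h m) -> \sum_(i < N) h (i%:Z + a) = \sum_(i < N) h i%:Z.
Proof.
move=> hN.
have h1 (b : int) : \sum_(i < N) h (i%:Z + b + 1) = \sum_(i < N) h (i%:Z + b).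
  case: N hN => [|N] hN; first by rewrite !big_ord0.
  rewrite big_ord_recr [RHS]big_ord_recl /= addrC; congr (_ + _).
    by rewrite -(hN (0 + b)); congr h; lia.
  by apply: eq_bigr => i _; congr h; rewrite /bump /=; lia.
have hp (n : nat) (b : int) : \sum_(i < N) h (i%:Z + b + n%:Z) = \sum_(i < N) h (i%:Z + b).
  elim: n b => [|n IHn] b; first by apply: eq_bigr => i _; rewrite addr0.
  transitivity (\sum_(i < N) h (i%:Z + (b + n%:Z) + 1)).
    by apply: eq_bigr => i _; congr h; lia.
  by rewrite h1 -[RHS]IHn; apply: eq_bigr => i _; congr h; lia.
case: a => n.
  by have := hp n 0; under eq_bigr do rewrite addr0; move=> ->; apply: eq_bigr => i _; rewrite addr0.
rewrite -(hp n.+1 (Negz n)); apply: eq_bigr => i _; congr h.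
by rewrite NegzE; lia.
Qed.

Lemma mulf_cancel (F : fieldType) (a b x y : F) : a != 0 -> b != 0 ->
  a * x * y / (b * a) = x * (y / b).
Proof. by move=> a0 b0; field; rewrite a0 b0. Qed.

Lemma normc_sum (R : rcfType) I (r : seq I) (P : pred I) (G : I -> R[i]) :
  normc (\sum_(i <- r | P i) G i) <= \sum_(i <- r | P i) normc (G i).
Proof.
elim/big_rec2: _ => [|i y x _ h]; first by rewrite normc0.
by apply: le_trans (le_normcD _ _) _; rewrite lerD2l.
Qed.

(** * Stationary phase *)

Section StationaryPhase.
Variables (R : realType) (p : prime_nat).
Local Notation K := (padic p).
Local Notation psi := (@padic_e R p).

Lemma pdvd_intr (s : nat) (m : int) : pdvd s%:Z (m%:~R : K) <-> (p%:Z ^+ s %| m)%Z.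
Proof.
have [->|m0] := eqVneq m 0; first by split=> // _; apply: pdvd0.
have vm := @pval_int p m m0.
have -> : (p%:Z ^+ s %| m)%Z = (s <= logn p `|m|)%N.
  by rewrite dvdzE abszX pfactor_dvdn ?prime_nat_prime// absz_gt0.
split=> [/(pval_dvd_le vm)|sm]; first by rewrite lez_nat.
by apply: pdvd_le (pval_dvd vm); rewrite lez_nat.
Qed.

Lemma count_multiples (s t : nat) : (s <= t)%N ->
  (\sum_(x < p ^ t) (p ^ s %| x))%N = (p ^ (t - s))%N.
Proof.
move=> st; have pt0 : (0 < p ^ t)%N by rewrite expn_gt0 prime_nat_gt0.
have := divn_count_dvd (p ^ s) (p ^ t); rewrite -expnB ?prime_nat_gt0// => ->.
case: (p ^ t)%N pt0 (dvdn_exp2l p st) => // n _ pn.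
by rewrite big_ord_recl /= dvdn0 big_nat_recr//= pn addnC big_add1 /= big_mkord.
Qed.

Lemma pdvd_half c (x : K) : pdvd c x -> pdvd (c - 1) (x / 2%:R).
Proof. exact: (@pdvd_divS p c x 1). Qed.

Variables (phi F : int -> K) (b : K) (t : nat).
Hypothesis t_gt0 : (0 < t)%N.
Hypothesis b0 : pdvd 0 b.
Hypothesis taylor : forall x y : int, exists2 z : K, pdvd 0 z &
  phi (x + y) = phi x + y%:~R * F x + b * y%:~R ^+ 2 / 2%:R + p%:R ^+ 2 * y%:~R ^+ 2 * z.
Hypothesis F0 : forall x, pdvd 0 (F x).
Hypothesis F_sub : forall x y, exists2 u : K, pval 0 u & F x - F y = (x - y)%:~R * u.

(** The largest s with 2s < t. For y divisible by p^s the remainder p^2 y^2 z vanishes modulo p^t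
    because 2s + 2 >= t. For y divisible by p^(t-s) the quadratic term vanishes too, because 2(t -
    s) > t leaves one power of p for the halving at p = 2. *)
Let s := (t.-1)./2.

Definition complete_sum (j : int) : R[i] :=
  \sum_(x < p ^ t) psi ((phi x%:Z - j%:~R * x%:Z%:~R) / p%:R ^+ t).

Definition gauss_sum : R[i] :=
  \sum_(x < p ^ t) (if (p ^ s %| x)%N then psi (b * x%:R ^+ 2 / 2%:R / p%:R ^+ t) else 0).

(** Counting the multiples of p^s is enough: t - s <= t/2 + 1, so the bound is within a factor p of
    square-root size, and p^r absorbs that factor. *)
Lemma normc_gauss_sum : normc gauss_sum <= (p%:R : R) ^+ (t - s).
Proof.
have st : (s <= t)%N by rewrite /s; lia.
apply: le_trans (normc_sum _ _ _) _; rewrite -[leRHS]natrX -(count_multiples st) natr_sum.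
apply: ler_sum => x _; case: ifP => _; first by rewrite normc_psi.
by rewrite normc0.
Qed.

Lemma phase_taylor (j x y : int) : exists2 z, pdvd 0 z &
  psi ((phi (x + y) - j%:~R * (x + y)%:~R) / p%:R ^+ t) =
  psi ((phi x - j%:~R * x%:~R) / p%:R ^+ t) *
  psi ((y%:~R * (F x - j%:~R) + b * y%:~R ^+ 2 / 2%:R + p%:R ^+ 2 * y%:~R ^+ 2 * z) / p%:R ^+ t).
Proof.
have [z z0 hz] := taylor x y; exists z => //; rewrite -psiD -mulrDl; congr (psi (_ / _)).
by rewrite hz rmorphD mulrBr; move: (b * _ / _) (p%:R ^+ 2 * _ * z); rewrite /=; move=> u v; ring.
Qed.

Lemma phase_linear (e : nat) (j x y : int) : (p%:Z ^+ e %| y)%Z -> (t < e.*2)%N ->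
  psi ((phi (x + y) - j%:~R * (x + y)%:~R) / p%:R ^+ t) =
  psi ((phi x - j%:~R * x%:~R) / p%:R ^+ t) * psi (y%:~R * (F x - j%:~R) / p%:R ^+ t).
Proof.
move=> /pdvd_intr ye te; have [z z0 ->] := phase_taylor j x y; congr (_ * _); apply: psi_eq.
rewrite -mulrBl; apply/pdvd_divX; rewrite add0r.
set u := _ * (F x - _); set v := b * _ / _; set w := _ * z.
have -> : u + v + w - u = v + w by ring.
rewrite /v /w {u v w}.
have y2 : pdvd (e.*2)%:Z (y%:~R ^+ 2 : K).
  by have := pdvdX 2 ye; apply: pdvd_le; rewrite mulr2n; lia.
apply: pdvdD; last first.
  rewrite -mulrA; apply: pdvdMl; first by rewrite -natrX; apply: pdvd_nat.
  by apply: pdvdMr => //; apply: pdvd_le y2; lia.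
by apply: pdvd_le (pdvd_half (pdvdMl b0 y2)); lia.
Qed.

Lemma phase_periodic (j x : int) :
  psi ((phi (x + (p ^ t)%N%:Z) - j%:~R * (x + (p ^ t)%N%:Z)%:~R) / p%:R ^+ t) =
  psi ((phi x - j%:~R * x%:~R) / p%:R ^+ t).
Proof.
have ptE : (p ^ t)%N%:Z = p%:Z ^+ t by rewrite -[LHS]natz natrX natz.
rewrite (@phase_linear t); first last.
- by lia.
- by rewrite ptE.
rewrite [X in _ * X]psi_Zp ?mulr1//; apply/pdvd_divX; rewrite add0r.
apply: pdvdMr; last by apply: pdvdB => //; apply: pdvd_int.
by apply/pdvd_intr; rewrite ptE.
Qed.

(** Translations by multiples of p^(t-s) change the phase linearly, so averaging over them keeps
    only the x with F x congruent to j modulo p^s. By [F_sub] these form the class of [xj] modulo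
    p^s. Recentred at [xj], where the linear term vanishes, the phase is the quadratic one of
    [gauss_sum], the same for every [j]. *)
Lemma stationary_phase (j xj : int) : pdvd t%:Z (F xj - j%:~R) ->
  complete_sum j = psi ((phi xj - j%:~R * xj%:~R) / p%:R ^+ t) * gauss_sum.
Proof.
move=> Fxj.
pose h (x : int) := psi ((phi x - j%:~R * x%:~R) / p%:R ^+ t).
have h_per (x : int) : h (x + (p ^ t)%N%:Z) = h x by exact: phase_periodic.
set s' := (t - s)%N; have ss : (s + s' = t)%N by rewrite /s' /s; lia.
have ts' : (t < s'.*2)%N by rewrite /s' /s; lia.
have ps0 : ((p ^ s)%:R : R[i]) != 0 by rewrite pnatr_eq0 expn_eq0 -leqn0 leqNgt prime_nat_gt0.
have nearxj (x : int) : pdvd s%:Z (F x - j%:~R) <-> (p%:Z ^+ s %| x - xj)%Z.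
  rewrite -pdvd_intr; have [u uu Fu] := F_sub x xj.
  have Fs : pdvd s%:Z (F xj - j%:~R) by apply: pdvd_le Fxj; rewrite lez_nat /s; lia.
  have -> : F x - j%:~R = (x - xj)%:~R * u + (F xj - j%:~R) by rewrite -Fu addrA subrK.
  split=> [xs|xs]; last by apply: pdvdD => //; apply: pdvdMr => //; apply: pval_dvd.
  have := pdvdB xs Fs; rewrite addrK mulrC => /(pval_dvdM uu).
  by rewrite subr0.
have localized : complete_sum j =
    \sum_(x < p ^ t) (if (p%:Z ^+ s %| x%:Z - xj)%Z then h x%:Z else 0).
  apply: (mulfI ps0); rewrite mulr_natl -[X in _ *+ X]card_ord -sumr_const mulr_sumr.
  transitivity (\sum_(v < p ^ s) \sum_(x < p ^ t) h (x%:Z + (p ^ s' * v)%N%:Z)).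
    by apply: eq_bigr => v _; rewrite sum_periodic_shift.
  rewrite exchange_big /=; apply: eq_bigr => x _.
  transitivity (\sum_(v < p ^ s) h x%:Z * psi (v%:R * ((F x%:Z - j%:~R) / p%:R ^+ s))).
    apply: eq_bigr => v _; rewrite {1}/h (@phase_linear s')//; last first.
      by rewrite PoszM -[Posz (_ ^ _)]natz natrX natz dvdz_mulr.
    congr (_ * psi _).
    have -> : (p ^ s' * v)%N%:Z%:~R = p%:R ^+ s' * v%:R :> K.
      by rewrite -[LHS]/((p ^ s' * v)%:R) natrM natrX.
    have -> : (p%:R : K) ^+ t = p%:R ^+ s * p%:R ^+ s' by rewrite -exprD ss.
    by apply: mulf_cancel; exact: padic_pXn_neq0.
  rewrite -mulr_sumr psi_orthogonality; last first.
    apply/pdvd_divX; rewrite addNr; apply: pdvdB => //; exact: pdvd_int.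
  have -> : `[< pdvd 0 ((F x%:Z - j%:~R) / p%:R ^+ s) >] = (p%:Z ^+ s %| x%:Z - xj)%Z.
    apply/asboolP/idP => [/pdvd_divX|/nearxj ?]; first by rewrite add0r => /nearxj.
    by apply/pdvd_divX; rewrite add0r.
  by case: ifP; rewrite ?mulr0// mulrC.
pose h' (x : int) := if (p%:Z ^+ s %| x - xj)%Z then h x else 0.
have h'_per (x : int) : h' (x + (p ^ t)%N%:Z) = h' x.
  rewrite /h' h_per addrAC rpredDr//.
  by rewrite -[Posz (_ ^ _)]natz natrX natz dvdz_exp2l// /s; lia.
rewrite localized -(sum_periodic_shift xj h'_per) /gauss_sum mulr_sumr.
apply: eq_bigr => x _; rewrite /h' addrK.
have -> : (p%:Z ^+ s %| x%:Z)%Z = (p ^ s %| x)%N by rewrite dvdzE abszX.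
case: ifP => xs; last by rewrite mulr0.
have [z z0] := phase_taylor j xj x%:Z; rewrite [x%:Z + xj]addrC {1}/h => ->; rewrite -/(h xj); congr (_ * _).
have xK : pdvd s%:Z (x%:Z%:~R : K) by apply/pdvd_intr; rewrite dvdzE abszX.
apply: psi_eq; rewrite -mulrBl; apply/pdvd_divX; rewrite add0r.
rewrite [x%:R]/(x%:Z%:~R).
set u := x%:Z%:~R * _; set v := b * _ / _; set w := _ * z.
have -> : u + v + w - v = u + w by ring.
apply: pdvdD; first by apply: pdvdMl => //; apply: pdvd_int.
apply: pdvdMr => //; have := pdvdM (pdvd_pX p 2) (pdvdX 2 xK).
by apply: pdvd_le; rewrite mulr2n /s; lia.
Qed.

End StationaryPhase.

(** * The class F *)

Section BinomialValuation.
Variable p : prime_nat.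
Local Notation K := (padic p).

Lemma rat_ordV (y : rat) : y != 0 -> rat_ord p y^-1 = - rat_ord p y.
Proof.
move=> y0; apply: (@pval_uniq p _ _ (ratr y^-1)).
  by apply: pval_ratr; rewrite invr_eq0.
by rewrite padic_ratrV; apply/pvalV/pval_ratr.
Qed.

Lemma iota_negV (y : rat) : y != 0 -> iota_neg p y^-1 = iota_pos p y.
Proof. by move=> y0; rewrite /iota_neg /iota_pos rat_ordV// opprK. Qed.

Lemma iota_posV (y : rat) : y != 0 -> iota_pos p y^-1 = iota_neg p y.
Proof. by move=> y0; rewrite /iota_neg /iota_pos rat_ordV. Qed.

Lemma rat_ordE (y : rat) : rat_ord p y = (iota_pos p y)%:Z - (iota_neg p y)%:Z.
Proof. by rewrite /iota_neg /iota_pos; lia. Qed.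

Lemma pdvd_ratr (y : rat) : pdvd (- (iota_neg p y)%:Z) (ratr y : K).
Proof.
have [->|y0] := eqVneq y 0; first by rewrite (padic_ratrz p 0); apply: pdvd0.
by apply: pdvd_le (pval_dvd (pval_ratr p y0)); rewrite rat_ordE; lia.
Qed.

(** Differencing turns the exponent - y into - y - 1; this keeps the factor p^(iota + kappa) omega
    inside the binomial unchanged. *)
Lemma iota_negD1 (y : rat) : 0 < y -> iota_neg p (y + 1) = iota_neg p y.
Proof.
move=> y0; have yN0 : y != 0 by rewrite gt_eqF.
have y1N0 : y + 1 != 0 by rewrite gt_eqF// addr_gt0.
have vy := pval_ratr p yN0; have vy1 := pval_ratr p y1N0.
have ratr1 : ratr 1 = 1 :> K by exact: (padic_ratrz p 1).
have [lt0|ge0] := ltP (rat_ord p y) 0.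
  suff e : rat_ord p (y + 1) = rat_ord p y by rewrite /iota_neg e.
  apply: pval_uniq vy1 _; rewrite padic_ratrD ratr1; apply: pvalD vy _.
  by apply: pdvd_le (pdvd_1 p); lia.
have : 0 <= rat_ord p (y + 1).
  apply: pval_dvd_le vy1 _; rewrite padic_ratrD ratr1; apply: pdvdD (pdvd_1 p).
  exact: pdvd_le ge0 (pval_dvd vy).
by rewrite /iota_neg; lia.
Qed.

Lemma logn_fact_lt n : (0 < n)%N -> (logn p n`! < n)%N.
Proof.
move=> n0; rewrite logn_fact ?prime_nat_prime//.
(* Legendre's formula with a remainder that makes the induction run: with a = n / p^N, one has a/p +
   max(1, a/p) <= max(1, a) because p >= 2. *)
suff h N : (\sum_(1 <= k < N.+1) n %/ p ^ k + maxn 1 (n %/ p ^ N) <= n)%N by have := h n; lia.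
elim: N => [|N IHN]; first by rewrite big_nil expn0 divn1 add0n geq_max n0 leqnn.
rewrite big_nat_recr//=; apply: leq_trans IHN; rewrite -addnA leq_add2l.
rewrite expnS mulnC divnMA; set a := (n %/ p ^ N)%N.
have := leq_trunc_div a p; have := prime_nat_gt1 p; nia.
Qed.

Lemma pval_binom1 (Y c : K) v e : pval v Y -> pval e c ->
  pval (v + e) (binom_coef Y 1 * c ^+ 1).
Proof.
move=> vY ec; rewrite /binom_coef big_ord_recl big_ord0 mulr1 subr0 factS fact0 muln1 expr1 divr1.
exact: pvalM.
Qed.

(* [Y = -y] or [Y = -y - 1]; the factors of the numerator after the first one
   lose at most [p ^ iota_neg] each, the factorial at most [p ^ (k - 1)]. *)
Lemma pdvd_binom (Y c : K) (v : int) (i kappa k : nat) : pdvd v Y -> pdvd (- i%:Z) Y ->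
  pdvd (i + kappa)%N%:Z c -> (0 < kappa)%N ->
  pdvd (v + i%:Z + kappa%:Z + (kappa.-1 * k)%N%:Z) (binom_coef Y k.+1 * c ^+ k.+1).
Proof.
move=> vY iY ic kappa0; rewrite /binom_coef big_ord_recl /= subr0.
have prodv : pdvd (- (i * k)%N%:Z) (\prod_(j < k) (Y - (bump 0 j)%:R)).
  elim: k => [|k IHk]; first by rewrite big_ord0 muln0; apply: pdvd_1.
  rewrite big_ord_recr /=; apply: pdvdMle IHk (pdvdB iY _); last first.
    by apply: pdvd_le (pdvd_nat _ _); lia.
  by nia.
have factv : pdvd (- k%:Z) ((k.+1)`!%:R^-1 : K).
  apply: pdvd_le (pval_dvd (pvalV (pval_nat p (fact_gt0 k.+1)))).
  by have := @logn_fact_lt k.+1 isT; lia.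
apply: pdvdMle (pdvdM (pdvdM vY prodv) factv) (pdvdX k.+1 ic).
by rewrite -mulr_natr natz; nia.
Qed.

Lemma ratr_gbinom (y : rat) k : ratr (gbinom y k) = binom_coef (ratr y) k :> K.
Proof.
rewrite /gbinom /binom_coef padic_ratrM padic_ratrV padic_ratr_nat padic_ratr_prod.
by congr (_ / _); apply: eq_bigr => i _; rewrite padic_ratrD padic_ratrN padic_ratr_nat.
Qed.

End BinomialValuation.

Section ClassF.
Variables (R : realType) (p : prime_nat).
Local Notation K := (padic p).

Lemma ceil_natM (k mu : nat) : Num.ceil (k%:R * mu%:R : R) = (mu%:Z * k%:Z)%R.
Proof. by rewrite -natrM -[X in Num.ceil X]/((k * mu)%N%:Z%:~R) intrKceil; lia. Qed.

Lemma classF_elim w y kappa (lambda : R) u (mu : nat) (f : nat -> K) :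
  mu%:R <= lambda -> classF w y kappa lambda u f ->
  exists (omega omega' gamma : padic_int p) (g : nat -> K),
  [/\ omega \is a GRing.unit, omega' \is a GRing.unit,
     forall k, pdvd (mu%:Z * k%:Z) (g k) &
     forall k, deriv_series f k = p%:R ^ w * tofrac omega' *
          binom_series (- y) (p%:R ^+ (iota_neg p y + kappa) * tofrac omega) k
        + const_series (p%:R ^ w * tofrac gamma) k + p%:R ^ (u%:Z + w) * g k].
Proof.
move=> mul [om [om' [omu omu' [_ [ga [g [[_ gl] fE]]]]]]].
exists om, om', ga, g; split=> // k; have := gl k => /pdvd_ord; apply: pdvd_le.
by rewrite -ceil_natM; apply: ceil_le; rewrite ler_wpM2l.
Qed.

Lemma scaled_I0_growth (f : nat -> K) (c : int) :
  (forall k, pdvd (c + k%:Z) (f k.+1)) -> scaled_I0 R f.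
Proof.
move=> fc; have [e f0] : exists e, pdvd e (f 0%N).
  have [->|/pval_ord[e /pval_dvd fe]] := eqVneq (f 0%N) 0; last by exists e.
  by exists 0; apply: pdvd0.
pose d := Num.min c e; exists (p%:R ^ d), (fun k => p%:R ^ (- d) * f k).
have gk k : pdvd k%:Z (p%:R ^ (- d) * f k.+1).
  by apply/pdvd_pMl; rewrite opprK; apply: pdvd_le (fc k); rewrite /d; lia.
split.
- exact: padic_pX_neq0.
- apply: I0P => [[|k]|N].
  + by apply/pdvd_pMl; rewrite opprK; apply: pdvd_le f0; rewrite /d; lia.
  + by apply: pdvd_le (gk k); lia.
  + by exists N.+1 => -[//|k] Nk; apply: pdvd_le (gk k); lia.
- by move=> k; rewrite mulrA -expfzDr ?subrr ?expr0z ?mul1r//; exact: padic_p_neq0.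
Qed.

Lemma pdvd_binom_series (y : rat) kappa (mu : nat) (c : K) k : y != 0 -> (mu < kappa)%N ->
  pdvd (iota_neg p y + kappa)%N%:Z c -> pdvd (mu%:Z * k%:Z) (binom_series (- y) c k).
Proof.
move=> y0 muk ic; rewrite /binom_series ratr_gbinom; case: k => [|k].
  by rewrite binom_coef0 mulr0 mul1r; apply: pdvd_1.
have vY : pdvd (- (iota_neg p y)%:Z) (ratr (- y) : K).
  by rewrite padic_ratrN; apply/pdvdN/pdvd_ratr.
by apply: pdvd_le (pdvd_binom k vY vY ic _); nia.
Qed.

(** Membership in [scaled_I0] has to be recovered from the derivative: integration loses at most p^k
    in degree k + 1, so mu >= 2 still leaves a growth of p^k. *)
Lemma classF_intro w y kappa u (mu : nat) (f g : nat -> K)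
    (omega omega' gamma : padic_int p) : y != 0 -> (1 < mu)%N -> (mu < kappa)%N ->
  omega \is a GRing.unit -> omega' \is a GRing.unit ->
  (forall k, pdvd (mu%:Z * k%:Z) (g k)) ->
  (forall k, deriv_series f k = p%:R ^ w * tofrac omega' *
          binom_series (- y) (p%:R ^+ (iota_neg p y + kappa) * tofrac omega) k
        + const_series (p%:R ^ w * tofrac gamma) k + p%:R ^ (u%:Z + w) * g k) ->
  classF w y kappa (mu%:R : R) u f.
Proof.
move=> y0 mu1 muk omu omu' gk fE; exists omega, omega'; split=> //.
have cI : pdvd (iota_neg p y + kappa)%N%:Z (p%:R ^+ (iota_neg p y + kappa) * tofrac omega).
  by apply: pdvdMr (pdvd_tofrac _); apply: pdvd_pX.
have dk k : pdvd (w + mu%:Z * k%:Z) (deriv_series f k).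
  rewrite fE; apply: pdvdD; first apply: pdvdD.
  - apply: pdvdM (pdvd_binom_series k y0 muk cI); apply: pdvdMr (pdvd_tofrac _).
    exact: pdvd_pX.
  - rewrite /const_series; case: eqP => [->|_]; last exact: pdvd0.
    by rewrite mulr0 addr0; apply: pdvdMr (pdvd_tofrac _); apply: pdvd_pX.
  - by apply: pdvdMle (pdvd_pX p _) (gk k); lia.
split; last first.
  exists gamma, g; split=> //; split; last first.
    by move=> k; apply/pdvd_ord; rewrite ceil_natM.
  apply: I0P => [k|N]; first by apply: pdvd_le (gk k); lia.
  by exists N => k Nk; apply: pdvd_le (gk k); nia.
apply: (@scaled_I0_growth _ w) => k.
have -> : f k.+1 = deriv_series f k / k.+1%:R.
  by rewrite /deriv_series -[f _ *+ _]mulr_natr mulfK// padic_natr_eq0.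
by apply: pdvd_le (pdvd_divS k (dk k)); nia.
Qed.

End ClassF.

(** * Integral polynomials and the local expansion of the phase *)

Section IntegralPolynomials.
Variable p : prime_nat.
Local Notation K := (padic p).
Implicit Types (P : {poly K}) (x y : K).

Lemma deriv_integral P : (forall i, pdvd 0 P`_i) -> forall i, pdvd 0 P^`()`_i.
Proof. by move=> P0 i; rewrite coef_deriv; apply: pdvd_Mn. Qed.

Lemma taylor_integral P x y : (forall i, pdvd 0 P`_i) -> pdvd 0 x -> pdvd 0 y ->
  exists2 z, pdvd 0 z & P.[x + y] = P.[x] + y * P^`().[x] + y ^+ 2 * z.
Proof.
move=> + x0 y0; elim/poly_ind: P => [|q c IHq] P0.
  by exists 0 => //; rewrite deriv0 !horner0 !mulr0 !addr0.
have q0 i : pdvd 0 q`_i by have := P0 i.+1; rewrite coefD coefMX coefC addr0.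
have [z z0 qE] := IHq q0; exists (q^`().[x] + z * (x + y)).
  apply: pdvdD; first by apply: pdvd_horner => // i; apply: deriv_integral.
  by apply: pdvdMl => //; apply: pdvdD.
rewrite derivD derivM derivX derivC mulr1 addr0 !(hornerD, hornerM, hornerX, hornerC) qE.
by move: q.[x] q^`().[x] => u v; ring.
Qed.

Lemma horner_sub_integral P x y : (forall i, pdvd 0 P`_i) -> pdvd 0 x -> pdvd 0 y ->
  exists2 z, pdvd 0 z & P.[x] - P.[y] = (x - y) * z.
Proof.
move=> P0 x0 y0; have [z z0] := taylor_integral P0 y0 (pdvdB x0 y0).
rewrite addrC subrK => ->; exists (P^`().[y] + (x - y) * z); last by ring.
apply: pdvdD; first by apply: pdvd_horner => // i; apply: deriv_integral.
by apply: pdvdMl => //; apply: pdvdB.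
Qed.

Lemma int_approx (N : nat) x : pdvd 0 x -> exists m : int, pdvd N (x - m%:~R).
Proof.
move=> [z]; rewrite expr0z mul1r => ->; exists (z N).
have zN : 0 <= z N.
  by rewrite -residue_mod modz_ge0// expf_neq0// eqz_nat -lt0n prime_nat_gt0.
case E : (z N) zN => [k|//] _; have -> : (k%:Z%:~R : K) = tofrac k%:R by rewrite rmorph_nat.
rewrite -tofracB; apply/pdvd_residue.
rewrite -[z - _]/(padic_add z (padic_opp _)) /= natr_residue modzNm modzDmr.
by rewrite E subrr mod0z.
Qed.

End IntegralPolynomials.

Section PhasePolynomial.
Variables (p : prime_nat) (mu : nat) (f : nat -> padic p).
Local Notation K := (padic p).
Hypotheses (mu3 : (3 < mu)%N) (f0 : f 0%N = 0) (f1 : pval 0 (f 1%N)).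
Hypothesis fk : forall k, pdvd (mu%:Z * k%:Z - mu%:Z) (f k).
Variable E : nat.
Hypothesis E2 : (1 < E)%N.
Local Notation P := (trunc_series E.+1 (int_series f)).
Local Notation F := (trunc_series E f).

(** Origin of mu > 3: for the cubic coefficient the uniform estimate [pdvd_divS] leaves order mu -
    2, and two powers of p are required. *)
Lemma phase_coef i : (2 < i)%N -> pdvd 2%:Z (int_series f i).
Proof.
case: i => // i i2 /=; apply: pdvd_le (pdvd_divS i (fk i)); nia.
Qed.

(** Subtracting the quadratic term, which expands exactly, leaves p^2 times an integral polynomial,
    to which [taylor_integral] applies. *)
Lemma phase_taylor_expansion x y : pdvd 0 x -> pdvd 0 y -> exists2 z : K, pdvd 0 z &
  P.[x + y] = P.[x] + y * F.[x] + f 1%N * y ^+ 2 / 2%:R + p%:R ^+ 2 * y ^+ 2 * z.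
Proof.
move=> x0 y0.
pose Psi := (p%:R ^- 2) *: (P - (f 1%N / 2%:R) *: 'X^2).
have p2 : (p%:R : K) ^+ 2 != 0 by exact: padic_pXn_neq0.
have PE : P = (f 1%N / 2%:R) *: 'X^2 + p%:R ^+ 2 *: Psi.
  by rewrite scalerA divff// scale1r addrC subrK.
have Psi0 i : pdvd 0 Psi`_i.
  rewrite coefZ mulrC; apply/pdvd_divX; rewrite add0r coefB coefZ coefXn coef_poly.
  case: i => [|[|[|i]]] /=.
  - by rewrite mulr0 subr0; apply: pdvd0.
  - by rewrite f0 mul0r mulr0 subr0; case: ifP => _; apply: pdvd0.
  - by rewrite !ltnS E2 mulr1 subrr; apply: pdvd0.
  - rewrite mulr0 subr0; case: ifP => _; last exact: pdvd0.
    exact: (@phase_coef i.+3).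
have [z z0 zE] := taylor_integral Psi0 x0 y0; exists z => //.
have FE : F = (f 1%N / 2%:R) *: ('X *+ 2) + p%:R ^+ 2 *: Psi^`().
  rewrite -(deriv_int_series (@padic_natS_neq0 p) f) [in LHS]PE derivD !derivZ derivXn.
  by rewrite expr1.
clearbody Psi; rewrite FE PE !(hornerD, hornerZ, hornerX, hornerXn, mulr2n) zE.
have two : (2%:R : K) != 0 by rewrite padic_natr_eq0.
have -> : f 1%N * y ^+ 2 / 2%:R = f 1%N / 2%:R * y ^+ 2 by rewrite mulrAC.
move: (f 1%N / 2%:R) (p%:R ^+ 2) Psi.[x] Psi^`().[x] => c d u v.
by ring.
Qed.

Lemma phase_deriv_integral x : pdvd 0 x -> pdvd 0 F.[x].
Proof.
move=> x0; apply: pdvd_horner => // i; rewrite coef_poly; case: ifP => _; last exact: pdvd0.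
case: i => [|i]; first by rewrite f0; apply: pdvd0.
by apply: pdvd_le (fk i.+1); nia.
Qed.

Lemma phase_deriv_sub x y : pdvd 0 x -> pdvd 0 y ->
  exists2 u, pval 0 u & F.[x] - F.[y] = (x - y) * u.
Proof.
move=> x0 y0; pose Psi := (p%:R ^- 1) *: (F - f 1%N *: 'X).
have FE : F = f 1%N *: 'X + p%:R ^+ 1 *: Psi.
  by rewrite scalerA divff ?padic_pXn_neq0// scale1r addrC subrK.
have Psi0 i : pdvd 0 Psi`_i.
  rewrite coefZ mulrC; apply/pdvd_divX; rewrite add0r coefB coefZ coefX coef_poly.
  case: i => [|[|i]] /=.
  - by rewrite f0 mulr0 subr0; case: ifP => _; apply: pdvd0.
  - by rewrite E2 mulr1 subrr; apply: pdvd0.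
  - rewrite mulr0 subr0; case: ifP => _; last exact: pdvd0.
    by apply: pdvd_le (fk i.+2); nia.
have [z z0 zE] := horner_sub_integral Psi0 x0 y0.
exists (f 1%N + p%:R ^+ 1 * z).
  apply: pvalD f1 _; rewrite add0r -[1]addr0; apply: pdvdM => //.
  exact: pdvd_pX.
clearbody Psi; rewrite FE !(hornerD, hornerZ, hornerX); move: zE (p%:R ^+ 1) => + d; move: Psi.[x] Psi.[y] (f 1%N) => a b c zE.
have -> : a = b + (x - y) * z by rewrite -zE addrC subrK.
by ring.
Qed.

(** The extra power of p in the hypothesis pays for the halved quadratic term at p = 2. *)
Lemma phase_horner_sub x y (t : nat) : pdvd 0 x -> pdvd 0 y -> pdvd t.+1%:Z (x - y) ->
  pdvd t%:Z (P.[x] - P.[y]).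
Proof.
move=> x0 y0 xy; have [z z0 zE] := phase_taylor_expansion y0 (pdvdB x0 y0).
move: zE; rewrite addrC subrK => ->.
set u := _ * F.[y]; set v := f 1%N * _ / _; set s := _ * z.
have -> : P.[y] + u + v + s - P.[y] = u + v + s by move: P.[y] => q; ring.
have xy2 : pdvd t.+1%:Z ((x - y) ^+ 2).
  by rewrite expr2; apply: pdvdMl => //; apply: pdvdB.
apply: pdvdD; first apply: pdvdD.
- apply: pdvdMr; last exact: phase_deriv_integral.
  by apply: pdvd_le xy; lia.
- by apply: pdvd_le (pdvd_half (pdvdMl _ xy2)); [lia|exact: pval_dvd].
- apply: pdvdMr => //; apply: pdvdMl; last by apply: pdvd_le xy2; lia.
  by rewrite -natrX; apply: pdvd_nat.
Qed.

End PhasePolynomial.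

(** * Duality *)

Section DualClass.
Variables (R : realType) (p : prime_nat) (w : int) (y : rat) (kappa u v mu : nat).
Variables (omega omega' gamma : padic_int p) (f g : nat -> padic p).
Local Notation K := (padic p).
Local Notation iota := (iota_neg p y).
Local Notation iota' := (iota_pos p y).
Hypotheses (y_gt0 : 0 < y) (mu3 : (3 < mu)%N) (mu_kappa : (mu < kappa)%N).
Hypotheses (omegaU : omega \is a GRing.unit) (omegaU' : omega' \is a GRing.unit).
Hypothesis v_gt0 : (0 < v)%N.
Hypothesis v_u : (v + kappa + iota' <= u)%N.
Hypothesis gk : forall k, pdvd (mu%:Z * k%:Z) (g k).
Hypothesis fE : forall k, deriv_series f k = p%:R ^ w * tofrac omega' *
          binom_series (- y) (p%:R ^+ (iota + kappa) * tofrac omega) k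
        + const_series (p%:R ^ w * tofrac gamma) k + p%:R ^ (u%:Z + w) * g k.

(** The order of the linear coefficient of the main term of f', namely w + (iota + kappa) + ord y.
    Dividing by p^a makes that coefficient a unit. *)
Let a : int := w + kappa%:Z + iota'%:Z.

Definition phase_series (k : nat) : K :=
  if k == 0%N then 0 else p%:R ^ (- a) * deriv_series f k.

Let c : K := p%:R ^+ (iota + kappa) * tofrac omega.
Let A : K := tofrac omega' / p%:R ^+ (kappa + iota').
(** [h] is the main term A ((1 + c x)^(-y) - 1) of [phase_series], and [Y] is its inverse ((1 +
    z/A)^(-1/y) - 1) / c. *)
Let h (k : nat) : K := if k == 0%N then 0 else A * (binom_coef (ratr (- y)) k * c ^+ k).
Let Y (k : nat) : K := if k == 0%N then 0 else binom_coef (ratr (- y^-1)) k * A ^- k / c.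

Let yN0 : y != 0. Proof. by rewrite gt_eqF. Qed.
Let yNN0 : - y != 0. Proof. by rewrite oppr_eq0. Qed.

Let cv : pval (iota + kappa)%N c.
Proof. by rewrite -[X in pval X _]addr0; apply: pvalM (pval_tofrac omegaU); apply: pval_pX. Qed.

Let Av : pval (- (kappa + iota')%N%:Z) A.
Proof.
rewrite -[X in pval X _]add0r; apply: pvalM (pval_tofrac omegaU') _.
by apply: pvalV; apply: pval_pX.
Qed.

Let ordy : pval (iota'%:Z - iota%:Z) (ratr (- y) : K).
Proof. by rewrite padic_ratrN -rat_ordE; apply/pvalN/pval_ratr. Qed.

Let ordyV : pval (iota%:Z - iota'%:Z) (ratr (- y^-1) : K).
Proof.
rewrite padic_ratrN -opprB -rat_ordE -rat_ordV//.
by apply/pvalN/pval_ratr; rewrite invr_eq0.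
Qed.

Let h_bound k : pdvd (mu%:Z * k%:Z - mu%:Z) (h k).
Proof.
rewrite /h; case: k => [|k] /=; first exact: pdvd0.
have kappa0 : (0 < kappa)%N by lia.
have iY : pdvd (- iota%:Z) (ratr (- y) : K) by apply: pdvd_le (pval_dvd ordy); lia.
by apply: pdvdMle (pval_dvd Av) (pdvd_binom k (pval_dvd ordy) iY (pval_dvd cv) kappa0); nia.
Qed.

Let h1 : pval 0 (h 1%N).
Proof.
rewrite /h /=; have := pvalM Av (pval_binom1 ordy cv).
by congr pval; lia.
Qed.

Let AVv : pval (iota' + kappa)%N A^-1.
Proof. by have := pvalV Av; congr pval; lia. Qed.

Let Y_bound k : pdvd (mu%:Z * k%:Z - mu%:Z) (Y k).
Proof.
rewrite /Y; case: k => [|k] /=; first exact: pdvd0.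
have kappa0 : (0 < kappa)%N by lia.
have iY : pdvd (- iota'%:Z) (ratr (- y^-1) : K) by apply: pdvd_le (pval_dvd ordyV); lia.
rewrite -exprVn.
have := pdvd_binom k (pval_dvd ordyV) iY (pval_dvd AVv) kappa0.
by move=> B; apply: pdvdMle B (pval_dvd (pvalV cv)); nia.
Qed.

Let pwA : p%:R ^ w * tofrac omega' = p%:R ^ a * A.
Proof.
rewrite /A mulrCA /a -addrA expfzDr ?padic_p_neq0//; rewrite -PoszD -exprnP.
by rewrite mulfK ?padic_pXn_neq0// mulrC.
Qed.

Let phaseE k : phase_series k = h k +
  (if k == 0%N then 0 else p%:R ^ (u%:Z + w - a) * g k).
Proof.
rewrite /phase_series /h; case: k => [|k] /=; first by rewrite addr0.
rewrite fE /const_series /= addr0 /binom_series ratr_gbinom pwA mulrDr !mulrA.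
rewrite -!expfzDr ?padic_p_neq0// addNr expr0z mul1r [- a + _]addrC.
by congr (_ + _); rewrite -mulrA.
Qed.

Let phase_sub k : pdvd (mu%:Z * k%:Z + v%:Z) (phase_series k - h k).
Proof.
rewrite phaseE addrAC subrr add0r; case: eqP => [_|_]; first exact: pdvd0.
by apply: pdvdMle (pdvd_pX p _) (gk k); rewrite /a; lia.
Qed.

Lemma phase_series0 : phase_series 0 = 0. Proof. by []. Qed.

Lemma phase_series1 : pval 0 (phase_series 1).
Proof.
rewrite -(subrK (h 1%N) (phase_series 1)) addrC; apply: pvalD h1 _.
by apply: pdvd_le (phase_sub 1); lia.
Qed.

Lemma phase_series_bound k : pdvd (mu%:Z * k%:Z - mu%:Z) (phase_series k).
Proof.
rewrite -(subrK (h k) (phase_series k)); apply: pdvdD (h_bound k).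
by apply: pdvd_le (phase_sub k); lia.
Qed.

Local Notation X := (inverse_series phase_series).

Let X_sub k : pdvd (mu%:Z * k%:Z + v%:Z) (X k - Y k).
Proof.
apply: (@pdvd_inverse_sub p mu phase_series phase_series0 phase_series1 phase_series_bound v h Y) => //.
move=> D; apply: (@binom_right_inverse _ (@padic_natS_neq0 p) (ratr (- y^-1)) (ratr (- y)) A c) => //.
- by rewrite -padic_ratrM mulrNN mulVf// (padic_ratrz p 1).
- exact: pval_neq0 Av.
- exact: pval_neq0 cv.
Qed.

(** An antiderivative of p^a (M - X). The linear term carries the character e(jM/p^t) due to the
    starting point [M] of the sum; it changes only the constant term of the derivative, so it is
    absorbed by gamma. *)
Definition dual_series (M : int) (k : nat) : K :=
  p%:R ^ a * (int_series (fun k => - X k) k + (if k == 1%N then M%:~R else 0)).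

Lemma deriv_dual_series M k : deriv_series (dual_series M) k =
  p%:R ^ a * ((if k == 0%N then M%:~R else 0) - X k).
Proof.
rewrite /deriv_series /dual_series /= -mulrnAr mulrnDl; congr (_ * _).
rewrite -[(_ / _) *+ _]mulr_natr divfK ?padic_natr_eq0// addrC eqSS.
by case: k => [|k] //=; rewrite ?mulr1n ?mul0rn.
Qed.

Lemma classF_dual_series M :
  classF (w + iota'%:Z - iota%:Z) y^-1 kappa (mu%:R : R) v (dual_series M).
Proof.
pose w' := w + iota'%:Z - iota%:Z.
pose g' k := - p%:R ^ (a - (v%:Z + w')) * (X k - Y k).
(* Read off from p^a (M - Y): 1/A contributes the unit omega'^-1, - p^a/c the unit - omega^-1, and
   the constant p^a (1/c + M) gives gamma. The error p^a (X - Y) is divisible by p^v relative to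
   p^w'. *)
apply: (@classF_intro R p w' y^-1 kappa v mu (dual_series M) g' omega'^-1 (- omega^-1)
   (omega^-1 + p%:R ^+ (kappa + iota) * M%:~R)).
- by rewrite invr_eq0.
- by lia.
- by [].
- by rewrite unitrV.
- by rewrite unitrN unitrV.
- move=> k; apply: pdvdMle (pdvdN (pdvd_pX p _)) (X_sub k).
  by rewrite /a /w'; lia.
move=> k; rewrite deriv_dual_series /binom_series ratr_gbinom iota_negV//.
have -> : p%:R ^+ (iota' + kappa) * tofrac omega'^-1 = A^-1.
  by rewrite tofracV// /A invf_div addnC.
have -> : p%:R ^ w' * tofrac (- omega^-1) = - (p%:R ^ a / c).
  rewrite rmorphN mulrN /= tofracV// /c invfM mulrA; congr (- (_ / _)).
  rewrite exprnN -expfzDr ?padic_p_neq0//; congr (_ ^ _); rewrite /a /w'; lia.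
have -> : p%:R ^ w' * tofrac (omega^-1 + p%:R ^+ (kappa + iota) * M%:~R)
    = p%:R ^ a * (c^-1 + M%:~R).
  rewrite rmorphD rmorphM rmorphXn rmorph_nat rmorph_int /= tofracV// !mulrDr; congr (_ + _).
    rewrite /c invfM mulrA; congr (_ * _).
    rewrite exprnN -expfzDr ?padic_p_neq0//; congr (_ ^ _); rewrite /a /w'; lia.
  rewrite mulrA exprnP -expfzDr ?padic_p_neq0//; congr (_ ^ _ * _); rewrite /a /w'; lia.
have -> : p%:R ^ (v%:Z + w') * g' k = - p%:R ^ a * (X k - Y k).
  rewrite /g' mulrA mulrN -expfzDr ?padic_p_neq0//; congr (- _ ^ _ * _); lia.
rewrite /Y /const_series exprVn; case: k => [|k] /=.
  by rewrite binom_coef0 expr0 invr1; move: (p%:R ^ a) c^-1 M%:~R (X 0%N) => P C m x; ring.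
by move: (p%:R ^ a) c^-1 (binom_coef _ _) (A ^- _) (X _) => P C m x z; ring.
Qed.

End DualClass.

Section DualPhase.
Variables (R : realType) (p : prime_nat).
Local Notation K := (padic p).
Local Notation psi := (@padic_e R p).

Lemma psi_eq_div (x z : K) (t : nat) : pdvd t%:Z (x - z) -> psi (x / p%:R ^+ t) = psi (z / p%:R ^+ t).
Proof. by move=> xz; apply: psi_eq; rewrite -mulrBl; apply/pdvd_divX; rewrite add0r. Qed.

Lemma trunc_series_sub_pdvd (f : nat -> K) (D D' : nat) c x : (D <= D')%N -> pdvd 0 x ->
  (forall i, (D <= i)%N -> pdvd c (f i)) ->
  pdvd c ((trunc_series D' f).[x] - (trunc_series D f).[x]).
Proof.
move=> DD' x0 fc; rewrite -hornerN -hornerD; apply: pdvd_horner => // i.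
rewrite coefD coefN !coef_poly; case: (ltnP i D) => iD.
  by rewrite (leq_trans iD DD') subrr; apply: pdvd0.
by rewrite subr0; case: ifP => _; [exact: fc|exact: pdvd0].
Qed.

Lemma trunc_series_affine (F : fieldType) (f g : nat -> F) (a : F) D :
  (1 < D)%N -> g 0%N = 0 -> g 1%N = 0 -> (forall k, f k.+2 = a * g k.+2) ->
  trunc_series D f = (f 0%N)%:P + f 1%N *: 'X + a *: trunc_series D g.
Proof.
move=> D1 g0 g1 fg; apply/polyP => i.
rewrite !coefD coefC !coefZ coefX !coef_poly.
case: i => [|[|i]] /=.
- by rewrite (ltnW D1) g0 !mulr0 !addr0.
- by rewrite D1 g1 mulr0 mulr1 add0r addr0.
- by rewrite mulr0 !add0r; case: ifP => _; rewrite ?mulr0.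
Qed.

Lemma legendre_rearrange (F : comNzRingType) (P Q s j x B : F) :
  s - j * x - B = (P - j * Q - B) - ((P - s) - j * (Q - x)).
Proof. by ring. Qed.

Lemma int_series_bound (X : nat -> K) (mu t i : nat) : (1 < mu)%N ->
  (forall k, pdvd (mu%:Z * k%:Z - mu%:Z) (X k)) -> (t + mu.*2 + 2 <= i)%N ->
  pdvd t%:Z (int_series X i).
Proof.
move=> mu1 Xk; case: i => [|i] ti; first by lia.
by apply: pdvd_le (pdvd_divS i (Xk i)); nia.
Qed.

(** Both [n] and [t] survive duality, since w + iota' - iota + kappa + iota'(1/y) = w + kappa +
    iota'. The factor [G] is chosen before [M] and [j], so it comes out of every sum over
    frequencies. *)
Lemma dual_phase (w : int) (y : rat) (kappa u v mu n t : nat) (lambda : R) (f : nat -> K) :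
  0 < y -> (3 < mu)%N -> (mu < kappa)%N -> mu%:R <= lambda -> (0 < v)%N ->
  (v + kappa + iota_pos p y <= u)%N -> (0 < t)%N ->
  n%:Z = w + kappa%:Z + (iota_pos p y)%:Z + t%:Z -> classF w y kappa lambda u f ->
  exists (xi0 xi : K) (h : int -> R[i]) (G : R[i]),
  [/\ forall m : int, psi (eval_series R f m%:~R / p%:R ^+ n) = psi xi0 * psi (m%:~R * xi) * h m,
      forall m : int, h (m + (p ^ t)%N%:Z) = h m,
      normc G <= (p%:R : R) ^+ (t - (t.-1)./2) &
      forall M : int, exists2 f', classF (w + (iota_pos p y)%:Z - (iota_neg p y)%:Z) y^-1
           kappa (mu%:R : R) v f' &
        forall j : int, (\sum_(x < p ^ t) h x%:Z * psi (- (j%:~R * x%:Z%:~R) / p%:R ^+ t))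
            * psi (j%:~R * M%:~R / p%:R ^+ t) =
          G * psi (eval_series R f' j%:~R / p%:R ^+ n)].
Proof.
move=> y0 mu3 mu_kappa mul v0 vu t0 nE fF.
have [om [om' [ga [g [omu omu' gk fE]]]]] := classF_elim mul fF.
have fI : scaled_I0 R f by case: fF => ? [? [_ _ []]].
set F := phase_series w y kappa f.
have F0 : F 0%N = 0 by [].
have F1 : pval 0 (F 1%N) by exact: (phase_series1 y0 mu3 mu_kappa omu omu' v0 vu gk fE).
have Fk : forall k, pdvd (mu%:Z * k%:Z - mu%:Z) (F k).
  exact: (phase_series_bound y0 mu3 mu_kappa omu omu' v0 vu gk fE).
have dualF M : classF (w + (iota_pos p y)%:Z - (iota_neg p y)%:Z) y^-1
    kappa (mu%:R : R) v (dual_series w y kappa f M).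
  exact: (classF_dual_series R y0 mu3 mu_kappa omu omu' v0 vu gk fE).
have mu1 : (1 < mu)%N by lia.
set X := inverse_series F in dualF.
have X0 : X 0%N = 0 by exact: inverse_series0.
have Xk : forall k, pdvd (mu%:Z * k%:Z - mu%:Z) (X k) by exact: pdvd_inverse_series.
have [Df fD] := eval_series_trunc n fI.
have [Dl legendre] := legendre_transform F0 F1 Fk t mu1.
(* One truncation degree for the value of f modulo p^n, the Legendre identity and the tails modulo
   p^t. *)
pose E := (Df + Dl + t + mu.*2 + 2)%N.
have E2 : (1 < E)%N by rewrite /E; lia.
pose a : int := w + kappa%:Z + (iota_pos p y)%:Z.
have fS k : f k.+2 = p%:R ^ a * int_series F k.+2.
  rewrite /= /F /phase_series /= /deriv_series mulrA mulrA -/a -expfzDr ?padic_p_neq0//.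
  by rewrite subrr expr0z mul1r -[f _ *+ _]mulr_natr mulfK ?padic_natr_eq0.
have phi_t (x z : K) : (p%:R ^ a * x + z) / p%:R ^+ n = x / p%:R ^+ t + z / p%:R ^+ n.
  rewrite mulrDl; congr (_ + _); rewrite mulrAC mulrC; congr (_ * _).
  by rewrite exprnN -expfzDr ?padic_p_neq0// exprnN; congr (_ ^ _); rewrite nE /a; lia.
pose P := trunc_series E.+1 (int_series F); pose F' := trunc_series E F.
pose phi (m : int) := P.[m%:~R]; pose Fz (m : int) := F'.[m%:~R].
have b0 : pdvd 0 (F 1%N) by exact: pval_dvd.
have taylor (x z : int) : exists2 r : K, pdvd 0 r &
  phi (x + z) = phi x + z%:~R * Fz x + F 1%N * z%:~R ^+ 2 / 2%:R + p%:R ^+ 2 * z%:~R ^+ 2 * r.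
  have [r r0 rE] := phase_taylor_expansion mu3 F0 Fk E2 (pdvd_int p x) (pdvd_int p z).
  by exists r => //; rewrite /phi rmorphD.
have Fz0 x : pdvd 0 (Fz x) by apply: (phase_deriv_integral mu3 F0 Fk E2 (pdvd_int p x)).
have Fz_sub (x z : int) : exists2 r : K, pval 0 r & Fz x - Fz z = (x - z)%:~R * r.
  have [r r0 rE] := phase_deriv_sub mu3 F0 F1 Fk E2 (pdvd_int p x) (pdvd_int p z).
  by exists r => //; rewrite rmorphB.
exists (f 0%N / p%:R ^+ n), (f 1%N / p%:R ^+ n), (fun m => psi (phi m / p%:R ^+ t)),
  (gauss_sum R (F 1%N) t); split.
- move=> m; rewrite -!psiD; apply: psi_eq.
  have := fD E.+1 _ m%:~R (pdvd_int p m).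
  have intF1 : int_series F 1 = 0 by rewrite /= F0 mul0r.
  have E3 : (1 < E.+1)%N by lia.
  rewrite (trunc_series_affine E3 (erefl : int_series F 0 = 0) intF1 fS).
  rewrite !(hornerD, hornerZ, hornerX, hornerC) => fm.
  have e : f 0%N / p%:R ^+ n + m%:~R * (f 1%N / p%:R ^+ n) + phi m / p%:R ^+ t =
     (f 0%N + f 1%N * m%:~R + p%:R ^ a * phi m) / p%:R ^+ n.
    rewrite [_ + _ * phi m]addrC phi_t addrC mulrDl mulrA [_%:~R * _]mulrC.
    by [].
  rewrite e -mulrBl; apply/pdvd_divX; rewrite add0r; apply: fm.
  by rewrite /E; lia.
- move=> m; have := phase_periodic R t0 b0 taylor Fz0 0 m.
  by rewrite !mul0r !subr0.
- exact: normc_gauss_sum.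
move=> M; exists (dual_series w y kappa f M) => // j.
have Eh : \sum_(x < p ^ t) psi (phi x%:Z / p%:R ^+ t) * psi (- (j%:~R * x%:Z%:~R) / p%:R ^+ t)
   = complete_sum R phi t j.
  by apply: eq_bigr => x _; rewrite -psiD -mulrDl.
rewrite Eh.
pose Q := (trunc_series E.+1 X).[j%:~R].
have wX : weighted mu (- mu%:Z) (trunc_series E.+1 X) by apply: weighted_trunc.
have Q0 : pdvd 0 Q.
  apply: pdvd_horner (pdvd_int p j) _ => -[|i]; first by rewrite coef_poly X0; apply: pdvd0.
  by apply: pdvd_le (wX i.+1); nia.
(* The stationary point Q = X(j) is only a p-adic integer, while the sum runs over integers. The
   precision is t + 1 because [phase_horner_sub] loses one power of p. *)
have [xj xjQ] := int_approx t.+1 Q0.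
have F'Q : pdvd t%:Z (F'.[Q] - j%:~R).
  rewrite -horner_comp -[X in _ - X]hornerX -hornerN -hornerD.
  apply: pdvd_horner (pdvd_int p j) _ => i; rewrite coefD coefN.
  have : eqmodX E (F' \Po trunc_series E.+1 X) 'X.
    apply: eqmodX_trans (comp_inverse_series E F0 (pval_neq0 F1)).
    apply: eqmodX_comp; [exact: coef0_trunc|exact: eqmodX_refl|exact: eqmodX_trunc].
  move=> /eqmodXP/(_ i) eX; have [iE|Ei] := ltnP i E.
    by rewrite eX// subrr; apply: pdvd0.
  have wF : weighted mu (- mu%:Z) (F' \Po trunc_series E.+1 X) by apply: weighted_comp.
  apply: pdvd_le (pdvdB (wF i) (weighted_X p mu i)).
  by move: Ei; rewrite /E; nia.
have Fxj : pdvd t%:Z (Fz xj - j%:~R).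
  have [r r0 rE] := phase_deriv_sub mu3 F0 F1 Fk E2 Q0 (pdvd_int p xj).
  have -> : Fz xj - j%:~R = (F'.[Q] - j%:~R) - (F'.[Q] - Fz xj).
    by move: F'.[Q] (Fz xj) => A B; ring.
  apply: pdvdB => //; rewrite rE; apply: pdvdMr (pval_dvd r0).
  by apply: pdvd_le xjQ; lia.
rewrite (stationary_phase R t0 b0 taylor Fz0 Fz_sub Fxj).
rewrite mulrC mulrA [RHS]mulrC; congr (_ * _).
pose Psi := int_series (fun k => - X k).
have Psij : psi ((phi xj - j%:~R * xj%:~R) / p%:R ^+ t)
    = psi ((trunc_series E.+1 Psi).[j%:~R] / p%:R ^+ t).
  apply: psi_eq_div.
  have leg := legendre E.+1 _ j%:~R (pdvd_int p j).
  have {leg} leg : pdvd t%:Z (P.[Q] - j%:~R * Q - (trunc_series E.+1 Psi).[j%:~R]).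
    by apply: leg; rewrite /E; lia.
  have PQ := phase_horner_sub mu3 F0 F1 Fk E2 Q0 (pdvd_int p xj) xjQ.
  have jQ : pdvd t%:Z (j%:~R * (Q - xj%:~R)).
    by apply: pdvdMl; [exact: pdvd_int|apply: pdvd_le xjQ; lia].
  rewrite (@legendre_rearrange _ P.[Q] Q).
  by apply: pdvdB leg (pdvdB PQ jQ).
rewrite Psij mulrC -psiD; apply: psi_eq.
have [D0 dD] := eval_series_trunc n (R := R) (f := dual_series w y kappa f M)
  (let: ex_intro _ (ex_intro _ (And3 _ _ (conj h _))) := dualF M in h).
pose D := maxn D0 E.+1.
have := dD D (leq_maxl _ _) j%:~R (pdvd_int p j).
have D1 : (1 < D)%N by rewrite /D leq_max; apply/orP; right; lia.
have -> : trunc_series D (dual_series w y kappa f M) =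
    p%:R ^ a *: (trunc_series D Psi + M%:~R *: 'X).
  apply/polyP => i; rewrite coefZ coefD coefZ coefX !coef_poly.
  case: ifP => iD; first by rewrite /dual_series; congr (_ * (_ + _)); case: eqP; rewrite ?mulr1 ?mulr0.
  by rewrite add0r; case: eqP => [i1|_]; [rewrite i1 D1 in iD|rewrite !mulr0].
rewrite hornerZ hornerD hornerZ hornerX => ev.
have tail : pdvd t%:Z ((trunc_series D Psi).[j%:~R] - (trunc_series E.+1 Psi).[j%:~R]).
  apply: trunc_series_sub_pdvd; [exact: leq_maxr|exact: pdvd_int|] => i Ei.
  apply: (@int_series_bound _ mu) => // [k|]; first exact: pdvdN.
  by move: Ei; rewrite /E; lia.
have -> : (trunc_series E.+1 Psi).[j%:~R] / p%:R ^+ t + j%:~R * M%:~R / p%:R ^+ t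
    - eval_series R (dual_series w y kappa f M) j%:~R / p%:R ^+ n =
   - (((trunc_series D Psi).[j%:~R] - (trunc_series E.+1 Psi).[j%:~R]) / p%:R ^+ t)
   - (eval_series R (dual_series w y kappa f M) j%:~R
       - p%:R ^ a * ((trunc_series D Psi).[j%:~R] + M%:~R * j%:~R)) / p%:R ^+ n.
  rewrite [X in _ = _ - X]mulrBl; have := phi_t ((trunc_series D Psi).[j%:~R] + M%:~R * j%:~R) 0.
  rewrite addr0 mul0r addr0 => ->.
  rewrite mulrBl mulrDl [j%:~R * _]mulrC.
  move: (_ / p%:R ^+ n) (_ * _ / p%:R ^+ t) => A B.
  move: ((trunc_series D Psi).[_] / _) (_ / _) => C H; ring.
apply: pdvdB; first by apply/pdvdN/pdvd_divX; rewrite add0r.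
by apply/pdvd_divX; rewrite add0r.
Qed.

End DualPhase.

Lemma coef_comp_XaddC (F : fieldType) (f : nat -> F) D (s : F) k :
  (trunc_series D f \Po ('X + s%:P))`_k = \sum_(i < D) f i * s ^+ (i - k) * 'C(i, k)%:R.
Proof.
rewrite comp_trunc_series coef_sum; apply: eq_bigr => i _.
rewrite coefZ -mulrA; congr (_ * _); rewrite [_ + _]addrC exprDn coef_sum.
under eq_bigr do rewrite coefMn -rmorphXn coefCM coefXn.
have [ki|ik] := leqP k i.
  rewrite (bigD1 (inord k)) //= inordK// eqxx mulr1 big1 ?addr0 ?mulr_natr// => j jk.
  rewrite (_ : (k == j) = false) ?mulr0 ?mul0rn//.
  by apply: contraNF jk => /eqP ->; rewrite inord_val.
rewrite bin_small// mulr0 big1// => j _.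
rewrite (_ : (k == j) = false) ?mulr0 ?mul0rn//.
by apply/negbTE; rewrite neq_ltn (leq_trans _ ik) ?orbT// ltn_ord.
Qed.

Lemma binom_coef_shift (F : fieldType) (b c s W : F) k : (forall n, (n.+1%:R : F) != 0) ->
  W * (binom_coef b k.+1 * c ^+ k.+1) * s * k.+1%:R =
  W * s * c * b * (binom_coef (b - 1) k * c ^+ k).
Proof.
move=> nF; have := binom_coef_pred nF b k; rewrite exprS => e.
transitivity (W * s * c * (binom_coef b k.+1 * k.+1%:R) * c ^+ k); first by ring.
by rewrite mulr_natr e; ring.
Qed.

Lemma difference_rearrange (F : comNzRingType) (P Q T x y z : F) :
  x - y - z = ((x - P) - (y - Q)) - ((z - T) - (P - Q - T)).
Proof. by ring. Qed.

(** * Differencing *)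

Section Differencing.
Variables (R : realType) (p : prime_nat).
Local Notation K := (padic p).
Local Notation psi := (@padic_e R p).

(** With s = p^chi h, the derivative of the difference has coefficients sum over i > k of d_i C(i,
    k) s^(i-k). For i = k + 1 the binomial part is, by [binom_coef_pred], a factor of exact order w'
    times the series of exponent - y - 1. For i > k + 1 another factor s gives at least p^chi, with
    v <= chi; the part coming from [g] is small because v + kappa + iota' <= u. *)
Lemma difference_phase (w : int) (y : rat) (kappa u v mu n chi h : nat) (lambda : R)
    (f : nat -> K) :
  0 < y -> (1 < mu)%N -> (mu < kappa)%N -> mu%:R <= lambda ->
  (v <= chi)%N -> (v + kappa + iota_pos p y <= u)%N -> (0 < h)%N ->
  classF w y kappa lambda u f ->
  exists2 f', classF (w + kappa%:Z + (iota_pos p y)%:Z + (chi + logn p h)%N%:Z) (y + 1)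
           kappa (mu%:R : R) v f' &
    forall m : int, psi ((eval_series R f (m + (p ^ chi * h)%N%:Z)%:~R - eval_series R f m%:~R)
        / p%:R ^+ n) = psi (eval_series R f' m%:~R / p%:R ^+ n).
Proof.
move=> y0 mu1 mu_kappa mul v_chi vu h0 fF.
have [om [om' [ga [g [omu omu' gk fE]]]]] := classF_elim mul fF.
have fI : scaled_I0 R f by case: fF => ? [? [_ _ []]].
have natK := @padic_natS_neq0 p.
set e := (chi + logn p h)%N; set w' := w + _ + _ + e%:Z.
pose s : K := (p ^ chi * h)%N%:R.
have sv : pval e s.
  rewrite /s natrM /e PoszD; apply: pvalM; last exact: pval_nat.
  by rewrite natrX exprnP; apply: pval_pX.
pose c : K := p%:R ^+ (iota_neg p y + kappa) * tofrac om.
have cv : pval (iota_neg p y + kappa)%N c.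
  by rewrite -[X in pval X _]addr0; apply: pvalM (pval_tofrac omu); apply: pval_pX.
have yN0 : y != 0 by rewrite gt_eqF.
have ordy : pval ((iota_pos p y)%:Z - (iota_neg p y)%:Z) (ratr (- y) : K).
  by rewrite padic_ratrN -rat_ordE; apply/pvalN/pval_ratr.
have iY : pdvd (- (iota_neg p y)%:Z) (ratr (- y) : K) by apply: pdvd_le (pval_dvd ordy); lia.
pose W : K := p%:R ^ w * tofrac om'.
have Wv : pval w W by rewrite -[X in pval X _]addr0; apply: pvalM (pval_tofrac omu'); apply: pval_pX.
have [z zu zE] : pval w' (W * s * c * ratr (- y)).
  have := pvalM (pvalM (pvalM Wv sv) cv) ordy; congr pval.
  by rewrite /w' /e; lia.
have [Df fD] := eval_series_trunc n fI.
(* Beyond degree D the integrated main term is itself divisible by p^n. *)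
pose D := (Df + `|n%:Z - w'| + 2)%N.
pose P := trunc_series D.+1 f; pose Q := (P \Po ('X + s%:P)) - P.
pose d := deriv_series f.
pose B k : K := binom_coef (ratr (- y)) k * c ^+ k.
have dE k : d k.+1 = W * B k.+1 + p%:R ^ (u%:Z + w) * g k.+1.
  by rewrite /d fE /const_series /= addr0 /binom_series ratr_gbinom.
have P' : P^`() = trunc_series D d.
  by apply/polyP => i; rewrite coef_deriv !coef_poly ltnS; case: ifP; rewrite ?mul0rn.
have Q'E k : Q^`()`_k = \sum_(i < D) (d i * s ^+ (i - k) * 'C(i, k)%:R -
     (if (i : nat) == k then d k else 0)).
  rewrite derivB deriv_comp derivD derivX derivC addr0 mulr1 P' coefB coef_comp_XaddC sumrB.
  congr (_ - _); rewrite coef_poly; case: ltnP => [kD|Dk].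
    rewrite (bigD1 (Ordinal kD))//= eqxx big1 ?addr0// => i /negbTE ik.
    by rewrite -val_eqE /= in ik; rewrite ik.
  rewrite big1// => i _; rewrite (_ : _ == _ = false)//.
  by apply/negbTE; rewrite neq_ltn (leq_trans (ltn_ord i) Dk).
pose mn k : K := W * s * c * ratr (- y) * (binom_coef (ratr (- y) - 1) k * c ^+ k).
have mnE k : W * B k.+1 * s * k.+1%:R = mn k by exact: binom_coef_shift.
have term0 k i : (i <= k)%N ->
    d i * s ^+ (i - k) * 'C(i, k)%:R - (if i == k then d k else 0) = 0.
  move=> ik; have /eqP -> : (i - k == 0)%N by rewrite subn_eq0.
  rewrite expr0 mulr1; case: eqP => [->|/eqP iNk]; first by rewrite binn mulr1 subrr.
  by rewrite bin_small ?mulr0 ?subr0// ltn_neqAle iNk.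
have Q'small k : (k.+1 < D)%N -> pdvd (mu%:Z * k%:Z + (v%:Z + w')) (Q^`()`_k - mn k).
  move=> kD; have -> : mn k = \sum_(i < D) (if (i : nat) == k.+1 then mn k else 0).
    rewrite (bigD1 (Ordinal kD))//= eqxx big1 ?addr0// => i /negbTE ik.
    by rewrite -val_eqE /= in ik; rewrite ik.
  rewrite Q'E -sumrB; apply: pdvd_sum => -[i iD] _ /=.
  have [ik|ki] := leqP i k.
    rewrite term0// (_ : (i == k.+1) = false) ?subr0; first exact: pdvd0.
    by apply/negbTE; rewrite neq_ltn ltnS ik.
  rewrite (gtn_eqF ki) subr0; case: i ki iD => // i ki iD; rewrite dE.
  have gpart : pdvd (mu%:Z * k%:Z + (v%:Z + w')) (p%:R ^ (u%:Z + w) * g i.+1 * s ^+ (i.+1 - k) * 'C(i.+1, k)%:R).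
    apply: pdvdMr (pdvd_nat _ _).
    apply: pdvdMle (pdvdM (pdvd_pX p _) (gk i.+1)) (pdvdX (i.+1 - k) (pval_dvd sv)).
    by rewrite -mulr_natr natz /w'; nia.
  rewrite !mulrDl; case: eqP => [[ik]|/eqP ik].
    rewrite ik subSn// subnn expr1 binSn -mnE addrAC subrr add0r.
    by move: gpart; rewrite ik subSn// subnn expr1 binSn.
  rewrite subr0; apply: pdvdD gpart; apply: pdvdMr (pdvd_nat _ _).
  have ki2 : (k < i)%N by rewrite ltn_neqAle -ltnS ki andbT eq_sym -eqSS.
  have kappa0 : (0 < kappa)%N by lia.
  have Bi := pdvd_binom i (pval_dvd ordy) iY (pval_dvd cv) kappa0.
  apply: pdvdMle (pdvdM (pval_dvd Wv) Bi) (pdvdX (i.+1 - k) (pval_dvd sv)).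
  have [q iE] : exists q, i = (k + q.+1)%N by exists (i - k.+1)%N; lia.
  rewrite iE -mulr_natr natz /w'.
  have ve : (v <= e)%N by rewrite /e; lia.
  have -> : ((k + q.+1).+1 - k = q.+2)%N by lia.
  by nia.
pose g' k : K := if (k.+1 < D)%N then p%:R ^ (- (v%:Z + w')) * (Q^`()`_k - mn k) else 0.
pose d' k : K := mn k + p%:R ^ (v%:Z + w') * g' k.
(* Since [g'] is cut off at degree D, this series agrees with the polynomial Q in low degrees and
   continues with the main term alone. Keeping the constant term of Q makes the values agree, and
   not merely the derivatives. *)
pose f' k : K := if k is i.+1 then d' i / i.+1%:R else Q`_0.
have g'k k : pdvd (mu%:Z * k%:Z) (g' k).
  rewrite /g'; case: ifP => kD; last exact: pdvd0.
  by apply: pdvdMle (pdvd_pX p _) (Q'small k kD); lia.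
have f'E k : deriv_series f' k = d' k.
  by rewrite /deriv_series /= -[(_ / _) *+ _]mulr_natr divfK// padic_natr_eq0.
have f'F : classF w' (y + 1) kappa (mu%:R : R) v f'.
  apply: (@classF_intro R p w' (y + 1) kappa v mu f' g' om z 0) => //.
    by rewrite gt_eqF// addr_gt0.
  move=> k; rewrite f'E /d' /binom_series ratr_gbinom iota_negD1// -zE.
  rewrite /const_series rmorph0 mulr0 if_same addr0 opprD padic_ratrD.
  by rewrite (padic_ratrz p (-1)).
exists f' => // m.
have f'I : scaled_I0 R f' by case: f'F => ? [? [_ _ []]].
have [D0 f'D] := eval_series_trunc n f'I.
pose D' := maxn D0 D.+1.
apply: psi_eq_div.
have e1 : pdvd n%:Z (eval_series R f (m + (p ^ chi * h)%N%:Z)%:~R - P.[(m + (p ^ chi * h)%N%:Z)%:~R]).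
  by apply: fD (pdvd_int p _); rewrite /D; lia.
have e2 : pdvd n%:Z (eval_series R f m%:~R - P.[m%:~R]).
  by apply: fD (pdvd_int p _); rewrite /D; lia.
have e3 : pdvd n%:Z (eval_series R f' m%:~R - (trunc_series D' f').[m%:~R]).
  by apply: f'D (pdvd_int p _); rewrite /D'; apply: leq_maxl.
have e4 : pdvd n%:Z (Q.[m%:~R] - (trunc_series D' f').[m%:~R]).
  rewrite -hornerN -hornerD; apply: pdvd_horner (pdvd_int p _) _ => i.
  rewrite coefD coefN coef_poly; case: i => [|k].
    by rewrite (_ : (0 < D')%N) ?subrr; [apply: pdvd0|rewrite /D' leq_max orbT].
  have Qk : Q`_k.+1 = Q^`()`_k / k.+1%:R.
    by rewrite coef_deriv -[_ *+ _]mulr_natr mulfK// padic_natr_eq0.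
  rewrite Qk; case: (ltnP k.+1 D) => kD.
    have -> : (k.+1 < D')%N by apply: leq_trans (leq_maxr _ _); rewrite ltnW.
    rewrite /f' /d' /g' kD mulrA -expfzDr ?padic_p_neq0// subrr expr0z mul1r [mn k + _]addrC subrK subrr.
    exact: pdvd0.
  have -> : Q^`()`_k = 0.
    rewrite Q'E big1// => -[i iD] _ /=; apply: term0.
    by rewrite -ltnS (leq_trans iD).
  rewrite mul0r sub0r; apply: pdvdN; case: ifP => _; last exact: pdvd0.
  rewrite /f' /d' /g' ltnNge kD /= mulr0 addr0.
  have mnk : pdvd (w' + mu%:Z * k%:Z) (mn k).
    rewrite /mn; apply: pdvdM; first by exists z.
    have := @pdvd_binom_series p (y + 1) kappa mu c k.
    rewrite /binom_series ratr_gbinom opprD padic_ratrD (padic_ratrz p (-1)) iota_negD1//.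
    by apply=> //; [rewrite gt_eqF// addr_gt0|exact: pval_dvd].
  apply: pdvd_le (pdvd_divS k mnk).
  by move: kD; rewrite /D; nia.
have QE : Q.[m%:~R] = P.[(m + (p ^ chi * h)%N%:Z)%:~R] - P.[m%:~R].
  rewrite /Q hornerD hornerN horner_comp hornerD hornerX hornerC rmorphD.
  by [].
rewrite QE in e4.
rewrite (@difference_rearrange _ P.[(m + (p ^ chi * h)%N%:Z)%:~R] P.[m%:~R]
  (trunc_series D' f').[m%:~R]).
exact: pdvdB (pdvdB e1 e2) (pdvdB e3 e4).
Qed.

End Differencing.

Lemma sum_splitD (V : nmodType) (G : nat -> V) N n m : N = (n + m)%N ->
  \sum_(j < N) G j = \sum_(j < n) G j + \sum_(j < m) G (n + j)%N.
Proof. by move=> ->; rewrite big_split_ord. Qed.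

(** * Estimates for complex sums *)

Section ExponentialSums.
Variable R : realType.
Implicit Types (x theta : R) (c d : nat -> R[i]) (b L : nat).

Lemma normc_ge0 (z : R[i]) : 0 <= normc z.
Proof. by case: z => u v; apply: sqrtr_ge0. Qed.

Lemma normc_Re_le (z : R[i]) : `|complex.Re z| <= normc z.
Proof. by case: z => u v /=; rewrite -sqrtr_sqr ler_wsqrtr// lerDl sqr_ge0. Qed.

Lemma normc_conj (z : R[i]) : normc (z^*)%C = normc z.
Proof. by case: z => u v /=; rewrite sqrrN. Qed.

Lemma normc_sub (z z' : R[i]) : normc (z - z') <= normc z + normc z'.
Proof. by rewrite -(normcN z'); apply: le_normcD. Qed.

Lemma normcX (z : R[i]) n : normc (z ^+ n) = normc z ^+ n.
Proof.
elim: n => [|n IHn]; first exact: normc1.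
by rewrite !exprS normcM IHn.
Qed.

Lemma abs_sin_le x : `|sin x| <= `|x|.
Proof.
wlog x0 : x / 0 <= x.
  move=> h; have [/h//|/ltW x0] := leP 0 x.
  by rewrite -normrN -sinN -[leRHS]normrN; apply: h; rewrite oppr_ge0.
have [u _] : exists2 u, u \in `[0, x]%R & sin x - sin 0 = cos u * (x - 0).
  apply: MVT_segment => // u; apply: continuous_subspaceT => ?; exact: continuous_sin.
rewrite sin0 !subr0 => ->; rewrite normrM -[leRHS]mul1r ler_wpM2r//.
by rewrite ler_norml cos_geN1 cos_le1.
Qed.

Lemma normc_expi_sub1 x : 0 <= x -> normc (expi x - 1) <= 8 * x.
Proof.
move=> x0; have -> : normc (expi x - 1) = 2 * `|sin (pi * x)|.
  rewrite /expi /= subr0.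
  have -> : 2 * pi * x = pi * x *+ 2 by rewrite -mulrA mulr_natl.
  have -> : (cos (pi * x *+ 2) - 1) ^+ 2 + sin (pi * x *+ 2) ^+ 2 = (2 * sin (pi * x)) ^+ 2.
    have := cos2Dsin2 (pi * x); rewrite cos_mulr2n sin_mulr2n.
    move: (cos _) (sin _) => u v uv; apply/eqP; rewrite -subr_eq0.
    have -> : (u ^+ 2 *+ 2 - 1 - 1) ^+ 2 + (u * v *+ 2) ^+ 2 - (2 * v) ^+ 2 =
      4 * (u ^+ 2 + v ^+ 2 - 1) * (u ^+ 2 - 1) :> R by ring.
    by rewrite uv subrr mulr0 mul0r.
  by rewrite sqrtr_sqr normrM ger0_norm.
have := abs_sin_le (pi * x); rewrite [X in _ <= X]ger0_norm; last first.
  by rewrite mulr_ge0// pi_ge0.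
have : pi * x <= 4 * x.
  rewrite ler_wpM2r//; have := pihalf_02 R; lra.
lra.
Qed.

Lemma expi_far x : 1 / 4 <= x <= 3 / 4 -> 1 <= normc (expi x - 1).
Proof.
move=> /andP[x1 x3]; apply: le_trans (normc_Re_le _); rewrite /expi /= .
have -> : 2 * pi * x = (2 * pi * x - pi) + pi by ring.
rewrite cosDpi; have : 0 <= cos (2 * pi * x - pi).
  have pi0 := pi_gt0 R; apply: cos_ge0_pihalf; apply/andP; split; nra.
move: (cos _) => u u0; rewrite ler0_norm; lra.
Qed.

(** A small x is multiplied by an integer q with 1/4 < q x <= 1/4 + x. There [expi_far] gives
    distance at least 1 from 1, while |e(qx) - 1| <= q |e(x) - 1|; since q x <= 1, the claim
    follows. *)
Lemma normc_expi_sub1_ge x : 0 < x <= 3 / 4 -> x <= normc (expi x - 1).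
Proof.
move=> /andP[x0 x3]; have [x1|x1] := leP (1 / 4) x.
  by apply: le_trans (expi_far _); [lra|rewrite x1].
pose q := (Num.truncn (x *+ 4)^-1).+1.
have x4 : 0 < x *+ 4 by rewrite pmulrn_lgt0.
have xq : (x *+ 4)^-1 < q%:R by rewrite truncnS_gt.
have qx : q%:R <= (x *+ 4)^-1 + 1.
  by rewrite -natr1 lerD2r truncn_le// invr_ge0 ltW.
have qx1 : 1 / 4 < q%:R * x.
  move: xq; rewrite -[_^-1]div1r ltr_pdivrMr// -mulr_natr; lra.
have qx2 : q%:R * x <= 1 / 4 + x.
  have : q%:R * x <= ((x *+ 4)^-1 + 1) * x by rewrite ler_wpM2r// ltW.
  rewrite mulrDl mul1r; have -> : (x *+ 4)^-1 * x = 1 / 4 by rewrite -mulr_natr; field; lra.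
  by [].
have far : 1 <= normc (expi (q%:R * x) - 1) by apply: expi_far; lra.
have : normc (expi (q%:R * x) - 1) <= q%:R * normc (expi x - 1).
  rewrite mulr_natl expiMn subrX1 normcM mulrC ler_wpM2r ?normc_ge0//.
  apply: le_trans (normc_sum _ _ _) _.
  under eq_bigr do rewrite normcX normc_expi expr1n.
  by rewrite sumr_const card_ord.
have q0 : 0 < q%:R :> R by rewrite ltr0n.
have : q%:R * x <= 1 by lra.
move=> h1 h2; rewrite -(ler_pM2l q0); lra.
Qed.

Definition geom_sum b theta : R[i] := \sum_(i < b) expi (i.+1%:R * theta).

Lemma normc_geom_sum_triv b theta : normc (geom_sum b theta) <= b%:R.
Proof.
apply: le_trans (normc_sum _ _ _) _.
under eq_bigr do rewrite normc_expi.
by rewrite sumr_const card_ord.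
Qed.

Lemma normc_geom_sum b theta : 0 < theta <= 3 / 4 -> normc (geom_sum b theta) <= 2 / theta.
Proof.
move=> th; have th0 : 0 < theta by case/andP: th.
have e : (expi theta - 1) * geom_sum b theta = expi theta * (expi (b%:R * theta) - 1).
  rewrite /geom_sum mulr_natl expiMn subrX1 mulrCA; congr (_ * _); rewrite mulr_sumr.
  by apply: eq_bigr => i _; rewrite mulr_natl expiMn exprS.
have h := normc_expi_sub1_ge th.
rewrite ler_pdivlMr// mulrC.
apply: le_trans (_ : normc (expi theta - 1) * normc (geom_sum b theta) <= _).
  by rewrite ler_wpM2r ?normc_ge0.
rewrite -normcM e normcM normc_expi mul1r.
by apply: le_trans (normc_sub _ _) _; rewrite normc_expi normc1.
Qed.

Lemma abel_summation c d L : \sum_(j < L.+1) c j * d j =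
  (\sum_(j < L.+1) c j) * d L - \sum_(j < L) (\sum_(i < j.+1) c i) * (d j.+1 - d j).
Proof.
elim: L => [|L IHL]; first by rewrite !big_ord1 big_ord0 subr0.
rewrite big_ord_recr /= IHL [\sum_(j < L.+2) c j]big_ord_recr /=.
by rewrite [\sum_(j < L.+1) _ * (d _ - _)]big_ord_recr /=; ring.
Qed.

Lemma abel_bound c d L (E A V : R) : 0 <= A -> 0 <= V ->
  (forall l, (l <= L)%N -> normc (\sum_(j < l) c j) <= E) ->
  (forall j, (j < L)%N -> normc (d j) <= A) ->
  (forall j, (j.+1 < L)%N -> normc (d j.+1 - d j) <= V) ->
  normc (\sum_(j < L) c j * d j) <= E * (A + L%:R * V).
Proof.
move=> A0 V0 cE dA dV; have E0 : 0 <= E by apply: le_trans (cE 0%N isT); apply: normc_ge0.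
case: L cE dA dV => [|L] cE dA dV.
  by rewrite big_ord0 normc0 mul0r addr0 mulr_ge0.
rewrite abel_summation; apply: le_trans (normc_sub _ _) _; rewrite mulrDr lerD//.
  by rewrite normcM ler_pM ?normc_ge0 ?cE ?dA.
apply: le_trans (normc_sum _ _ _) _.
apply: (@le_trans _ _ (\sum_(i < L) E * V)).
  apply: ler_sum => i _; rewrite normcM ler_pM ?normc_ge0//.
    by apply: cE; rewrite ltnS; apply: ltnW.
  by apply: dV; rewrite ltnS.
by rewrite sumr_const card_ord -mulrnAr ler_wpM2l// mulr_natl ler_wpMn2l.
Qed.

(* [D_b theta = geom_sum b theta] is at most [A] for all shorter sums, so it varies by
   at most [16 A b eta] when [theta] moves by [eta]. *)
Lemma normc_geom_sum_sub b theta eta (A : R) : 0 <= eta ->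
  (forall l, (l <= b)%N -> normc (geom_sum l theta) <= A) ->
  normc (geom_sum b (theta + eta) - geom_sum b theta) <= A * (16 * b%:R * eta).
Proof.
move=> eta0 DA.
have -> : geom_sum b (theta + eta) - geom_sum b theta =
    \sum_(i < b) expi (i.+1%:R * theta) * (expi (i.+1%:R * eta) - 1).
  by rewrite -sumrB; apply: eq_bigr => i _; rewrite mulrDr expiD; ring.
apply: le_trans (@abel_bound (fun i => expi (i.+1%:R * theta)) (fun i => expi (i.+1%:R * eta) - 1)
  b A (8 * b%:R * eta) (8 * eta) _ _ _ _ _) _.
- by rewrite !mulr_ge0.
- by rewrite mulr_ge0.
- by move=> l /DA.
- move=> j jb; apply: le_trans (normc_expi_sub1 _) _; first by rewrite mulr_ge0.
  by rewrite mulrA ler_wpM2r// ler_wpM2l// ler_nat.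
- move=> j _; have -> : expi (j.+2%:R * eta) - 1 - (expi (j.+1%:R * eta) - 1) =
      expi (j.+1%:R * eta) * (expi eta - 1).
    by rewrite -[j.+2%:R]natr1 mulrDl mul1r expiD; ring.
  by rewrite normcM normc_expi mul1r normc_expi_sub1.
rewrite le_eqVlt; apply/orP; left; apply/eqP; ring.
Qed.

Variables (T b : nat) (E : R).
Hypotheses (T1 : (1 < T)%N) (b0 : (0 < b)%N) (bT : (b <= T)%N).
Let KE := (T %/ b)%N.

Let K_gt0 : (0 < KE)%N. Proof. by rewrite divn_gt0. Qed.
Let Kb : (KE * b <= T)%N. Proof. exact: leq_divM. Qed.
Let TK : (T <= (b * KE).*2)%N.
Proof. by have := ltn_ceil T b0; rewrite -/KE; nia. Qed.

(** A bound for [geom_sum b] on the i-th block of KE = T / b frequencies: there theta >= i KE / T >=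
    i / (2b), so 2 / theta <= 4b / i; the block at 0 gets the trivial bound. *)
Definition block_weight (i : nat) : R := if i == 0%N then b%:R else 4 * b%:R / i%:R.

Lemma block_weight_ge0 i : 0 <= block_weight i.
Proof. by rewrite /block_weight; case: ifP => // _; rewrite divr_ge0// mulr_ge0. Qed.

Let TR0 : 0 < T%:R :> R. Proof. by rewrite ltr0n ltnW. Qed.

(** Partial summation; 17 = 1 + 16, where 1 is the size of the geometric sum and 16 its total
    variation over at most KE steps of length 1/T, as KE b <= T. *)
Lemma block_bound c (beta : R) (i L : nat) : 0 <= beta ->
  (forall l, (l <= KE)%N -> normc (\sum_(j < l) c (i * KE + j)%N) <= E) ->
  (L <= KE)%N -> (forall j, (j < L)%N -> beta + (i * KE + j)%:R / T%:R <= 3 / 4) ->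
  normc (\sum_(j < L) c (i * KE + j)%N * geom_sum b (beta + (i * KE + j)%:R / T%:R)) <=
  17 * E * block_weight i.
Proof.
move=> be0 cE LK th.
have E0 : 0 <= E by apply: le_trans (cE 0%N isT); apply: normc_ge0.
have W0 := block_weight_ge0 i.
have geomW j l : (j < L)%N -> (l <= b)%N ->
    normc (geom_sum l (beta + (i * KE + j)%:R / T%:R)) <= block_weight i.
  move=> jL lb; rewrite /block_weight; case: eqP => [_|/eqP i0].
    by apply: le_trans (normc_geom_sum_triv _ _) _; rewrite ler_nat.
  have iR : 0 < i%:R :> R by rewrite ltr0n lt0n.
  have bR : 0 < b%:R :> R by rewrite ltr0n.
  have low : i%:R / (2 * b%:R) <= beta + (i * KE + j)%:R / T%:R.
    apply: (@le_trans _ _ ((i * KE)%:R / T%:R)).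
      rewrite ler_pdivrMr ?mulr_gt0// mulrAC ler_pdivlMr// -!natrM ler_nat -mulnA leq_mul2l.
      by move: TK; rewrite -muln2; lia.
    by rewrite -[leLHS]add0r lerD// ler_pM2r ?invr_gt0// ler_nat leq_addr.
  have low0 : 0 < i%:R / (2 * b%:R) :> R by rewrite divr_gt0// mulr_gt0.
  apply: le_trans (normc_geom_sum _ _) _; first by rewrite (lt_le_trans low0 low) th.
  apply: (@le_trans _ _ (2 / (i%:R / (2 * b%:R)))).
    by rewrite ler_pM2l// lef_pV2 ?posrE// (lt_le_trans low0).
  rewrite invf_div mulrA le_eqVlt; apply/orP; left; apply/eqP.
  by congr (_ / _); ring.
apply: le_trans (@abel_bound (fun j => c (i * KE + j)%N)
   (fun j => geom_sum b (beta + (i * KE + j)%:R / T%:R)) L E (block_weight i)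
   (block_weight i * (16 * b%:R * T%:R^-1)) _ _ _ _ _) _ => //.
- by rewrite !mulr_ge0// invr_ge0.
- by move=> l lL; apply: cE; apply: leq_trans LK.
- by move=> j jL; apply: geomW.
- move=> j jL.
  have -> : beta + (i * KE + j.+1)%:R / T%:R = beta + (i * KE + j)%:R / T%:R + T%:R^-1.
    by rewrite addnS -natr1 mulrDl mul1r addrA.
  apply: normc_geom_sum_sub; first by rewrite invr_ge0.
  by move=> l lb; apply: geomW => //; apply: ltnW.
have -> : 17 * E * block_weight i = E * (block_weight i + block_weight i * 16) by ring.
rewrite ler_wpM2l// lerD2l mulrCA ler_wpM2l//.
have -> : L%:R * (16 * b%:R / T%:R) = 16 * ((L * b)%:R / T%:R) :> R by rewrite natrM; ring.
rewrite -[leRHS]mulr1 ler_pM2l// ler_pdivrMr// mul1r ler_nat.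
by apply: leq_trans Kb; rewrite leq_mul2r LK orbT.
Qed.

Lemma one_sided_bound c (beta : R) n N : 0 <= beta ->
  (forall J l, (l <= KE)%N -> normc (\sum_(j < l) c (J + j)%N) <= E) ->
  (N <= n * KE)%N -> (forall j, (j < N)%N -> beta + j%:R / T%:R <= 3 / 4) ->
  normc (\sum_(j < N) c j * geom_sum b (beta + j%:R / T%:R)) <=
  17 * E * \sum_(i < n) block_weight i.
Proof.
move=> be0 cE; elim: n N => [|n IHn] N Nn th.
  have -> : N = 0%N by lia.
  by rewrite !big_ord0 normc0 mulr0.
rewrite big_ord_recr /= mulrDr.
have E0 : 0 <= E by apply: le_trans (cE 0%N 0%N isT); apply: normc_ge0.
have [Nn'|nN] := leqP N (n * KE).
  apply: le_trans (IHn N Nn' th) _; rewrite lerDl mulr_ge0 ?block_weight_ge0//.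
  by rewrite mulr_ge0.
pose L := (N - n * KE)%N; have NE : N = (n * KE + L)%N by rewrite /L subnKC// ltnW.
have LK : (L <= KE)%N by move: Nn; rewrite NE mulSn; lia.
rewrite NE big_split_ord /=; apply: le_trans (le_normcD _ _) _; apply: lerD.
  apply: IHn => // j jn; apply: th; apply: leq_trans jn _; exact: ltnW.
apply: block_bound => // [l lK|j jL]; first exact: cE.
by apply: th; rewrite NE ltn_add2l.
Qed.

Lemma harmonic_sum_le n : \sum_(i < n) i.+1%:R^-1 <= 1 + ln (maxn 1 n)%:R :> R.
Proof.
elim: n => [|[|n] IHn]; first by rewrite big_ord0 ln1 addr0.
  by rewrite big_ord1 ln1 invr1 addr0.
rewrite big_ord_recr /=; apply: le_trans (lerD IHn (lexx _)) _.
rewrite -addrA lerD2l !(maxn_idPr _)//.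
have n1 : 0 < n.+1%:R :> R by rewrite ltr0n.
have n2 : 0 < n.+2%:R :> R by rewrite ltr0n.
have := @le_ln1Dx R (- n.+2%:R^-1).
have -> : 1 + - n.+2%:R^-1 = n.+1%:R / n.+2%:R :> R.
  have -> : n.+1%:R = n.+2%:R - 1 :> R by rewrite -[n.+2%:R]natr1 addrK.
  by rewrite mulrBl divff ?gt_eqF// mul1r.
rewrite ltrN2 invf_lt1// ltr1n ln_div ?posrE// => /(_ isT).
move: (ln n.+1%:R) (ln n.+2%:R) (n.+2%:R^-1) => u v x; lra.
Qed.

(** From n <= 2b <= 2T the harmonic sum is at most 1 + ln 2 + ln T, and 1 <= 2 ln 2 <= 2 ln T turns
    every constant into a multiple of ln T. *)
Lemma sum_block_weight n : (0 < n)%N -> (n <= b.*2)%N ->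
  \sum_(i < n) block_weight i <= 24 * b%:R * ln T%:R.
Proof.
case: n => // n _ nb; rewrite big_ord_recl /= {1}/block_weight /=.
have -> : \sum_(i < n) block_weight (bump 0 i) = 4 * b%:R * \sum_(i < n) i.+1%:R^-1 :> R.
  by rewrite mulr_sumr; apply: eq_bigr => i _; rewrite /block_weight /bump.
have ln2 : 1 / 2 <= ln 2 :> R.
  have := @le_ln1Dx R (- 2^-1); have -> : 1 + - 2^-1 = 2^-1 :> R by field.
  have n1 : - 1 < - 2^-1 :> R by lra.
  by rewrite lnV ?posrE// => /(_ n1); lra.
have lnT : ln 2 <= ln T%:R :> R by rewrite ler_ln ?posrE ?ltr0n// ?ler_nat// ltnW.
have lnn : ln (maxn 1 n)%:R <= ln 2 + ln T%:R :> R.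
  rewrite -lnM ?posrE ?ltr0n// ?(ltnW T1)// ler_ln ?posrE ?mulr_gt0 ?ltr0n ?leq_maxl ?(ltnW T1)//.
  by rewrite -natrM ler_nat geq_max; apply/andP; split; lia.
have h := harmonic_sum_le n; have bR : 0 < b%:R :> R by rewrite ltr0n.
have -> : 24 * b%:R * ln T%:R = b%:R * (24 * ln T%:R) :> R by ring.
have -> : b%:R + 4 * b%:R * (\sum_(i < n) i.+1%:R^-1) = b%:R * (1 + 4 * \sum_(i < n) i.+1%:R^-1) :> R.
  by ring.
rewrite ler_pM2l//; lra.
Qed.

(** Here 408 = 17 x 24, and 2b blocks suffice because N <= T <= 2 b KE. *)
Lemma one_sided_total c (beta : R) N : 0 <= beta <= T%:R^-1 -> (N <= T./2.+1)%N ->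
  ((0 < N)%N -> beta + N.-1%:R / T%:R <= 3 / 4) ->
  (forall J l, (l <= KE)%N -> normc (\sum_(j < l) c (J + j)%N) <= E) ->
  normc (\sum_(j < N) c j * geom_sum b (beta + j%:R / T%:R)) <= 408 * E * b%:R * ln T%:R.
Proof.
move=> /andP[be0 be1] NT th cE.
have E0 : 0 <= E by apply: le_trans (cE 0%N 0%N isT); apply: normc_ge0.
apply: le_trans (@one_sided_bound c beta b.*2 N be0 cE _ _) _.
- by move: TK; rewrite -!muln2; nia.
- move=> j jN; apply: le_trans (th _); last by lia.
  by rewrite lerD2l ler_pM2r ?invr_gt0// ler_nat; lia.
apply: le_trans (ler_wpM2l _ (sum_block_weight _ _)) _ => //; first by rewrite mulr_ge0.
  by rewrite double_gt0.
by rewrite le_eqVlt; apply/orP; left; apply/eqP; ring.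
Qed.

Lemma conj_sum_mul c d n :
  ((\sum_(i < n) (c i)^*%C * d i)^*)%C = \sum_(i < n) c i * (d i)^*%C.
Proof.
rewrite rmorph_sum; apply: eq_bigr => i _ /=; move: (c i) (d i) => [u v] [x y] /=.
by congr Complex; ring.
Qed.

Lemma geom_sumN n theta : geom_sum n (- theta) = ((geom_sum n theta)^*)%C.
Proof. by rewrite /geom_sum rmorph_sum; apply: eq_bigr => i _; rewrite mulrN -expi_conj. Qed.

(** By periodicity the frequencies are recentred at - alpha T. Those on the right are bounded
    directly, those on the left after complex conjugation, which reverses theta; this doubles 408.
    Rounding lets theta exceed 1/2, but only up to (T + 1) / (2T) <= 3/4. *)
Lemma completed_sum_bound (c : int -> R[i]) (alpha : R) :
  (forall j, c (j + T%:Z) = c j) ->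
  (forall (J : int) l, (l <= KE)%N -> normc (\sum_(j < l) c (J + j%:Z)) <= E) ->
  normc (\sum_(j < T) c j%:Z * geom_sum b (alpha + j%:R / T%:R)) <= 816 * E * b%:R * ln T%:R.
Proof.
move=> cT cE; pose j1 := Num.floor (alpha * T%:R); pose be := alpha - j1%:~R / T%:R.
have be01 : 0 <= be <= T%:R^-1.
  have /andP[h1 h2] := floor_itv (alpha * T%:R); rewrite -/j1 in h1 h2.
  rewrite /be subr_ge0 ler_pdivrMr// h1 /= lerBlDr.
  have -> : T%:R^-1 + j1%:~R / T%:R = (j1 + 1)%:~R / T%:R :> R.
    by rewrite rmorphD mulrDl mul1r addrC.
  by rewrite ler_pdivlMr// ltW.
pose T1' := (T./2)%N; pose T2 := (T - T1')%N.
have TT : T = (T2 + T1')%N by rewrite /T2 /T1'; lia.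
pose g (j : int) := c j * geom_sum b (alpha + j%:~R / T%:R).
have gT j : g (j + T%:Z) = g j.
  rewrite /g cT; congr (_ * _); apply: eq_bigr => i _.
  have -> : i.+1%:R * (alpha + (j + T%:Z)%:~R / T%:R) =
     i.+1%:R * (alpha + j%:~R / T%:R) + i.+1%:R :> R.
    rewrite rmorphD /= [(T%:Z)%:~R]/(T%:R) mulrDl divff ?gt_eqF//; ring.
  exact: expiDn.
have -> : \sum_(j < T) c j%:Z * geom_sum b (alpha + j%:R / T%:R) = \sum_(j < T) g j%:Z by [].
rewrite -(sum_periodic_shift (- j1 - T2%:Z) gT).
rewrite (sum_splitD (fun j => g (j%:Z + (- j1 - T2%:Z))) TT).
apply: le_trans (le_normcD _ _) _.
have -> : 816 * E * b%:R * ln T%:R = 408 * E * b%:R * ln T%:R + 408 * E * b%:R * ln T%:R by ring.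
have T2R : 2 <= T%:R :> R by rewrite ler_nat.
apply: lerD.
  rewrite (reindex_inj rev_ord_inj) /=.
  pose c' (i : nat) : R[i] := ((c (- j1 - 1 - i%:Z))^*)%C.
  have -> : \sum_(i < T2) g ((T2 - i.+1)%N%:Z + (- j1 - T2%:Z)) =
      ((\sum_(i < T2) c' i * geom_sum b (T%:R^-1 - be + i%:R / T%:R))^*)%C.
    rewrite (conj_sum_mul (fun i => c (- j1 - 1 - i%:Z))
      (fun i => geom_sum b (T%:R^-1 - be + i%:R / T%:R))).
    apply: eq_bigr => i _; rewrite -geom_sumN /g.
    have -> : (T2 - i.+1)%N%:Z + (- j1 - T2%:Z) = - j1 - 1 - i%:Z.
      by have := ltn_ord i; lia.
    congr (_ * geom_sum b _); rewrite /be !rmorphB !rmorphN /=.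
    by rewrite -[i%:Z%:~R]/(i%:R); field; rewrite gt_eqF.
  rewrite normc_conj; apply: one_sided_total.
  - by case/andP: be01 => h1 h2; rewrite subr_ge0 h2 lerBlDr lerDl h1.
  - by rewrite /T2 /T1'; lia.
  - move=> T20; case/andP: be01 => h1 h2.
    apply: (@le_trans _ _ ((1 + T2.-1%:R) / T%:R)); first by rewrite mulrDl mul1r lerD2r lerBlDr lerDl.
    rewrite nat1r prednK// ler_pdivrMr//.
    have : T2.*2%:R <= T%:R + 1 :> R by rewrite natr1 ler_nat /T2 /T1'; lia.
    rewrite -muln2 natrM; lra.
  - move=> J l lK.
    have -> : \sum_(j < l) c' (J + j)%N = ((\sum_(j < l) c (- j1 - J%:Z - l%:Z + j%:Z))^*)%C.
      rewrite rmorph_sum [RHS](reindex_inj rev_ord_inj) /=; apply: eq_bigr => i _.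
      by rewrite /c'; congr ((c _)^*)%C; have := ltn_ord i; lia.
    by rewrite normc_conj; apply: cE.
pose c' (i : nat) := c (i%:Z - j1).
have -> : \sum_(i < T1') g ((T2 + i)%N%:Z + (- j1 - T2%:Z)) =
    \sum_(i < T1') c' i * geom_sum b (be + i%:R / T%:R).
  apply: eq_bigr => i _; rewrite /g.
  have -> : (T2 + i)%N%:Z + (- j1 - T2%:Z) = i%:Z - j1 by lia.
  congr (_ * geom_sum b _); rewrite /be rmorphB /= -[i%:Z%:~R]/(i%:R).
  by field; rewrite gt_eqF.
apply: one_sided_total => //.
- move=> T10; case/andP: be01 => h1 h2.
  apply: (@le_trans _ _ ((1 + T1'.-1%:R) / T%:R)); first by rewrite mulrDl mul1r lerD2r.
  rewrite nat1r prednK// ler_pdivrMr//.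
  have : T1'.*2%:R <= T%:R :> R by rewrite ler_nat /T1'; lia.
  rewrite -muln2 natrM; lra.
move=> J l lK.
have -> : \sum_(j < l) c' (J + j)%N = \sum_(j < l) c ((J%:Z - j1) + j%:Z).
  by apply: eq_bigr => i _; rewrite /c'; congr c; lia.
exact: cE.
Qed.

End ExponentialSums.

(** * Real powers, and sums of natural length *)

Section PowR.
Variable R : realType.
Implicit Types (x y a b : R).

Lemma powR_addr x a b : 0 < x -> x `^ (a + b) = x `^ a * x `^ b.
Proof. by move=> x0; rewrite powRD// (gt_eqF x0) implybT. Qed.

Lemma powR_subr x a b : 0 < x -> x `^ (a - b) = x `^ a / x `^ b.
Proof. by move=> x0; rewrite powR_addr// powRN. Qed.

Lemma powR_div x y a : 0 < x -> 0 < y -> (x / y) `^ a = x `^ a / y `^ a.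
Proof.
move=> x0 y0; rewrite powRM ?invr_ge0 ?ltW//; congr (_ * _).
by rewrite -powR_inv1 ?ltW// -powRrM mulN1r powRN.
Qed.

Lemma powR_ratio x y a b : 0 < x -> 0 < y -> (x / y) `^ a * y `^ b = x `^ a * y `^ (b - a).
Proof. by move=> x0 y0; rewrite powR_div// powR_subr// mulrAC mulrA. Qed.

Lemma powR_div_split x y a : 0 < x -> 0 < y -> x / y * y `^ a = x `^ a * (x / y) `^ (1 - a).
Proof.
move=> x0 y0; rewrite powR_div// !powR_subr// !powRr1 ?ltW//.
have := powR_gt0 a y0; have := powR_gt0 a x0; move: (x `^ a) (y `^ a) => u v u0 v0.
by field; rewrite !gt_eqF.
Qed.

Lemma powR_mono x y a : 0 < x -> x <= y -> 0 <= a -> x `^ a <= y `^ a.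
Proof.
move=> x0 xy a0; apply: ge0_ler_powR => //; rewrite nnegrE ltW//.
exact: lt_le_trans xy.
Qed.

Lemma powR_ge1 x a : 1 <= x -> 0 <= a -> 1 <= x `^ a.
Proof. by move=> x1 a0; rewrite -[leLHS](powRr0 x) ler_powR. Qed.

End PowR.

Section NatSums.
Variables (R : realType) (p : prime_nat).

Definition phase_sum (f : nat -> padic p) (n : nat) (M : int) (b : nat) : R[i] :=
  \sum_(i < b) padic_e R (eval_series R f (M + i.+1%:Z)%:~R / p%:R ^+ n).

Lemma exp_sum_phase_sum f n M (B : R) : 0 <= B ->
  exp_sum f n M B = phase_sum f n M (Num.truncn B).
Proof.
move=> B0; rewrite /exp_sum /phase_sum.
rewrite (fsbig_ord _ (Num.truncn B) (fun i => padic_e R (eval_series R f (M + i.+1%:Z)%:~R / p%:R ^+ n))).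
apply: reindex_fsbig; split.
- move=> i /= iB; apply/andP; split; first by lia.
  rewrite rmorphD lerD2l /= -[i.+1%:Z%:~R]/(i.+1%:R).
  by rewrite -truncn_ge_nat.
- by move=> i j _ _ ij; lia.
- move=> m /= /andP[Mm mB]; exists (absz (m - M - 1)%R); last by lia.
  have : (m - M)%:~R <= B by rewrite rmorphB /= lerBlDl.
  have -> : (m - M)%:~R = (absz (m - M - 1)%R).+1%:R :> R.
    by rewrite -[RHS]/(((absz (m - M - 1)%R).+1)%:Z%:~R); congr (_%:~R); lia.
  by rewrite -truncn_ge_nat.
Qed.

Lemma normc_phase_sum f n M b : normc (phase_sum f n M b) <= b%:R.
Proof.
apply: le_trans (normc_sum _ _ _) _.
under eq_bigr do rewrite normc_psi.
by rewrite sumr_const card_ord.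
Qed.

Lemma phase_sumD f n M b c :
  phase_sum f n M (b + c) = phase_sum f n M b + phase_sum f n (M + b%:Z) c.
Proof.
pose G (m : int) := padic_e R (eval_series R f m%:~R / p%:R ^+ n).
have GE N c' : phase_sum f n N c' = \sum_(i < c') G (N + i.+1%:Z) by [].
rewrite !GE; clearbody G.
rewrite (sum_splitD (fun i => G (M + i.+1%:Z)) erefl); congr (_ + _).
by apply: eq_bigr => i _; congr G; lia.
Qed.

End NatSums.

(** * Exponent data *)

Section Data.
Variable R : realType.
Implicit Types q : datum R.

(** Since mu = rho_p mu (p - 1), a datum may be evaluated at an integer weight. *)
Lemma lambda_admissible_nat (p : prime_nat) (mu : nat) : (0 < mu)%N ->
  lambda_admissible p (mu%:R : R).
Proof.
have p1 : (0 < p.-1)%N by rewrite -subn1 subn_gt0 prime_nat_gt1.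
move=> mu0; exists (mu * p.-1)%N; first by rewrite muln_gt0 mu0.
have pR : (p%:R : R) - 1 = p.-1%:R.
  by rewrite -[in LHS](prednK (prime_nat_gt0 p)) -natr1 addrK.
have p0 : (p.-1%:R : R) != 0 by rewrite pnatr_eq0 -lt0n.
by rewrite /rho pR natrM mulrCA mulVf// mulr1.
Qed.

Lemma finite_primes_dvd (N : nat) : (0 < N)%N -> finite_set [set p : prime_nat | (p %| N)%N].
Proof.
move=> N0; apply: (@sub_finite_set _ _ (prime_nat_val @^-1` `I_N.+1)).
  by move=> p /= pN; rewrite ltnS dvdn_leq.
apply: finite_preimage; last exact: finite_II.
by move=> p q _ _ /val_inj.
Qed.

(** The exceptions divide the numerator or the denominator of y. Parameters containing iota' thus
    remain independent of y at almost all primes. *)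
Lemma iota_locus (y : rat) : 0 < y -> exists2 P0 : set prime_nat, finite_set P0 &
  forall p, ~ P0 p -> iota_neg p y = 0%N /\ iota_pos p y = 0%N.
Proof.
move=> y0; pose N := (`|numq y| * `|denq y|)%N.
have N0 : (0 < N)%N by rewrite muln_gt0 !absz_gt0 numq_eq0 denq_eq0 gt_eqF.
exists [set p : prime_nat | (p %| N)%N]; first exact: finite_primes_dvd.
move=> p /= /negP; rewrite Euclid_dvdM ?prime_nat_prime// negb_or => /andP[pn pd].
have log0 k : ~~ (p %| k)%N -> logn p k = 0%N.
  by move=> pk; apply/eqP; rewrite -leqn0 leqNgt logn_gt0 mem_primes (negPf pk) !andbF.
by rewrite /iota_neg /iota_pos /rat_ord !log0.
Qed.

Lemma datum_locus q : well_formed_datum q ->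
  exists (r0 : prime_nat -> nat -> R -> R) (n0 u0 : prime_nat -> nat -> R -> nat)
     (kappa0 : prime_nat -> nat) (lambda0 : prime_nat -> R),
  forall y, 0 < y -> exists2 P0 : set prime_nat, finite_set P0 &
    forall p : prime_nat, ~ P0 p ->
    [/\ dat_kappa0 q y p = kappa0 p, dat_lambda0 q y p = lambda0 p &
      forall kappa lambda, kappa_admissible p kappa -> lambda_admissible p lambda ->
      [/\ dat_r q y p kappa lambda = r0 p kappa lambda,
          dat_n0 q y p kappa lambda = n0 p kappa lambda &
          dat_u0 q y p kappa lambda = u0 p kappa lambda]].
Proof.
move=> [_ [[_ [r0 rP]] _] [[_ [n0 nP]] [_ [u0 uP]]] [[_ [ka kP]] [_ [la lP]]] _].
exists r0, n0, u0, ka, la => y y0.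
have [A fA Ar] := rP y y0; have [B fB Bn] := nP y y0; have [C fC Cu] := uP y y0.
have [D fD Dk] := kP y y0; have [E fE El] := lP y y0.
exists (A `|` B `|` C `|` D `|` E); first by rewrite !finite_setU.
move=> p nP0; split; [apply: Dk|apply: El|move=> ka' la' ka1 la1; split;
  [apply: Ar|apply: Bn|apply: Cu] => //]; by move=> h; apply: nP0; rewrite /setU /=; tauto.
Qed.

(* The estimate for natural lengths, in terms of [T = p ^ t]. *)
Definition pair_bound q (C : R) :=
  forall (p : prime_nat) (y : rat) (w : int) (kappa : nat) (lambda : R) (n u t : nat)
    (f : nat -> padic p) (M : int) (b : nat),
    0 < y -> kappa_admissible p kappa -> lambda_admissible p lambda ->
    (0 < n)%N -> (0 < u)%N -> (dat_kappa0 q y p <= kappa)%N -> dat_lambda0 q y p <= lambda ->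
    (dat_n0 q y p kappa lambda <= t + kappa + iota_pos p y)%N ->
    (dat_u0 q y p kappa lambda <= u)%N ->
    n%:Z = w + kappa%:Z + (iota_pos p y)%:Z + t%:Z ->
    classF w y kappa lambda u f -> (0 < b)%N -> (b <= p ^ t)%N ->
    normc (phase_sum R f n M b) <= C * (p%:R `^ dat_r q y p kappa lambda *
       ((p ^ t)%:R `^ dat_k q * b%:R `^ (dat_l q - dat_k q)) * ln (p ^ t)%:R `^ dat_delta q).

Lemma normCE (z : R[i]) : `|z| = (normc z)%:C%C.
Proof. by []. Qed.

Lemma exponent_datum_bound q : exponent_datum q -> exists2 C, 0 <= C & pair_bound q C.
Proof.
move=> [wf [C CP]]; exists `|C| => // p y w kappa lambda n u t f M b y0 ka la n0 u0 kq lq nq uq nE fF b0 bt.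
have pt0 : 0 < (p ^ t)%:R :> R by rewrite ltr0n expn_gt0 prime_nat_gt0.
have bR : 0 < b%:R :> R by rewrite ltr0n.
have := CP p y w kappa lambda n u y0 ka la n0 u0 kq lq _ uq f M b%:R fF bR _.
have -> : n%:Z - w - kappa%:Z - (iota_pos p y)%:Z = t%:Z by lia.
rewrite -exprnP -natrX ler_nat => /(_ _ bt); rewrite exp_sum_phase_sum ?(ltW bR)// natrK normCE lecR.
move=> h; apply: le_trans (h _) _; first by lia.
rewrite -(powR_ratio _ _ pt0 bR) [X in _ <= _ * (X * _)]mulrA.
by rewrite ler_wpM2r ?ler_norm// !mulr_ge0 ?powR_ge0.
Qed.

(** Passing from B to its integer part is harmless because the exponent l - k of the length is
    nonnegative; for B < 1 the sum is empty. The lower bound on n0 makes t a natural number. *)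
Lemma pair_bound_exponent_datum q C : 0 <= C -> well_formed_datum q -> pair_bound q C ->
  exponent_datum q.
Proof.
move=> C0 wf CP; split=> //; exists C => p y w kappa lambda n u y0 ka la n0 u0 kq lq nq uq f M B T fF B0 BT.
have [[/andP[k0 k1] /andP[l1 l2]] _ _ _ /(_ y p kappa lambda y0 ka la) kn] := wf.
pose t := absz (n%:Z - w - kappa%:Z - (iota_pos p y)%:Z)%R.
have tE : n%:Z - w - kappa%:Z - (iota_pos p y)%:Z = t%:Z.
  by apply/esym/gez0_abs; move: nq kn; clear; lia.
have TE : T = (p ^ t)%:R by rewrite /T tE -exprnP natrX.
have T0 : 0 < T by rewrite TE ltr0n expn_gt0 prime_nat_gt0.
have rhs0 : 0 <= (T / B) `^ dat_k q * B `^ dat_l q by rewrite mulr_ge0 ?powR_ge0.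
rewrite exp_sum_phase_sum ?(ltW B0)// normCE lecR.
have [b0|b0] := posnP (Num.truncn B).
  rewrite b0 /phase_sum big_ord0 normc0 mulr_ge0// mulr_ge0 ?powR_ge0//.
  by rewrite -mulrA mulr_ge0 ?powR_ge0.
have bB : (Num.truncn B)%:R <= B by rewrite truncn_le ?(ltW B0).
have bT : (Num.truncn B <= p ^ t)%N by rewrite -(ler_nat R) -TE (le_trans bB).
apply: le_trans (CP p y w kappa lambda n u t f M _ y0 ka la n0 u0 kq lq _ uq _ fF b0 bT) _.
- by clear -tE nq; lia.
- by clear -tE; lia.
rewrite ler_wpM2l// -TE ler_wpM2r ?powR_ge0// -mulrA ler_wpM2l ?powR_ge0// powR_ratio//.
rewrite ler_wpM2l ?powR_ge0//; apply: powR_mono => //; first by rewrite ltr0n.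
by lra.
Qed.

End Data.

(** * The B-process *)

Section Fourier.
Variables (R : realType) (p : prime_nat).
Local Notation psi := (@padic_e R p).

Definition fourier_coef (t : nat) (h : int -> R[i]) (j : int) : R[i] :=
  \sum_(x < p ^ t) h x%:Z * psi (- (j%:~R * x%:Z%:~R) / p%:R ^+ t).

Lemma psi_frac_period (t : nat) (j m : int) :
  psi ((j + (p ^ t)%N%:Z)%:~R * m%:~R / p%:R ^+ t) = psi (j%:~R * m%:~R / p%:R ^+ t).
Proof.
apply: psi_eq_div; rewrite rmorphD mulrDl [_ + _ * _]addrC addrK.
apply: pdvdMr (pdvd_int p m); apply/pdvd_intr.
by rewrite -[Posz (_ ^ _)]natz natrX natz.
Qed.

Lemma fourier_coef_period (t : nat) (h : int -> R[i]) (j : int) :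
  fourier_coef t h (j + (p ^ t)%N%:Z) = fourier_coef t h j.
Proof.
apply: eq_bigr => x _; congr (_ * _).
have e (i : int) : - (i%:~R * x%:Z%:~R) = i%:~R * (- x%:Z)%:~R :> padic p by rewrite rmorphN mulrN.
by rewrite !e psi_frac_period.
Qed.

Lemma fourier_inversion (t : nat) (h : int -> R[i]) (m : int) :
  (forall x, h (x + (p ^ t)%N%:Z) = h x) ->
  (p ^ t)%:R * h m = \sum_(j < p ^ t) fourier_coef t h j%:Z * psi (j%:Z%:~R * m%:~R / p%:R ^+ t).
Proof.
move=> hT; pose g (x : int) := if (m == x %[mod p%:Z ^+ t])%Z then h x else 0.
have ptE : (p ^ t)%N%:Z = p%:Z ^+ t by rewrite -[LHS]natz natrX natz.
have gT x : g (x + (p ^ t)%N%:Z) = g x by rewrite /g hT ptE modzDr.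
transitivity (\sum_(x < p ^ t) (p ^ t)%:R * g x%:Z); last first.
  under [RHS]eq_bigr do rewrite /fourier_coef mulr_suml.
  rewrite exchange_big /=; apply: eq_bigr => x _.
  transitivity (h x%:Z * \sum_(j < p ^ t) psi (j%:R * ((m - x%:Z)%:~R / p%:R ^+ t))).
    rewrite psi_orthogonality_residue /g; case: ifP => _; last by rewrite !mulr0.
    by rewrite mulrC.
  rewrite mulr_sumr; apply: eq_bigr => j _; rewrite -mulrA -psiD; congr (_ * psi _).
  rewrite -mulrDl rmorphB mulrA mulrBr addrC; congr (_ / _).
rewrite -mulr_sumr; congr (_ * _); rewrite -(sum_periodic_shift m gT).
have pt0 : (0 < p ^ t)%N by rewrite expn_gt0 prime_nat_gt0.
case E : (p ^ t)%N pt0 ptE => [//|N] _ ptE.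
rewrite big_ord_recl /= add0r {1}/g eqxx big1 ?addr0// => i _.
rewrite /g; case: ifP => //; rewrite eqz_mod_dvd -ptE opprD addrCA subrr addr0 => /dvdzP[z zE].
exfalso; move: (nat_of_ord i) (ltn_ord i) (z : int) zE => k kN z'; rewrite /bump /= => zE.
by have [z0|z0] := leP 0 z'; nia.
Qed.

End Fourier.

Section BProcess.
Variable R : realType.
Implicit Types q : datum R.

(** The 4 is the least weight allowed by [phase_coef]. *)
Definition int_weight q y p : nat := maxn 4 (Num.truncn (dat_lambda0 q y p)).+1.

Lemma int_weight_ge q y p : dat_lambda0 q y p <= (int_weight q y p)%:R.
Proof.
apply: (@le_trans _ _ (Num.truncn (dat_lambda0 q y p)).+1%:R); last by rewrite ler_nat leq_maxr.
by rewrite ltW// truncnS_gt.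
Qed.

Lemma int_weight_gt3 q y p : (3 < int_weight q y p)%N. Proof. exact: leq_maxl. Qed.

(** The extra p in [dat_r] comes from the Gauss sum, the extra logarithm from the harmonic sum over
    blocks. Adding kappa + iota' to u0 puts the dual series in the class with parameter [v] of q;
    the summand 1 in n0 gives t >= 1. *)
Definition B_datum q := Datum (dat_l q - 1 / 2) (dat_k q + 1 / 2)
  (fun y p kappa _ => dat_r q y^-1 p kappa (int_weight q y^-1 p)%:R + 1)
  (dat_delta q + 1)
  (fun y p kappa _ => (dat_n0 q y^-1 p kappa (int_weight q y^-1 p)%:R + kappa + iota_pos p y + 1)%N)
  (fun y p kappa _ => (dat_u0 q y^-1 p kappa (int_weight q y^-1 p)%:R + kappa + iota_pos p y)%N)
  (fun y p => maxn (dat_kappa0 q y^-1 p) (int_weight q y^-1 p).+1)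
  (fun y p => (int_weight q y^-1 p)%:R).

Lemma B_datum_well_formed q : well_formed_datum q -> well_formed_datum (B_datum q).
Proof.
move=> wf; have [r0 [n0 [u0 [ka0 [la0 locus]]]]] := datum_locus wf.
have [[/andP[k0 k1] /andP[l1 l2]] [_ d0] [_ [u_pos _]] [_ _] _] := wf.
pose mu0 p := maxn 4 (Num.truncn (la0 p)).+1.
have locus' y : 0 < y -> exists2 P0 : set prime_nat, finite_set P0 &
    forall p : prime_nat, ~ P0 p ->
    [/\ dat_kappa0 q y^-1 p = ka0 p, int_weight q y^-1 p = mu0 p, iota_pos p y = 0%N &
      forall kappa, kappa_admissible p kappa ->
      [/\ dat_r q y^-1 p kappa (int_weight q y^-1 p)%:R = r0 p kappa (mu0 p)%:R,
          dat_n0 q y^-1 p kappa (int_weight q y^-1 p)%:R = n0 p kappa (mu0 p)%:R &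
          dat_u0 q y^-1 p kappa (int_weight q y^-1 p)%:R = u0 p kappa (mu0 p)%:R]].
  move=> y0; have yV0 : 0 < y^-1 by rewrite invr_gt0.
  have [A fA Ap] := locus _ yV0; have [B fB Bp] := iota_locus y0.
  exists (A `|` B); first by rewrite finite_setU.
  move=> p nAB; have [] : ~ A p /\ ~ B p by split=> h; apply: nAB; [left|right].
  move=> /Ap[h1 h2 h3] /Bp[_ h4]; split=> //; first by rewrite /int_weight h2.
  have -> : int_weight q y^-1 p = mu0 p by rewrite /int_weight h2.
  by move=> kappa ka; apply: h3 => //; apply: lambda_admissible_nat; rewrite /mu0 leq_max.
split=> /=.
- by split; apply/andP; split; lra.
- split; last by rewrite addr_ge0.
  split=> //; exists (fun p kappa _ => r0 p kappa (mu0 p)%:R + 1) => y /locus'[A fA Ap].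
  by exists A => // p kappa lambda /Ap[_ _ _ h] /h[-> _ _].
- split.
  + split; first by move=> *; rewrite /= addn1.
    exists (fun p kappa _ => (n0 p kappa (mu0 p)%:R + kappa + 0 + 1)%N) => y /locus'[A fA Ap].
    by exists A => // p kappa lambda /Ap[_ _ -> h] /h[_ -> _].
  + split.
      move=> y p kappa lambda y0 ka _ /=.
      have := u_pos y^-1 p kappa (int_weight q y^-1 p)%:R; rewrite invr_gt0 => /(_ y0 ka).
      have mu_pos : (0 < int_weight q y^-1 p)%N by apply: leq_trans (int_weight_gt3 _ _ _).
      move=> /(_ (lambda_admissible_nat R p mu_pos)) h.
      by rewrite /= -addnA addn_gt0 [X in X || _]h.
    exists (fun p kappa _ => (u0 p kappa (mu0 p)%:R + kappa + 0)%N) => y /locus'[A fA Ap].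
    by exists A => // p kappa lambda /Ap[_ _ -> h] /h[_ _ ->].
- split.
  + split; first by move=> *; rewrite /= leq_max orbT.
    exists (fun p => maxn (ka0 p) (mu0 p).+1) => y /locus'[A fA Ap].
    by exists A => // p /Ap[-> -> _ _].
  + split; first by move=> *; rewrite /= ler0n.
    exists (fun p => (mu0 p)%:R) => y /locus'[A fA Ap].
    by exists A => // p /Ap[_ -> _ _].
- by move=> *; lia.
Qed.

Lemma int_shiftE (J : int) (j : nat) : J - 1 + j.+1%:Z = J + j%:Z.
Proof. by lia. Qed.

Lemma gauss_factor_le (p t : nat) : (0 < p)%N -> (0 < t)%N ->
  (p%:R : R) ^+ (t - (t.-1)./2) <= p%:R `^ 1 * (p ^ t)%:R `^ (1 / 2).
Proof.
move=> p0 t0; have pR : 0 < p%:R :> R by rewrite ltr0n.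
rewrite natrX -!powR_mulrn ?(ltW pR)// -powRrM -powR_addr// ler_powR ?ler1n//.
have : ((t - (t.-1)./2).*2 <= t + 2)%N by lia.
rewrite -(ler_nat R) -muln2 natrM natrD; lra.
Qed.

Lemma B_pair_bound q C : 0 <= C -> well_formed_datum q -> pair_bound q C ->
  pair_bound (B_datum q) (816 * C).
Proof.
move=> C0 wf qC p y w kappa lambda n u t f M b y0 ka la n0 u0.
rewrite /= geq_max => /andP[kq mu_kappa] mul nq uq nE fF b0 bT.
have [[/andP[k0 k1] /andP[l1 l2]] [_ d0] [_ [u_pos _]] [_ _] _] := wf.
set mu := int_weight q y^-1 p in kq mu_kappa mul nq uq *.
have mu3 : (3 < mu)%N := int_weight_gt3 _ _ _.
have muA : lambda_admissible p (mu%:R : R) by apply: lambda_admissible_nat; apply: leq_trans mu3.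
have yV0 : 0 < y^-1 by rewrite invr_gt0.
have yN0 : y != 0 by rewrite gt_eqF.
set v := dat_u0 q y^-1 p kappa mu%:R in uq.
have v0 : (0 < v)%N := u_pos _ _ _ _ yV0 ka muA.
have t0 : (0 < t)%N by move: nq; clear; lia.
have [xi0 [xi [h [G [fh hT Gb dual]]]]] := dual_phase y0 mu3 mu_kappa mul v0 uq t0 nE fF.
have [f' f'F f'h] := dual M.
have [alpha lift] := psi_lift R xi.
have T1 : (1 < p ^ t)%N by rewrite -(expn0 p) ltn_exp2l// prime_nat_gt1.
have TR : 0 < (p ^ t)%:R :> R by rewrite ltr0n ltnW.
have bR : 0 < b%:R :> R by rewrite ltr0n.
(* The twist moves the start [M] of the sum into the coefficients; by duality they become a constant
   times a phase of the class for 1/y. *)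
pose c (j : int) : R[i] := fourier_coef p t h j * padic_e R (j%:~R * M%:~R / p%:R ^+ t : padic p).
have cE j : c j = G * padic_e R (eval_series R f' j%:~R / p%:R ^+ n) by exact: f'h.
have cT j : c (j + (p ^ t)%N%:Z) = c j by rewrite /c fourier_coef_period psi_frac_period.
pose K := (p ^ t %/ b)%N.
have K0 : (0 < K)%N by rewrite divn_gt0.
have KT : (K <= p ^ t)%N by exact: leq_div.
pose E0 : R := C * (p%:R `^ dat_r q y^-1 p kappa mu%:R *
  ((p ^ t)%:R `^ dat_k q * K%:R `^ (dat_l q - dat_k q)) * ln (p ^ t)%:R `^ dat_delta q).
have E00 : 0 <= E0 by rewrite !mulr_ge0 ?powR_ge0.
(* A run of frequencies starting at J is a dual sum over J - 1 < j, bounded by q; its length may be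
   raised to K = T / b because l >= k. *)
have cB (J : int) l : (l <= K)%N -> normc (\sum_(j < l) c (J + j%:Z)) <= normc G * E0.
  move=> lK; have [->|l0] := posnP l.
    by rewrite big_ord0 normc0 mulr_ge0 ?normc_ge0.
  have -> : \sum_(j < l) c (J + j%:Z) = G * phase_sum R f' n (J - 1) l.
    rewrite /phase_sum mulr_sumr; apply: eq_bigr => j _; rewrite cE.
    by rewrite int_shiftE.
  rewrite normcM ler_wpM2l ?normc_ge0//.
  apply: le_trans (qC p y^-1 _ kappa mu%:R n v t f' (J - 1) l yV0 ka muA n0 v0 kq _ _ (leqnn _) _ f'F l0 _) _.
  - exact: int_weight_ge.
  - by clear -nq; lia.
  - by rewrite iota_posV//; clear -nE; lia.
  - exact: leq_trans KT.
  rewrite /E0 ler_wpM2l// ler_wpM2r ?powR_ge0// ler_wpM2l ?powR_ge0// ler_wpM2l ?powR_ge0//.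
  by apply: powR_mono; rewrite ?ltr0n ?ler_nat//; lra.
have := completed_sum_bound T1 b0 bT alpha cT cB.
set S := \sum_(j < _) _ => SB.
have c80 : 0 <= 816%:R :> R by exact: ler0n.
move: (816%:R : R) c80 SB => c8 c80 SB.
have fS : (p ^ t)%:R * phase_sum R f n M b = padic_e R xi0 * expi (M%:~R * alpha) * S.
  rewrite /phase_sum mulr_sumr.
  transitivity (\sum_(i < b) \sum_(j < p ^ t) padic_e R xi0 * expi (M%:~R * alpha) *
      (c j%:Z * expi (i.+1%:R * (alpha + j%:R / (p ^ t)%:R)))).
    apply: eq_bigr => i _; rewrite fh mulrCA fourier_inversion// mulr_sumr.
    apply: eq_bigr => j _; rewrite lift /c.
    have -> : padic_e R (j%:Z%:~R * (M + i.+1%:Z)%:~R / p%:R ^+ t : padic p) =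
        padic_e R (j%:Z%:~R * M%:~R / p%:R ^+ t : padic p) * expi (i.+1%:R * (j%:R / (p ^ t)%:R)).
      rewrite rmorphD mulrDr mulrDl psiD; congr (_ * _).
      have := psi_frac R p (j%:Z * i.+1%:Z) t; rewrite rmorphM => ->.
      by rewrite rmorphM /= natrX mulrA [X in expi (X / _)]mulrC.
    rewrite rmorphD mulrDl expiD mulrDr expiD -[i.+1%:Z%:~R * alpha]/(i.+1%:R * alpha).
    by move: (fourier_coef _ _ _ _) (padic_e _ _) (padic_e _ _) => A1 A2 A3; ring.
  rewrite exchange_big mulr_sumr; apply: eq_bigr => j _ /=.
  by rewrite -mulr_sumr; congr (_ * _); rewrite -mulr_sumr.
have : (p ^ t)%:R * normc (phase_sum R f n M b) = normc S.
  have -> : (p ^ t)%:R = normc ((p ^ t)%:R : R[i]).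
    by rewrite -(rmorph_nat (real_complex R)) /= expr0n addr0 sqrtr_sqr ger0_norm.
  by rewrite -normcM fS !normcM normc_psi normc_expi !mul1r.
move=> nS; rewrite -(ler_pM2l TR) nS; apply: le_trans SB _.
have Gb' := le_trans Gb (gauss_factor_le (prime_nat_gt0 p) t0).
have lnT0 : 0 <= ln (p ^ t)%:R :> R by rewrite ln_ge0// ler1n ltnW.
apply: (@le_trans _ _ (c8 * (p%:R `^ 1 * (p ^ t)%:R `^ (1 / 2) * E0) * b%:R * ln (p ^ t)%:R)).
  by rewrite ler_wpM2r// ler_wpM2r// ler_wpM2l// ler_wpM2r.
have KB : K%:R `^ (dat_l q - dat_k q) <= (p ^ t)%:R `^ (dat_l q - dat_k q) / b%:R `^ (dat_l q - dat_k q) :> R.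
  rewrite -powR_div//; apply: powR_mono; rewrite ?ltr0n//; last by lra.
  by rewrite ler_pdivlMr// -natrM ler_nat leq_divM.
rewrite /E0.
set T := (p ^ t)%:R in TR lnT0 KB *.
have -> : ln T `^ (dat_delta q + 1) = ln T `^ dat_delta q * ln T.
  have lnT1 : 0 < ln T by rewrite ln_gt0// ltr1n.
  by rewrite powR_addr// powRr1.
have pR : 0 < p%:R :> R by rewrite ltr0n prime_nat_gt0.
rewrite (powR_addr _ _ pR).
(* The factors are T^-1 from Fourier inversion, T^(1/2) from the Gauss sum, T^k (T/b)^(l-k) from
   dual sums of length T/b, and b from the geometric sums. *)
have -> : T `^ (dat_l q - 1 / 2) * b%:R `^ (dat_k q + 1 / 2 - (dat_l q - 1 / 2)) =
   T^-1 * (T `^ (1 / 2) * (T `^ dat_k q * (T `^ (dat_l q - dat_k q) / b%:R `^ (dat_l q - dat_k q)) * b%:R)).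
  have [e eE] : exists e, e = dat_l q - dat_k q by exists (dat_l q - dat_k q).
  have -> : dat_l q - 1 / 2 = - 1 + (1 / 2 + (dat_k q + e)) by rewrite eE; lra.
  have -> : dat_k q + 1 / 2 - (- 1 + (1 / 2 + (dat_k q + e))) = - e + 1 by lra.
  rewrite -eE !powR_addr// (powR_inv1 (ltW TR)) powRN (powRr1 (ltW bR)).
  by ring.
move: (_ / b%:R `^ _) (T `^ (1 / 2)) (T `^ dat_k q) (ln T `^ _) KB (powR_ge0 T (1 / 2))
  (powR_ge0 T (dat_k q)) (powR_ge0 (ln T) (dat_delta q)) => KX Th Tk Lt KB Th0 Tk0 Lt0.
have -> : T * (c8 * C * (p%:R `^ dat_r q y^-1 p kappa mu%:R * p%:R `^ 1 *
    (T^-1 * (Th * (Tk * KX * b%:R))) * (Lt * ln T))) =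
  c8 * (p%:R `^ 1 * Th * (C * (p%:R `^ dat_r q y^-1 p kappa mu%:R *
    (Tk * KX) * Lt))) * b%:R * ln T.
  rewrite -[RHS]mul1r -(divff (lt0r_neq0 TR)); ring.
rewrite ler_wpM2r// ler_wpM2r ?(ltW bR)// ler_wpM2l// ler_wpM2l ?mulr_ge0 ?powR_ge0// ler_wpM2l//.
by rewrite ler_wpM2r// ler_wpM2l ?powR_ge0// ler_wpM2l.
Qed.

Lemma B_exponent_datum q : exponent_datum q -> exponent_datum (B_datum q).
Proof.
move=> qD; have [C C0 qC] := exponent_datum_bound qD; have [wf _] := qD.
apply: (@pair_bound_exponent_datum _ (B_datum q) (816 * C)).
- by apply: mulr_ge0 C0; exact: ler0n.
- exact: B_datum_well_formed.
- exact: B_pair_bound.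
Qed.

End BProcess.

(** * The A-process *)

Section VanDerCorput.
Variable R : realType.
Implicit Types (a z : nat -> R[i]) (b c e q H N : nat).

Lemma sum_shift_support (V : nmodType) (G : nat -> V) N e A c : (e <= A)%N -> (A + c <= e + N)%N ->
  (forall m, (m < A)%N || (A + c <= m)%N -> G m = 0) ->
  \sum_(m < N) G (m + e)%N = \sum_(i < c) G (A + i)%N.
Proof.
move=> eA AcN G0.
rewrite -(big_mkord xpredT (fun m => G (m + e)%N)) -{1}(add0n e) -(addKn e N).
rewrite -(big_addn 0 (e + N) e xpredT G) add0n.
rewrite (@big_cat_nat _ _ _ A) /=; [|by []|by lia].
rewrite big_nat_cond big1 ?add0r; last first.
  by move=> m /andP[/andP[_ mA] _]; rewrite G0// mA.
rewrite (@big_cat_nat _ _ _ (A + c)) /=; [|by lia|by []].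
rewrite addrC big_nat_cond big1 ?add0r; last first.
  by move=> m /andP[/andP[Am _] _]; rewrite G0// Am orbT.
by rewrite -{1}[A]add0n big_addn addKn big_mkord; apply: eq_bigr => i _; rewrite addnC.
Qed.

(** Each distance is attained by at most 2H pairs; the induction adds the last row and column. *)
Lemma double_sum_dist (r : nat -> R) H : (forall h, 0 <= r h) ->
  \sum_(h1 < H) \sum_(h2 < H) r (`|h1 - h2|)%N <= 2 * H%:R * \sum_(h < H) r h.
Proof.
move=> r0; elim: H => [|H IHH]; first by rewrite !big_ord0 mulr0.
rewrite big_ord_recr /=; under eq_bigr do rewrite big_ord_recr /=.
rewrite big_split /= big_ord_recr /=.
pose s := \sum_(h < H.+1) r h; have s0 : 0 <= \sum_(h < H) r h by apply: sumr_ge0.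
have sE : s = r 0%N + \sum_(h < H) r (H - h)%N.
  rewrite /s big_ord_recl /=; congr (_ + _); rewrite (reindex_inj rev_ord_inj) /=.
  by apply: eq_bigr => i _; congr r; have := ltn_ord i; rewrite /bump /=; lia.
have -> : \sum_(h1 < H) r (`|h1 - H|)%N = \sum_(h < H) r (H - h)%N.
  by apply: eq_bigr => i _; congr r; have := ltn_ord i; lia.
have -> : \sum_(h2 < H) r (`|H - h2|)%N = \sum_(h < H) r (H - h)%N.
  by apply: eq_bigr => i _; congr r; have := ltn_ord i; lia.
have -> : r (`|H - H|)%N = r 0%N by congr r; lia.
rewrite -/s -[H.+1%:R]natr1.
have ss : \sum_(h < H) r h <= s by rewrite /s big_ord_recr /= lerDl.
have HR : 0 <= H%:R :> R by [].
have h1 : 2 * H%:R * \sum_(h < H) r h <= 2 * H%:R * s by rewrite ler_wpM2l// mulr_ge0.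
have rH := r0 0%N.
move: IHH h1 sE; set x := \sum_(i < H) \sum_(j < H) _; set u := \sum_(h < H) r (H - h)%N.
by move=> IHH h1 sE; rewrite mulrDr mulrDl mulr1; lra.
Qed.

Lemma sqr_normc_conj (x : R[i]) : x * (x^*)%C = (normc x ^+ 2)%:C%C.
Proof.
case: x => u v /=; rewrite sqr_sqrtr ?addr_ge0 ?sqr_ge0//.
by apply/eqP; rewrite eq_complex /=; apply/andP; split; apply/eqP; ring.
Qed.

Lemma cauchy_schwarz_sum (x : nat -> R) N : (\sum_(m < N) x m) ^+ 2 <= N%:R * \sum_(m < N) x m ^+ 2.
Proof.
elim: N => [|N IHN]; first by rewrite !big_ord0 mul0r expr0n.
rewrite !big_ord_recr /= -natr1.
set s := \sum_(m < N) x m in IHN *; set s2 := \sum_(m < N) x m ^+ 2 in IHN *.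
have s20 : 0 <= s2 by apply: sumr_ge0 => i _; apply: sqr_ge0.
case: N @s @s2 IHN s20 => [|N] s s2 IHN s20.
  by rewrite /s /s2 !big_ord0 !add0r mul1r.
have N0 : 0 < N.+1%:R :> R by rewrite ltr0n.
move: s s2 (x N.+1) (N.+1%:R : R) N0 IHN s20 => s s2 y n n0 IHN s20.
suff : 2 * s * y <= s2 + n * y ^+ 2 by nra.
by rewrite -(ler_pM2l n0); have := sqr_ge0 (s - n * y); nra.
Qed.

(** Extended by zero to [z], with qH leading zeros so that all shifts are natural, the sequence
    gives H S as the sum over m < N of the x m, the sums of z (m + q h) over h. Cauchy-Schwarz and
    [double_sum_dist] finish; 4 is the product of the 2 in N <= 2b and the 2 of that lemma. *)
Lemma van_der_corput a b q H : (0 < H)%N -> (q * H <= b)%N ->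
  H%:R * normc (\sum_(m < b) a m) ^+ 2 <=
  4 * b%:R * \sum_(h < H) normc (\sum_(m < b - q * h) a (m + q * h)%N * (a m)^*%C).
Proof.
move=> H0 qHb; pose A := (q * H)%N; pose N := (A + b)%N.
pose z m := if (A <= m < A + b)%N then a (m - A)%N else 0.
have z0 m : (m < A)%N || (A + b <= m)%N -> z m = 0.
  by rewrite /z; case: ifP => // /andP[h1 h2]; lia.
have zA i : (i < b)%N -> z (A + i)%N = a i.
  by move=> ib; rewrite /z leq_addr ltn_add2l ib addKn.
set S := \sum_(m < b) a m.
have qh h : (h < H)%N -> (q * h <= A)%N by move=> hH; rewrite leq_mul2l ltnW ?orbT.
have Sh h : (h < H)%N -> \sum_(m < N) z (m + q * h)%N = S.
  move=> hH; rewrite (@sum_shift_support _ z N (q * h) A b) ?qh//; last by rewrite /N; lia.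
  by apply: eq_bigr => i _; apply: zA.
pose r h := normc (\sum_(m < b - q * h) a (m + q * h)%N * (a m)^*%C).
have corr h1 h2 : (h2 <= h1)%N -> (h1 < H)%N ->
    \sum_(m < N) z (m + q * h1)%N * (z (m + q * h2)%N)^*%C =
    \sum_(m < b - q * (h1 - h2)) a (m + q * (h1 - h2))%N * (a m)^*%C.
  move=> h21 h1H; pose G m := z (m + q * (h1 - h2))%N * (z m)^*%C.
  have -> : \sum_(m < N) z (m + q * h1)%N * (z (m + q * h2)%N)^*%C = \sum_(m < N) G (m + q * h2)%N.
    by apply: eq_bigr => m _; rewrite /G -addnA -mulnDr subnKC.
  have dh : (q * (h1 - h2) <= A)%N by apply: qh; lia.
  rewrite (@sum_shift_support _ G N (q * h2) A (b - q * (h1 - h2))).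
  - apply: eq_bigr => i _; have ib : (i + q * (h1 - h2) < b)%N by rewrite addnC -ltn_subRL.
    by rewrite /G -addnA !zA//; apply: leq_ltn_trans ib; apply: leq_addr.
  - by apply: qh; lia.
  - by rewrite /N; lia.
  - move=> m mA; rewrite /G; have [mlt|mge] := ltnP m A.
      by rewrite (z0 m) ?mlt// conjc0 mulr0.
    by rewrite z0 ?mul0r//; lia.
have corr_norm h1 h2 : (h1 < H)%N -> (h2 < H)%N ->
    normc (\sum_(m < N) z (m + q * h1)%N * (z (m + q * h2)%N)^*%C) = r (`|h1 - h2|)%N.
  move=> h1H h2H; have [h21|/ltnW h12] := leqP h2 h1.
    rewrite corr// /r; have -> : `|h1 - h2|%N = (h1 - h2)%N by lia.
    by [].
  rewrite -normc_conj; have -> : (\sum_(m < N) z (m + q * h1)%N * (z (m + q * h2)%N)^*%C)^*%C =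
      \sum_(m < N) z (m + q * h2)%N * (z (m + q * h1)%N)^*%C.
    rewrite rmorph_sum; apply: eq_bigr => m _ /=.
    move: (z _) (z _) => [u v] [u' v'] /=; congr Complex; ring.
  rewrite corr// /r; have -> : `|h1 - h2|%N = (h2 - h1)%N by lia.
  by [].
have HR : 0 < H%:R :> R by rewrite ltr0n.
pose x m := \sum_(h < H) z (m + q * h)%N.
have HS : H%:R * normc S <= \sum_(m < N) normc (x m).
  apply: le_trans (normc_sum _ _ _); rewrite /x exchange_big /=.
  under eq_bigr do rewrite Sh//.
  by rewrite sumr_const card_ord normcMn mulr_natl.
have sq : \sum_(m < N) normc (x m) ^+ 2 <= 2 * H%:R * \sum_(h < H) r h.
  have r_ge0 h : 0 <= r h by exact: normc_ge0.
  apply: le_trans _ (double_sum_dist H r_ge0).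
  have e : (\sum_(m < N) normc (x m) ^+ 2)%:C%C =
      \sum_(h1 < H) \sum_(h2 < H) \sum_(m < N) z (m + q * h1)%N * (z (m + q * h2)%N)^*%C.
    rewrite rmorph_sum; under [RHS]eq_bigr do rewrite exchange_big /=.
    rewrite [RHS]exchange_big /=; apply: eq_bigr => m _.
    rewrite -sqr_normc_conj {2}/x rmorph_sum mulr_suml; apply: eq_bigr => h1 _.
    by rewrite mulr_sumr.
  have -> : \sum_(m < N) normc (x m) ^+ 2 = normc ((\sum_(m < N) normc (x m) ^+ 2)%:C%C : R[i]).
    by rewrite /= expr0n addr0 sqrtr_sqr ger0_norm// sumr_ge0// => m _; rewrite sqr_ge0.
  rewrite e; apply: le_trans (normc_sum _ _ _) _; apply: ler_sum => h1 _.
  apply: le_trans (normc_sum _ _ _) _; apply: ler_sum => h2 _.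
  by rewrite corr_norm.
have N2 : N%:R <= 2 * b%:R :> R by rewrite -natrM ler_nat /N; lia.
have r0 : 0 <= \sum_(h < H) r h by apply: sumr_ge0 => h _; apply: normc_ge0.
have : (H%:R * normc S) ^+ 2 <= N%:R * (2 * H%:R * \sum_(h < H) r h).
  apply: le_trans (_ : (\sum_(m < N) normc (x m)) ^+ 2 <= _).
    by rewrite ler_pXn2r ?nnegrE ?mulr_ge0 ?normc_ge0 ?sumr_ge0// => m _; rewrite normc_ge0.
  by apply: le_trans (cauchy_schwarz_sum (fun m => normc (x m)) N) _; rewrite ler_wpM2l.
move=> h1; have : (H%:R * normc S) ^+ 2 <= 2 * b%:R * (2 * H%:R * \sum_(h < H) r h).
  by apply: le_trans h1 _; rewrite ler_wpM2r// !mulr_ge0// ltW.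
move=> h2; rewrite -(ler_pM2l HR); move: h2; rewrite /r.
by move: (\sum_(h < H) _) (normc S) => s u; rewrite exprMn; lra.
Qed.

End VanDerCorput.

(** For 0 < h < H <= p^t, ord h < t, so p^ord h is one of the terms p^i with i < t and p^i dividing
    h. For each i these terms add up to at most H. So the loss p^ord h in a differenced sum costs
    only t on average, hence a logarithm. *)
Lemma sum_pfactor_le (p H t : nat) : prime p -> (H <= p ^ t)%N ->
  (\sum_(1 <= h < H) p ^ logn p h <= t * H)%N.
Proof.
move=> pp Ht; have p1 := prime_gt1 pp.
apply: (@leq_trans (\sum_(1 <= h < H) \sum_(i < t) (p ^ i %| h) * p ^ i)).
  rewrite !big_nat; apply: leq_sum => h /andP[h0 hH].
  have ht : (logn p h < t)%N.
    rewrite -(ltn_exp2l _ _ p1); apply: leq_ltn_trans (leq_trans hH Ht).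
    by apply: dvdn_leq => //; apply: pfactor_dvdnn.
  by rewrite (bigD1 (Ordinal ht)) //= pfactor_dvdnn mul1n leq_addr.
rewrite exchange_big /= -[X in (_ <= X * _)%N]card_ord -sum_nat_const.
apply: leq_sum => i _; rewrite -big_distrl /=.
case: H {Ht} => [|H]; first by rewrite big_nil.
rewrite -divn_count_dvd; apply: leq_trans (leq_divM _ _) _; exact: leqnSn.
Qed.

(** * Estimates for the differenced sums *)

Section DifferenceBound.
Variable R : realType.
Implicit Types q : datum R.

Lemma phase_sum_blocks (p : prime_nat) (f : nat -> padic p) n (M : int) (L b : nat) (B : R) :
  (0 < L)%N ->
  (forall (N : int) c, (0 < c)%N -> (c <= L)%N -> normc (phase_sum R f n N c) <= B) ->
  normc (phase_sum R f n M b) <= (b %/ L).+1%:R * B.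
Proof.
move=> L0 cB; have B0 : 0 <= B by apply: le_trans (cB 0 1%N isT L0); apply: normc_ge0.
elim/ltn_ind: b M => b IHb M; have [bL|Lb] := leqP b L.
  have [->|b0] := posnP b.
    by rewrite /phase_sum big_ord0 normc0 mulr_ge0.
  apply: le_trans (cB M b b0 bL) _.
  by rewrite -[leLHS]mul1r ler_wpM2r// ler1n.
have bE : b = (L + (b - L))%N by rewrite subnKC// ltnW.
rewrite bE phase_sumD; apply: le_trans (le_normcD _ _) _.
have -> : ((L + (b - L)) %/ L)%N = ((b - L) %/ L).+1 by rewrite divnDl// divnn L0.
rewrite -natr1 mulrDl mul1r addrC; apply: lerD; last exact: cB.
by apply: IHb; rewrite ltn_subrL L0 (leq_trans _ Lb).
Qed.

Lemma ln2_ge_half : 1 / 2 <= ln 2 :> R.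
Proof.
have n1 : - 1 < - 2^-1 :> R by lra.
have := le_ln1Dx n1; have -> : 1 + - 2^-1 = 2^-1 :> R by field.
by rewrite lnV ?posrE//; lra.
Qed.

(* At least 1 for [T > 1], unlike [ln T]. *)
Definition ln_sqr (T : nat) : R := 2 * ln T%:R.

Lemma ln_sqr_ge1 T : (1 < T)%N -> 1 <= ln_sqr T.
Proof.
move=> T1; have : ln 2 <= ln T%:R :> R by rewrite ler_ln ?posrE ?ltr0n// ?ler_nat// ltnW.
by have := ln2_ge_half; rewrite /ln_sqr; lra.
Qed.

Lemma exponent_le_ln_sqr (p t : nat) : (1 < p)%N -> t%:R <= ln_sqr (p ^ t).
Proof.
move=> p1; have pR : 0 < p%:R :> R by rewrite ltr0n ltnW.
have : ln 2 <= ln p%:R :> R by rewrite ler_ln ?posrE// ler_nat.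
have := ln2_ge_half; rewrite /ln_sqr natrX lnXn// -[ln _ *+ _]mulr_natr.
have : 0 <= t%:R :> R by [].
move: (ln p%:R) (ln 2) (t%:R : R) => x z s; nra.
Qed.

Lemma ln_powR_le_ln_sqr (T T' : nat) (d : R) : (1 < T')%N -> (T' <= T)%N -> 0 <= d ->
  ln T'%:R `^ d <= ln_sqr T `^ d.
Proof.
move=> T1 TT d0; have l0 : 0 < ln T'%:R :> R by rewrite ln_gt0// ltr1n.
apply: powR_mono => //; have : ln T'%:R <= ln T%:R :> R.
  by rewrite ler_ln ?posrE ?ltr0n ?ler_nat//; lia.
by rewrite /ln_sqr; lra.
Qed.

Lemma powR_natX_le (P a : R) n : 1 <= P -> 0 <= a <= 1 -> (P ^+ n) `^ a <= P ^+ n.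
Proof.
move=> P1 /andP[a0 a1]; have Pn1 : 1 <= P ^+ n by rewrite exprn_ege1.
by rewrite -[leRHS]powRr1 ?(le_trans _ Pn1)// ler_powR.
Qed.

Section Bound.
Variables (q : datum R) (C : R) (p : prime_nat) (y : rat) (w : int) (kappa u n t chi : nat).
Variables (lambda : R) (f : nat -> padic p) (M : int) (b : nat).
Let mu := int_weight q (y + 1) p.
Let v := dat_u0 q (y + 1) p kappa mu%:R.
Let n1 := dat_n0 q (y + 1) p kappa mu%:R.
Let rr := dat_r q (y + 1) p kappa mu%:R.
Let k := dat_k q.
Let l := dat_l q.
Let T : R := (p ^ t)%:R.
Let P : R := p%:R.
Hypotheses (C0 : 0 <= C) (wf : well_formed_datum q) (qC : pair_bound q C) (y0 : 0 < y).
Hypotheses (ka : kappa_admissible p kappa) (mu_kappa : (mu < kappa)%N).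
Hypotheses (kq : (dat_kappa0 q (y + 1) p <= kappa)%N) (mul : mu%:R <= lambda).
Hypotheses (v_chi : (v <= chi)%N) (vu : (v + kappa + iota_pos p y <= u)%N) (n0 : (0 < n)%N).
Hypotheses (t0 : (0 < t)%N) (nE : n%:Z = w + kappa%:Z + (iota_pos p y)%:Z + t%:Z).
Hypothesis fF : classF w y kappa lambda u f.
Hypothesis b_chi : (b * p ^ chi <= p ^ (v.+1 + t))%N.

(** 2C serves the estimates through q, possibly over several blocks, and 1 the trivial bound; the
    powers of p collect the losses of all cases. *)
Definition difference_factor : R := (2 * C + 1) *
  (P `^ `|rr| * P ^+ (v.+1.*2 + n1.*2)) * ln_sqr (p ^ t) `^ dat_delta q.

Let X0 : R := (T / (p ^ chi)%:R) `^ k * b%:R `^ (l - k).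

Let y1_0 : 0 < y + 1. Proof. by rewrite addr_gt0. Qed.
Let mu3 : (3 < mu)%N. Proof. exact: int_weight_gt3. Qed.
Let muA : lambda_admissible p (mu%:R : R).
Proof. by apply: lambda_admissible_nat; apply: leq_trans mu3. Qed.
Let P1 : 1 <= P. Proof. by rewrite ler1n prime_nat_gt0. Qed.
Let P0 : 0 < P. Proof. exact: lt_le_trans P1. Qed.
Let T_gt0 : 0 < T. Proof. by rewrite ltr0n expn_gt0 prime_nat_gt0. Qed.
Let pchi : 0 < (p ^ chi)%:R :> R. Proof. by rewrite ltr0n expn_gt0 prime_nat_gt0. Qed.
Let Lam : 1 <= ln_sqr (p ^ t) `^ dat_delta q.
Proof.
have [_ [_ d0] _ _ _] := wf; apply: powR_ge1 => //; apply: ln_sqr_ge1.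
by rewrite -(expn0 p) ltn_exp2l// prime_nat_gt1.
Qed.
Let kl : [/\ 0 <= k, k <= 1, k <= l, 0 <= l & l <= 1].
Proof. by have [[/andP[k0 k1] /andP[l1 l2]] _ _ _ _] := wf; split; rewrite /k /l; lra. Qed.

Let b_T : b%:R <= P ^+ v.+1 * (T / (p ^ chi)%:R).
Proof.
rewrite mulrA ler_pdivlMr// -natrM /P /T -natrX -natrM ler_nat; move: b_chi.
by rewrite expnD.
Qed.

Let bl_X0 : (0 < b)%N -> b%:R `^ l <= P ^+ v.+1 * X0.
Proof.
move=> b0; have bR : 0 < b%:R :> R by rewrite ltr0n.
have [k0 k1 kl' l0 l1] := kl.
have -> : b%:R `^ l = b%:R `^ k * b%:R `^ (l - k) by rewrite -powR_addr// addrC subrK.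
rewrite /X0 mulrA ler_wpM2r ?powR_ge0//.
apply: le_trans (powR_mono bR b_T k0) _.
have PV0 : 0 <= P ^+ v.+1 by rewrite exprn_ge0// ltW.
have TC0 : 0 <= T / (p ^ chi)%:R by rewrite divr_ge0// ltW.
by rewrite powRM// ler_wpM2r ?powR_ge0// powR_natX_le// k0.
Qed.

Lemma difference_sum_bound h : (0 < h)%N -> (p ^ chi * h < b)%N ->
  normc (\sum_(m < b - p ^ chi * h)
    padic_e R (eval_series R f (M + (m + p ^ chi * h)%N.+1%:Z)%:~R / p%:R ^+ n) *
    (padic_e R (eval_series R f (M + m.+1%:Z)%:~R / p%:R ^+ n))^*%C) <=
  difference_factor * P ^+ logn p h * X0.
Proof.
move=> h0 hb; have b0 : (0 < b)%N by apply: leq_ltn_trans hb.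
have bR : 0 < b%:R :> R by rewrite ltr0n.
have [k0 k1 kl' l0 l1] := kl.
have l10 : 0 <= 1 - l by rewrite subr_ge0.
have l11 : 0 <= 1 - l <= 1 by rewrite l10 lerBlDr lerDl.
have lk0 : 0 <= l - k by rewrite subr_ge0.
have [f' f'F f'h] := difference_phase n y0 (ltn_trans (isT : (1 < 3)%N) mu3) mu_kappa mul v_chi vu h0 fF.
set e := logn p h in f'F *; set b' := (b - p ^ chi * h)%N.
have b'0 : (0 < b')%N by rewrite subn_gt0.
have b'b : (b' <= b)%N by apply: leq_subr.
have -> : \sum_(m < b')
    padic_e R (eval_series R f (M + (m + p ^ chi * h)%N.+1%:Z)%:~R / p%:R ^+ n) *
    (padic_e R (eval_series R f (M + m.+1%:Z)%:~R / p%:R ^+ n))^*%C = phase_sum R f' n M b'.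
  apply: eq_bigr => m _; rewrite psi_conj -psiD -f'h mulrBl.
  by have -> : M + (m + p ^ chi * h)%N.+1%:Z = M + m.+1%:Z + (p ^ chi * h)%N%:Z
    by clear; lia.
have X00 : 0 <= X0 by rewrite mulr_ge0 ?powR_ge0.
have Pe0 : 0 <= P ^+ e by rewrite exprn_ge0// ltW.
have Pn (i j : nat) : (i <= j)%N -> P ^+ i <= P ^+ j by apply: ler_weXn2l.
have PP0 i : 0 <= P ^+ i by rewrite exprn_ge0// ltW.
have Pr1 : 1 <= P `^ `|rr| by apply: powR_ge1.
set d := (kappa + iota_pos p (y + 1))%N.
have dn1 : (d < n1)%N by have [_ _ _ _ /(_ _ _ _ _ y1_0 ka muA)] := wf.
set D1 := P ^+ (v.+1.*2 + n1.*2).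
have D10 : 0 <= D1 by apply: PP0.
(* If the differenced modulus is too small for q, then b <= P^(v+1+n1+e), and the trivial bound b =
   b^l b^(1-l) suffices. *)
have [tsmall|tbig] := ltnP t (chi + e + n1).
  apply: le_trans (normc_phase_sum R f' n M b') _.
  apply: (@le_trans _ _ b%:R); first by rewrite ler_nat.
  have bW : b%:R <= P ^+ (v.+1 + n1) * P ^+ e.
    rewrite -exprD -natrX ler_nat.
    have : (b * p ^ chi <= p ^ (v.+1 + n1 + e) * p ^ chi)%N.
      apply: leq_trans b_chi _; rewrite -expnD leq_exp2l ?prime_nat_gt1//.
      by clear -tsmall; lia.
    by rewrite leq_pmul2r// expn_gt0 prime_nat_gt0.
  have -> : b%:R = b%:R `^ l * b%:R `^ (1 - l) :> R.
    by rewrite -powR_addr// addrC subrK powRr1// ltW.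
  have bl1 : b%:R `^ (1 - l) <= P ^+ (v.+1 + n1) * P ^+ e.
    apply: le_trans (powR_mono bR bW l10) _; rewrite -exprD; exact: powR_natX_le.
  apply: le_trans (ler_pM (powR_ge0 _ _) (powR_ge0 _ _) (bl_X0 b0) bl1) _.
  have -> : P ^+ v.+1 * X0 * (P ^+ (v.+1 + n1) * P ^+ e) = P ^+ (v.+1 + (v.+1 + n1)) * (P ^+ e * X0).
    rewrite [P ^+ (v.+1 + (v.+1 + n1))]exprD.
    by move: (P ^+ v.+1) (P ^+ (v.+1 + n1)) (P ^+ e) (X0 : R); clear => A1 A2 A3 A4; ring.
  rewrite -[leRHS]mulrA ler_wpM2r ?(mulr_ge0 Pe0 X00)//.
  apply: (@le_trans _ _ D1); first by rewrite /D1; apply: Pn; rewrite -!addnn; clear; lia.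
  rewrite /difference_factor -/D1.
  have : D1 <= P `^ `|rr| * D1 by rewrite -[leLHS]mul1r ler_wpM2r.
  move: (P `^ _ * D1) => D2 D12; have D20 : 0 <= D2 by apply: le_trans D12.
  apply: le_trans D12 _; rewrite -[leLHS]mulr1 ler_pM//.
  by rewrite -[leLHS]mul1r ler_wpM2r// lerDr mulr_ge0.
(* p^th is the modulus belonging to f': the shift costs chi + e, and [d] is kappa + iota' for y +
   1. *)
pose th := (t - chi - e - d)%N.
have thE : t = (chi + e + d + th)%N by rewrite /th; clear -tbig dn1; lia.
have th0 : (0 < th)%N by clear -thE tbig dn1; lia.
set Th : R := (p ^ th)%:R.
have Th0 : 0 < Th by rewrite ltr0n expn_gt0 prime_nat_gt0.
pose Q : R := C * P `^ `|rr| * ln_sqr (p ^ t) `^ dat_delta q.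
have Q0 : 0 <= Q by rewrite !mulr_ge0 ?powR_ge0.
have v0 : (0 < v)%N by have [_ _ [_ [+ _]] _ _] := wf; apply.
have block (N : int) c : (0 < c)%N -> (c <= p ^ th)%N ->
    normc (phase_sum R f' n N c) <= Q * (Th `^ k * c%:R `^ (l - k)).
  move=> c0 cT.
  apply: le_trans (qC N y1_0 ka muA n0 v0 kq _ _ (leqnn _) _ f'F c0 cT) _.
  - exact: int_weight_ge.
  - by rewrite -addnA -/d; clear -thE tbig; lia.
  - by rewrite nE {1}thE /d; clear; lia.
  rewrite -/k -/l -/Th -/rr /Q.
  move: (Th `^ k * _) (mulr_ge0 (powR_ge0 Th k) (powR_ge0 c%:R (l - k))) => Z Z0.
  have -> : C * P `^ `|rr| * ln_sqr (p ^ t) `^ dat_delta q * Z =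
    C * (P `^ `|rr| * Z * ln_sqr (p ^ t) `^ dat_delta q).
    by move: (P `^ _) (ln_sqr _ `^ _); clear => A1 A2; ring.
  rewrite ler_wpM2l// ler_pM ?mulr_ge0 ?powR_ge0//.
    by rewrite ler_wpM2r// ler_powR// ler_norm.
  have [_ [_ d0] _ _ _] := wf; apply: ln_powR_le_ln_sqr => //.
    by rewrite -(expn0 p) ltn_exp2l// prime_nat_gt1.
  by rewrite leq_exp2l ?prime_nat_gt1// [leqRHS]thE leq_addl.
have QD (E : nat) : (E <= v.+1.*2 + n1.*2)%N -> 2 * Q * P ^+ E <= difference_factor.
  move=> ED; rewrite /difference_factor -/D1 /Q.
  have : P ^+ E <= D1 by rewrite /D1; apply: Pn.
  move: (P ^+ E) (PP0 E) => PE PE0 ED1.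
  have -> : 2 * (C * P `^ `|rr| * ln_sqr (p ^ t) `^ dat_delta q) * PE =
    (2 * C) * (P `^ `|rr| * PE) * ln_sqr (p ^ t) `^ dat_delta q.
    by move: (P `^ _) (ln_sqr _ `^ _); clear => A1 A2; ring.
  rewrite ler_wpM2r ?powR_ge0// ler_pM ?mulr_ge0 ?powR_ge0//; first by rewrite lerDl.
  by rewrite ler_wpM2l ?powR_ge0.
have Pe1 : 1 <= P ^+ e by rewrite exprn_ege1.
have [b'T|Tb'] := leqP b' (p ^ th).
  apply: le_trans (block M b' b'0 b'T) _.
  apply: (@le_trans _ _ (Q * X0)).
    rewrite ler_wpM2l// /X0 ler_pM ?powR_ge0//; last first.
      by apply: powR_mono; rewrite ?ltr0n ?ler_nat.
    apply: powR_mono => //; rewrite ler_pdivlMr// /Th /T -natrM ler_nat -expnD.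
    by rewrite leq_exp2l ?prime_nat_gt1// [leqRHS]thE; clear; lia.
  rewrite ler_wpM2r//; apply: le_trans (_ : 2 * Q * P ^+ 0 <= _).
    by rewrite expr0 mulr1 -[leLHS]mul1r ler_wpM2r// ler1n.
  have DF0 : 0 <= difference_factor by apply: le_trans (QD 0%N isT); rewrite !mulr_ge0 ?powR_ge0.
  by apply: le_trans (QD 0%N isT) _; rewrite -[leLHS]mulr1 ler_wpM2l.
(* The length exceeds the modulus, so q is applied on blocks of length p^th. Then (b/Th) Th^l = b^l
   (b/Th)^(1-l), where b/Th is a bounded power of p times p^ord h. *)
apply: le_trans (@phase_sum_blocks p f' n M (p ^ th) b' (Q * Th `^ l) _ _) _.
- by rewrite expn_gt0 prime_nat_gt0.
- move=> N c c0 cT; apply: le_trans (block N c c0 cT) _; rewrite ler_wpM2l//.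
  have -> : Th `^ l = Th `^ k * Th `^ (l - k) by rewrite -powR_addr// addrC subrK.
  by rewrite ler_wpM2l ?powR_ge0//; apply: powR_mono; rewrite ?ltr0n ?ler_nat.
have bTh : (b' %/ p ^ th).+1%:R <= 2 * (b%:R / Th).
  have h1 : (b' %/ p ^ th)%:R <= b%:R / Th.
    rewrite ler_pdivlMr// /Th -natrM ler_nat; apply: leq_trans b'b; exact: leq_divM.
  have h2 : 1 <= b%:R / Th.
    by rewrite ler_pdivlMr// mul1r ler_nat; apply: leq_trans b'b; apply: ltnW.
  by rewrite -natr1 [2]/(1 + 1) mulrDl mul1r lerD.
apply: le_trans (ler_wpM2r (mulr_ge0 Q0 (powR_ge0 Th l)) bTh) _.
have bThW : b%:R / Th <= P ^+ (v.+1 + e + d).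
  rewrite ler_pdivrMr// /Th /P -natrX -natrM ler_nat -expnD.
  have : (b * p ^ chi <= p ^ (v.+1 + e + d + th) * p ^ chi)%N.
    apply: leq_trans b_chi _; rewrite -expnD leq_exp2l ?prime_nat_gt1//.
    by clear -thE; lia.
  by rewrite leq_pmul2r// expn_gt0 prime_nat_gt0.
have e1 := powR_div_split l bR Th0.
have e2 : b%:R / Th * Th `^ l <= P ^+ v.+1 * X0 * P ^+ (v.+1 + e + d).
  rewrite e1 ler_pM ?powR_ge0 ?bl_X0//.
  apply: le_trans (powR_mono _ bThW l10) _; first by rewrite divr_gt0.
  exact: powR_natX_le.
have -> : 2 * (b%:R / Th) * (Q * Th `^ l) = 2 * Q * (b%:R / Th * Th `^ l).
  by move: (b%:R / Th) (Th `^ l) (Q : R); clear => A1 A2 A3; ring.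
apply: le_trans (ler_wpM2l _ e2) _; first by rewrite mulr_ge0.
have -> : 2 * Q * (P ^+ v.+1 * X0 * P ^+ (v.+1 + e + d)) =
    (2 * Q * P ^+ (v.+1 + v.+1 + d)) * P ^+ e * X0.
  rewrite [P ^+ (v.+1 + e + d)]exprD [P ^+ (v.+1 + e)]exprD [P ^+ (v.+1 + v.+1 + d)]exprD.
  rewrite [P ^+ (v.+1 + v.+1)]exprD.
  by move: (P ^+ v.+1) (P ^+ e) (P ^+ d) (Q : R) (X0 : R); clear => A1 A2 A3 A4 A5; ring.
rewrite ler_wpM2r// ler_wpM2r//; apply: QD.
by move: dn1; clear; rewrite -!addnn; lia.
Qed.

End Bound.
End DifferenceBound.

(** * The A-datum and the choice of the shift *)

Section AProcess.
Variable R : realType.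
Implicit Types q : datum R.

Definition trivial_datum : datum R := Datum 0 1 (fun _ _ _ _ => 0) 0
  (fun y p kappa _ => (kappa + iota_pos p y).+1) (fun _ _ _ _ => 1%N) (fun _ _ => 1%N) (fun _ _ => 0).

Lemma trivial_well_formed : well_formed_datum trivial_datum.
Proof.
split=> /=.
- by split; apply/andP; split; lra.
- split=> //; split=> //; exists (fun _ _ _ => 0) => y _.
  by exists set0; first exact: finite_set0.
- split.
  + split=> //; exists (fun _ kappa _ => (kappa + 0).+1) => y /iota_locus[A fA Ap].
    by exists A => // p kappa lambda /Ap[_ ->].
  + split=> //; exists (fun _ _ _ => 1%N) => y _.
    by exists set0; first exact: finite_set0.
- split.
  + split=> //; exists (fun=> 1%N) => y _.
    by exists set0; first exact: finite_set0.
  + split=> [*|]; first exact: lexx.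
    exists (fun=> 0) => y _; by exists set0; first exact: finite_set0.
- by [].
Qed.

Lemma trivial_pair_bound : pair_bound trivial_datum 1.
Proof.
move=> p y w kappa lambda n u t f M b *; rewrite /= !powRr0 subr0 powRr1//.
by rewrite !mul1r mulr1; apply: normc_phase_sum.
Qed.

(** [q2] will be the datum of the pair (1/2, 1/2). It alone supplies n0, because differenced sums of
    too small modulus are bounded trivially. The extra logarithm comes from averaging p^ord h. *)
Definition A_datum q q2 : datum R :=
  Datum (dat_k q / (2 * (dat_k q + 1))) ((dat_k q + dat_l q + 1) / (2 * (dat_k q + 1)))
  (fun y p kappa lambda =>
     let mu : R := (int_weight q (y + 1) p)%:R in
     `|dat_r q (y + 1) p kappa mu| + `|dat_r q2 y p kappa lambda| +
     ((dat_u0 q (y + 1) p kappa mu).+1.*2 + (dat_n0 q (y + 1) p kappa mu).*2)%:R)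
  (dat_delta q + dat_delta q2 + 1)
  (dat_n0 q2)
  (fun y p kappa lambda => maxn (dat_u0 q2 y p kappa lambda)
     (dat_u0 q (y + 1) p kappa (int_weight q (y + 1) p)%:R + kappa + iota_pos p y))
  (fun y p => maxn (dat_kappa0 q2 y p) (maxn (dat_kappa0 q (y + 1) p) (int_weight q (y + 1) p).+1))
  (fun y p => Num.max (dat_lambda0 q2 y p) (int_weight q (y + 1) p)%:R).

Lemma A_datum_well_formed q q2 : well_formed_datum q -> well_formed_datum q2 ->
  well_formed_datum (A_datum q q2).
Proof.
move=> wf wf2; have [r0 [n0 [u0 [ka0 [la0 locus]]]]] := datum_locus wf.
have [r2 [n2 [u2 [ka2 [la2 locus2]]]]] := datum_locus wf2.
have [[/andP[k0 k1] /andP[l1 l2]] [_ d0] _ _ _] := wf.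
have [_ [_ d2] [n2J [u2_pos _]] [[ka2_pos _] [la2_ge0 _]] n2_gt] := wf2.
pose mu0 p := maxn 4 (Num.truncn (la0 p)).+1.
have locus' y : 0 < y -> exists2 P0 : set prime_nat, finite_set P0 &
    forall p : prime_nat, ~ P0 p ->
    [/\ dat_kappa0 q (y + 1) p = ka0 p, int_weight q (y + 1) p = mu0 p, iota_pos p y = 0%N,
        dat_kappa0 q2 y p = ka2 p /\ dat_lambda0 q2 y p = la2 p &
      forall kappa lambda, kappa_admissible p kappa -> lambda_admissible p lambda ->
      [/\ dat_r q (y + 1) p kappa (int_weight q (y + 1) p)%:R = r0 p kappa (mu0 p)%:R,
          dat_n0 q (y + 1) p kappa (int_weight q (y + 1) p)%:R = n0 p kappa (mu0 p)%:R,
          dat_u0 q (y + 1) p kappa (int_weight q (y + 1) p)%:R = u0 p kappa (mu0 p)%:R,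
          dat_r q2 y p kappa lambda = r2 p kappa lambda &
          dat_u0 q2 y p kappa lambda = u2 p kappa lambda]].
  move=> y0; have y1 : 0 < y + 1 by rewrite addr_gt0.
  have [A fA Ap] := locus _ y1; have [B fB Bp] := iota_locus y0.
  have [D fD Dp] := locus2 _ y0.
  exists (A `|` B `|` D); first by rewrite !finite_setU.
  move=> p nABD.
  have [hA hB hD] : [/\ ~ A p, ~ B p & ~ D p].
    by split=> h; apply: nABD; rewrite /setU /=; tauto.
  have [h1 h2 h3] := Ap p hA; have [_ h4] := Bp p hB; have [h5 h6 h7] := Dp p hD.
  have -> : int_weight q (y + 1) p = mu0 p by rewrite /int_weight h2.
  split=> // kappa lambda ka la; have [-> _ ->] := h7 kappa lambda ka la.
  have muA : lambda_admissible p ((mu0 p)%:R : R).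
    by apply: lambda_admissible_nat; rewrite /mu0 leq_max.
  by have [-> -> ->] := h3 kappa _ ka muA.
have k10 : 0 < 2 * (dat_k q + 1) by lra.
split=> /=.
- split; apply/andP; split.
  + by rewrite divr_ge0 // ltW.
  + by rewrite ler_pdivrMr//; lra.
  + by rewrite ler_pdivlMr//; lra.
  + by rewrite ler_pdivrMr//; lra.
- split; last by rewrite !addr_ge0.
  split=> //; exists (fun p kappa lambda => `|r0 p kappa (mu0 p)%:R| + `|r2 p kappa lambda| +
    ((u0 p kappa (mu0 p)%:R).+1.*2 + (n0 p kappa (mu0 p)%:R).*2)%:R) => y /locus'[A fA Ap].
  exists A => // p kappa lambda /Ap[_ _ _ _ h] ka la.
  by have [-> -> -> -> _] := h kappa lambda ka la.
- split=> //; split.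
    by move=> y p kappa lambda y0 ka la; rewrite /= leq_max [X in X || _](u2_pos y p kappa lambda y0 ka la).
  exists (fun p kappa lambda => maxn (u2 p kappa lambda) (u0 p kappa (mu0 p)%:R + kappa + 0)%N) => y /locus'[A fA Ap].
  exists A => // p kappa lambda /Ap[_ _ -> _ h] ka la.
  by have [_ _ -> _ ->] := h kappa lambda ka la.
- split.
  + split; first by move=> *; rewrite /= !leq_max ltnS leq0n !orbT.
    exists (fun p => maxn (ka2 p) (maxn (ka0 p) (mu0 p).+1)) => y /locus'[A fA Ap].
    by exists A => // p /Ap[-> -> _ [-> _] _].
  + split; first by move=> *; rewrite /= le_max ler0n orbT.
    exists (fun p => Num.max (la2 p) (mu0 p)%:R) => y /locus'[A fA Ap].
    by exists A => // p /Ap[_ -> _ [_ ->] _].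
- exact: n2_gt.
Qed.

Section Balance.
Variables (T b k l : R).
Hypotheses (T1 : 1 <= T) (b1 : 1 <= b) (k0 : 0 <= k) (kl : k <= l).
Let T0 : 0 < T. Proof. exact: lt_le_trans T1. Qed.
Let b0 : 0 < b. Proof. exact: lt_le_trans b1. Qed.
Let k1 : 0 < k + 1. Proof. by rewrite ltr_wpDl. Qed.
Let k1N : k + 1 != 0. Proof. by rewrite gt_eqF. Qed.

(** The target T^k' b^(l'-k') for (k', l') = A(k, l). *)
Definition A_size := T `^ (k / (2 * (k + 1))) *
  b `^ ((k + l + 1) / (2 * (k + 1)) - k / (2 * (k + 1))).

(* Solves [Z = (T / Z) ^ k * b ^ (l - k)]: the shift length p ^ chi of order
   [Z] balances the diagonal term against the differenced sums. *)
Definition balance := (T `^ k * b `^ (l - k)) `^ (k + 1)^-1.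

Lemma balance_ge1 : 1 <= balance.
Proof.
have lk0 : 0 <= l - k by rewrite subr_ge0.
apply: powR_ge1; last by rewrite invr_ge0 ltW.
by rewrite -[leLHS]mul1r ler_pM// powR_ge1.
Qed.

Let Z0 : 0 < balance. Proof. exact: lt_le_trans balance_ge1. Qed.

Lemma balance_powR : balance `^ (k + 1) = T `^ k * b `^ (l - k).
Proof. by rewrite -powRrM mulVf// powRr1// mulr_ge0 ?powR_ge0. Qed.

Lemma balanceE : (T / balance) `^ k * b `^ (l - k) = balance.
Proof.
rewrite powR_div// mulrAC -balance_powR powR_addr// powRr1 ?ltW// mulrAC divff ?mul1r//.
by rewrite gt_eqF// powR_gt0.
Qed.

Lemma A_sizeE : A_size = (b * balance) `^ (1 / 2).
Proof.
rewrite /balance /A_size powRM ?powR_ge0 ?ltW// -powRrM powRM ?powR_ge0// -!powRrM.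
rewrite mulrCA -powR_addr//; congr (_ `^ _ * _ `^ _); field; rewrite ?k1N//.
Qed.

(** With e = 1 / (2 (k + 1)), T^(1/2) = T^k' T^e, and T^e <= b^((l+1) e) = b^(l'-k'). *)
Lemma sqrt_le_A_size : T <= b `^ (l + 1) -> T `^ (1 / 2) <= A_size.
Proof.
move=> Tb; pose e := 1 / (2 * (k + 1)).
have e0 : 0 <= e by rewrite divr_ge0// mulr_ge0// ltW.
have -> : 1 / 2 = k / (2 * (k + 1)) + e by rewrite /e; field; rewrite k1N.
rewrite powR_addr// ler_wpM2l ?powR_ge0//; apply: le_trans (powR_mono T0 Tb e0) _.
rewrite -powRrM le_eqVlt; apply/orP; left; apply/eqP; congr (_ `^ _).
by rewrite /e; field; rewrite k1N.
Qed.

(** Since (b Z)^(k+1) = T^k b^(l+1) for Z = [balance]. This keeps b, up to a power of p, below the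
    modulus T / p^chi left after differencing. *)
Lemma balance_le : b `^ (l + 1) <= T -> b * balance <= T.
Proof.
move=> bT; have bZ0 : 0 < b * balance by apply: mulr_gt0.
rewrite leNgt; apply/negP => TbZ.
have := gt0_ltr_powR k1 _ _ TbZ; rewrite !nnegrE (ltW T0) (ltW bZ0) => /(_ isT isT).
apply/negP; rewrite -leNgt powRM ?(ltW b0) ?(ltW Z0)// balance_powR mulrCA -powR_addr//.
have -> : k + 1 + (l - k) = l + 1 by clear; ring.
rewrite [T `^ (k + 1)]powR_addr// (powRr1 (ltW T0)).
by rewrite ler_wpM2l ?powR_ge0.
Qed.

End Balance.

Lemma prime_power_between (p : nat) (Z : R) : (1 < p)%N -> 1 <= Z ->
  exists a, Z <= p%:R ^+ a <= p%:R * Z.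
Proof.
move=> p1 Z1; have ex : exists a, Z <= p%:R ^+ a.
  exists (Num.truncn Z).+1; apply: ltW; apply: lt_trans (truncnS_gt Z) _.
  by rewrite -natrX ltr_nat ltn_expl.
case: (ex_minnP ex) => a Za amin; exists a; rewrite Za /=.
have p0 : 0 < p%:R :> R by rewrite ltr0n ltnW.
case: a Za amin => [|a] Za amin.
  by rewrite expr0 -[leLHS]mulr1 ler_pM// ler1n ltnW.
rewrite exprS ler_wpM2l ?(ltW p0)// ltW// ltNge; apply/negP => /amin.
by rewrite ltnn.
Qed.

Section LongSum.
Variables (q : datum R) (C : R) (p : prime_nat) (y : rat) (w : int) (kappa u n t : nat).
Variables (lambda : R) (f : nat -> padic p) (M : int) (b : nat).
Let mu := int_weight q (y + 1) p.
Let v := dat_u0 q (y + 1) p kappa mu%:R.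
Let n1 := dat_n0 q (y + 1) p kappa mu%:R.
Let rr := dat_r q (y + 1) p kappa mu%:R.
Let k := dat_k q.
Let l := dat_l q.
Let T : R := (p ^ t)%:R.
Let P : R := p%:R.
Hypotheses (C0 : 0 <= C) (wf : well_formed_datum q) (qC : pair_bound q C) (y0 : 0 < y).
Hypotheses (ka : kappa_admissible p kappa) (mu_kappa : (mu < kappa)%N).
Hypotheses (kq : (dat_kappa0 q (y + 1) p <= kappa)%N) (mul : mu%:R <= lambda).
Hypotheses (vu : (v + kappa + iota_pos p y <= u)%N) (n0 : (0 < n)%N).
Hypotheses (t0 : (0 < t)%N) (nE : n%:Z = w + kappa%:Z + (iota_pos p y)%:Z + t%:Z).
Hypotheses (fF : classF w y kappa lambda u f) (b0 : (0 < b)%N) (bT : (b <= p ^ t)%N).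
Hypothesis blT : b%:R `^ (l + 1) <= T.

(** By [A_sizeE] it suffices that the square of the sum is O(b Z), with Z the balance. In 12 = 4 (2
    + 1), 4 is from van der Corput, 2 from the diagonal through b <= 2 p^chi H, and 1 from the
    differenced sums. *)
Lemma long_sum_bound :
  normc (phase_sum R f n M b) <= 12%:R * (2 * C + 1) *
    (P `^ `|rr| * P ^+ (v.+1.*2 + n1.*2) * ln_sqr R (p ^ t) `^ (dat_delta q + 1)) *
    A_size T b%:R k l.
Proof.
have [k0 kl d0] : [/\ 0 <= k, k <= l & 0 <= dat_delta q].
  by have [[/andP[h0 h1] /andP[h2 h3]] [_ d0] _ _ _] := wf; split=> //; rewrite /k /l; lra.
have P1 : 1 < P by rewrite ltr1n prime_nat_gt1.
have P0 : 0 < P := lt_trans ltr01 P1.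
have T1 : 1 <= T by rewrite ler1n expn_gt0 prime_nat_gt0.
have bR1 : 1 <= b%:R :> R by rewrite ler1n.
have bR0 : 0 < b%:R :> R by rewrite ltr0n.
have Z1 := balance_ge1 T1 bR1 k0 kl; have ZE := balanceE T1 bR1 k0 kl.
have bZT := balance_le T1 bR1 k0 kl blT.
rewrite (A_sizeE _ _ bR1 k0).
set Z := balance T b%:R k l in Z1 ZE bZT *; clearbody Z.
have Z0 : 0 < Z := lt_le_trans ltr01 Z1.
have [a /andP[Za aZ]] := prime_power_between (prime_nat_gt1 p) Z1.
(* p^a rounds Z up to a power of p; the extra [v] ensures v <= chi, which [difference_phase]
   requires. *)
pose chi := (v + a)%N.
have pchi : (p ^ chi)%:R = P ^+ v * P ^+ a :> R by rewrite natrX exprD.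
have Pv1 : 1 <= P ^+ v by rewrite exprn_ege1// ltW.
have Zchi : Z <= (p ^ chi)%:R.
  by rewrite pchi; apply: le_trans Za _; rewrite -[leLHS]mul1r ler_wpM2r// exprn_ge0// ltW.
have chiZ : (p ^ chi)%:R <= P ^+ v.+1 * Z.
  by rewrite pchi exprSr -mulrA ler_wpM2l// (le_trans _ Pv1).
have b_chi : (b * p ^ chi <= p ^ (v.+1 + t))%N.
  rewrite -(ler_nat R) natrM expnD natrM [(p ^ v.+1)%:R]natrX.
  apply: le_trans (ler_wpM2l (ltW bR0) chiZ) _; rewrite mulrCA ler_wpM2l// exprn_ge0// ltW.
pose L := ln_sqr R (p ^ t).
have L1 : 1 <= L by apply: ln_sqr_ge1; rewrite -(expn0 p) ltn_exp2l// prime_nat_gt1.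
have L0 : 0 < L := lt_le_trans ltr01 L1.
pose E := P `^ `|rr| * P ^+ (v.+1.*2 + n1.*2).
have DE : difference_factor q C p y kappa t = (2 * C + 1) * E * L `^ dat_delta q by [].
have PE : P ^+ v.+1 <= E.
  rewrite -[leLHS]mul1r; apply: ler_pM => //.
  - by rewrite exprn_ge0// ltW.
  - by apply: powR_ge1 => //; exact: ltW.
  - by apply: ler_weXn2l; [exact: ltW|rewrite -!addnn; clear; lia].
have E0 : 0 < E by apply: lt_le_trans PE; rewrite exprn_gt0.
have E1 : 1 <= E by apply: le_trans PE; rewrite exprn_ege1// ltW.
have Ld1 : 1 <= L `^ dat_delta q by apply: powR_ge1.
have LdE : L `^ (dat_delta q + 1) = L `^ dat_delta q * L by rewrite powR_addr// (powRr1 (ltW L0)).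
rewrite -/L -/E LdE.
set S := normc _.
have S0 : 0 <= S by apply: normc_ge0.
have bZ0 : 0 < b%:R * Z by apply: mulr_gt0.
set K := 12%:R * (2 * C + 1) * (E * (L `^ dat_delta q * L)).
have EL1 : E <= E * (L `^ dat_delta q * L).
  by rewrite -[leLHS]mulr1 ler_wpM2l ?(ltW E0)// -[leLHS]mulr1 ler_pM.
have C21 : 1 <= 2 * C + 1 by rewrite lerDr mulr_ge0.
have K1 : E <= K.
  apply: (le_trans EL1); rewrite -[leLHS]mul1r ler_wpM2r//.
    by rewrite (le_trans _ EL1)// ltW.
  by rewrite -[leLHS]mul1r ler_pM// ler1n.
(* As K >= 1, K may be replaced by its square, which avoids square roots of the factors in K. *)
have SK : S ^+ 2 <= b%:R * Z * K -> S <= K * (b%:R * Z) `^ (1 / 2).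
  have K11 : 1 <= K by apply: le_trans K1.
  move=> S2; have bZE : b%:R * Z = (b%:R * Z) `^ (1 / 2) ^+ 2.
    by rewrite expr2 -powR_addr// -splitr powRr1// ltW.
  rewrite -(ler_sqr (S0)) ?nnegrE//; last by rewrite mulr_ge0 ?powR_ge0// (le_trans _ K11).
  rewrite exprMn -bZE; apply: le_trans S2 _; rewrite mulrC ler_wpM2r ?(ltW bZ0)//.
  by rewrite expr2 -[leLHS]mulr1 ler_wpM2l// (le_trans _ K11).
apply: SK; have Sb : S <= b%:R by apply: normc_phase_sum.
(* When even one shift is longer than the sum, the trivial bound gives b^2 <= b p^chi <= b P^(v+1)
   Z. *)
have [chib|bchi] := leqP (p ^ chi) b; last first.
  apply: (@le_trans _ _ (b%:R * (p ^ chi)%:R)).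
    by rewrite expr2 ler_pM// (le_trans Sb)// ler_nat ltnW.
  rewrite -mulrA ler_wpM2l ?(ltW bR0)//; apply: le_trans chiZ _.
  by rewrite mulrC ler_wpM2l ?(ltW Z0)// (le_trans PE).
have pchi0 : (0 < p ^ chi)%N by rewrite expn_gt0 prime_nat_gt0.
pose H := (b %/ p ^ chi)%N.
have H0 : (0 < H)%N by rewrite divn_gt0.
have HR : 0 < H%:R :> R by rewrite ltr0n.
have Hb : (p ^ chi * H <= b)%N by rewrite mulnC; exact: leq_divM.
have bH : b%:R <= 2 * (p ^ chi)%:R * H%:R :> R.
  rewrite -!natrM ler_nat; have := ltn_ceil b pchi0; rewrite -/H => bS.
  apply: leq_trans (ltnW bS) _; rewrite mulnC -mulnA mulnCA leq_mul2l; apply/orP; right.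
  by move: H0; clear; lia.
have HT : (H <= p ^ t)%N by apply: leq_trans (leq_div _ _) bT.
have nn (z z' : R[i]) : normc z = 1 -> normc z' = 1 -> normc (z * z'^*%C) = 1.
  by move=> h h'; rewrite normcM normc_conj h h' mulr1.
pose am (m : nat) := padic_e R (eval_series R f (M + m.+1%:Z)%:~R / p%:R ^+ n).
have am1 m : normc (am m) = 1 by apply: normc_psi.
have SE : S = normc (\sum_(m < b) am m) by [].
have := van_der_corput am H0 Hb; rewrite -SE => vdc.
rewrite -(ler_pM2l HR); apply: le_trans vdc _.
set Df := difference_factor q C p y kappa t in DE.
(* The balance equation [balanceE], since p^chi >= Z. *)
have X0Z : (T / (p ^ chi)%:R) `^ k * b%:R `^ (l - k) <= Z.
  rewrite -[leRHS]ZE ler_wpM2r ?powR_ge0//; apply: powR_mono => //.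
    by rewrite divr_gt0 ?ltr0n// expn_gt0 prime_nat_gt0.
  rewrite ler_wpM2l// ?(le_trans ler01 T1)// lef_pV2// posrE ltr0n//.
have Df0 : 0 <= Df by rewrite DE mulr_ge0 ?powR_ge0// mulr_ge0 ?(ltW E0)// (le_trans ler01 C21).
have sumB : \sum_(h < H) normc (\sum_(m < b - p ^ chi * h) am (m + p ^ chi * h)%N * (am m)^*%C)
    <= b%:R + Df * Z * (L * H%:R).
  rewrite -(big_mkord xpredT (fun h => normc (\sum_(m < b - p ^ chi * h) am (m + p ^ chi * h)%N * (am m)^*%C))).
  rewrite (big_ltn H0); apply: lerD.
    apply: (le_trans (normc_sum _ _ _)).
    rewrite (eq_bigr (fun=> 1)); first by rewrite sumr_const card_ord ler_nat leq_subr.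
    by move=> m _; apply: nn; apply: am1.
  apply: (@le_trans _ _ (\sum_(1 <= h < H) Df * Z * P ^+ logn p h)).
    rewrite big_nat [leRHS]big_nat; apply: ler_sum => h /andP[h0 hH].
    have hb : (p ^ chi * h < b)%N by apply: leq_trans Hb; rewrite ltn_pmul2l.
    have := difference_sum_bound M C0 wf qC y0 ka mu_kappa kq mul (leq_addr _ _) vu n0 t0 nE fF b_chi h0 hb.
    move=> /le_trans; apply; rewrite -/Df -/P mulrAC ler_wpM2r ?exprn_ge0 ?(ltW P0)//.
    by rewrite ler_wpM2l.
  rewrite -mulr_sumr; apply: ler_wpM2l; first exact: mulr_ge0 Df0 (ltW Z0).
  have -> : \sum_(1 <= h < H) P ^+ logn p h = (\sum_(1 <= h < H) p ^ logn p h)%:R.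
    by rewrite natr_sum; apply: eq_bigr => h _; rewrite natrX.
  apply: (@le_trans _ _ (t * H)%:R).
    by rewrite ler_nat sum_pfactor_le// prime_nat_prime.
  by rewrite natrM ler_wpM2r ?(ltW HR)// exponent_le_ln_sqr// prime_nat_gt1.
have b40 : 0 <= 4 * b%:R :> R by rewrite mulr_ge0.
apply: le_trans (ler_wpM2l b40 sumB) _.
have E2 : E <= E * (L `^ dat_delta q * L) * (2 * C + 1).
  by apply: (le_trans EL1); rewrite -[leLHS]mulr1 ler_wpM2l// (le_trans _ EL1)// ltW.
have h1 : b%:R <= 2 * (E * (L `^ dat_delta q * L)) * (2 * C + 1) * Z * H%:R.
  apply: (le_trans bH); rewrite ler_wpM2r ?(ltW HR)// -!(mulrA 2) ler_wpM2l//.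
  apply: (le_trans chiZ); rewrite ler_wpM2r ?(ltW Z0)//; exact: le_trans E2.
have h2 : Df * Z * (L * H%:R) = (E * (L `^ dat_delta q * L)) * (2 * C + 1) * Z * H%:R.
  by rewrite DE; move: (L `^ dat_delta q) => Ld; clear; ring.
rewrite h2 /K; move: h1; move: (E * (L `^ dat_delta q * L)) (2 * C + 1) => X Y h1.
have -> : H%:R * (b%:R * Z * (12%:R * Y * X)) = 4 * b%:R * (2 * X * Y * Z * H%:R + X * Y * Z * H%:R) by ring.
by rewrite ler_wpM2l// lerD2r.
Qed.

End LongSum.

(** The constants of the two regimes are added; the power of 2 converts [ln_sqr] back to the
    logarithm. *)
Lemma A_pair_bound q q2 C C2 : 0 <= C -> 0 <= C2 ->
  well_formed_datum q -> well_formed_datum q2 -> dat_k q2 = 1 / 2 -> dat_l q2 = 1 / 2 ->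
  pair_bound q C -> pair_bound q2 C2 ->
  pair_bound (A_datum q q2) ((12%:R * (2 * C + 1) + C2) * 2 `^ dat_delta (A_datum q q2)).
Proof.
move=> C0 C20 wf wf2 k2 l2 qC qC2 p y w kappa lambda n u t f M b y0 ka la n0 u0.
rewrite /= !geq_max ge_max => /andP[kq2 /andP[kq mu_kappa]] /andP[lq2 mul] nq /andP[uq2 uq] nE fF b0 bT.
have [k0 kl d0] : [/\ 0 <= dat_k q, dat_k q <= dat_l q & 0 <= dat_delta q].
  by have [[/andP[h0 h1] /andP[h2 h3]] [_ d0] _ _ _] := wf; split=> //; lra.
have [_ [_ d20] _ _ n2_gt] := wf2.
have t0 : (0 < t)%N by have := n2_gt y p kappa lambda y0 ka la; move: nq; clear; lia.
have T2 : (1 < p ^ t)%N by rewrite -(expn0 p) ltn_exp2l// prime_nat_gt1.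
have T1 : 1 <= (p ^ t)%:R :> R by rewrite ler1n ltnW.
have P1 : 1 <= p%:R :> R by rewrite ler1n prime_nat_gt0.
have P0 : 0 < p%:R :> R := lt_le_trans ltr01 P1.
have bR : 0 < b%:R :> R by rewrite ltr0n.
have lnT0 : 0 < ln (p ^ t)%:R :> R by rewrite ln_gt0// ltr1n.
have L1 := ln_sqr_ge1 R T2.
rewrite -/(A_size (p ^ t)%:R b%:R (dat_k q) (dat_l q)).
set mu := int_weight q (y + 1) p in kq mu_kappa mul uq *.
set r1 := dat_r q (y + 1) p kappa mu%:R; set r2 := dat_r q2 y p kappa lambda.
set v := dat_u0 q (y + 1) p kappa mu%:R in uq *; set n1 := dat_n0 q (y + 1) p kappa mu%:R.
set dd := dat_delta q + dat_delta q2 + 1.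
have LE : ln_sqr R (p ^ t) `^ dd = 2 `^ dd * ln (p ^ t)%:R `^ dd by rewrite /ln_sqr powRM// ltW.
set A := A_size _ _ _ _; have A0 : 0 <= A by rewrite mulr_ge0 ?powR_ge0.
set Pr := p%:R `^ (`|r1| + `|r2| + (v.+1.*2 + n1.*2)%:R).
have Pr0 : 0 <= Pr by apply: powR_ge0.
have Kn : 0 <= 12%:R * (2 * C + 1) by rewrite mulr_ge0// addr_ge0// mulr_ge0.
have -> : (12%:R * (2 * C + 1) + C2) * 2 `^ dd * (Pr * A * ln (p ^ t)%:R `^ dd) =
    (12%:R * (2 * C + 1) + C2) * (Pr * ln_sqr R (p ^ t) `^ dd) * A.
  by rewrite LE; move: (_ `^ dd) (_ `^ dd) => x x'; ring.
have Ldd e : e <= dd -> ln_sqr R (p ^ t) `^ e <= ln_sqr R (p ^ t) `^ dd by move=> ?; apply: ler_powR.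
have [Tb|bT'] := leP (p ^ t)%:R (b%:R `^ (dat_l q + 1) : R).
  apply: (le_trans (qC2 p y w kappa lambda n u t f M b y0 ka la n0 u0 kq2 lq2 nq uq2 nE fF b0 bT)).
  rewrite k2 l2 subrr powRr0 mulr1 -/r2.
  have h1 := sqrt_le_A_size T1 k0 Tb.
  have h2 : p%:R `^ r2 <= Pr.
    by apply: ler_powR => //; have := ler_norm r2; have := normr_ge0 r1; have := ler0n R (v.+1.*2 + n1.*2); lra.
  have h3 : ln (p ^ t)%:R `^ dat_delta q2 <= ln_sqr R (p ^ t) `^ dd.
    apply: (le_trans (ln_powR_le_ln_sqr T2 (leqnn _) d20)); apply: Ldd; rewrite /dd; lra.
  have h4 := ler_pM (powR_ge0 _ _) (powR_ge0 _ _) h2 h3.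
  rewrite mulrAC; apply: le_trans (_ : C2 * (Pr * ln_sqr R (p ^ t) `^ dd * A) <= _).
    by rewrite ler_wpM2l// ler_pM// ?mulr_ge0 ?powR_ge0.
  by rewrite mulrA ler_wpM2r// ler_wpM2r ?mulr_ge0 ?powR_ge0// lerDr.
apply: (le_trans (long_sum_bound M C0 wf qC y0 ka mu_kappa kq mul uq n0 t0 nE fF b0 bT (ltW bT'))).
rewrite -/A ler_wpM2r//.
have PP N : 0 <= p%:R `^ `|r1| * p%:R ^+ N :> R by rewrite mulr_ge0 ?powR_ge0 ?exprn_ge0 ?(ltW P0).
apply: ler_pM => //; first exact: mulr_ge0 (PP _) (powR_ge0 _ _).
  by rewrite lerDl.
apply: ler_pM; [exact: PP|exact: powR_ge0| |].
  rewrite -powR_mulrn ?(ltW P0)// -powR_addr//; apply: ler_powR => //.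
  by rewrite -/mu -/r1 -/v -/n1; have := normr_ge0 r2; lra.
by apply: Ldd; rewrite /dd; lra.
Qed.

Lemma A_exponent_datum q : exponent_datum q ->
  exists2 q' : datum R, exponent_datum q' & dat_k q' = dat_k q / (2 * (dat_k q + 1)) /\
    dat_l q' = (dat_k q + dat_l q + 1) / (2 * (dat_k q + 1)).
Proof.
move=> qD; have [C C0 qC] := exponent_datum_bound qD; have [wf _] := qD.
have hD := B_exponent_datum (pair_bound_exponent_datum ler01 trivial_well_formed trivial_pair_bound).
have [C2 C20 qC2] := exponent_datum_bound hD; have [wf2 _] := hD.
exists (A_datum q (B_datum trivial_datum)) => //.
apply: (@pair_bound_exponent_datum _ _ ((12%:R * (2 * C + 1) + C2) *
  2 `^ dat_delta (A_datum q (B_datum trivial_datum)))).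
- by rewrite mulr_ge0 ?powR_ge0// addr_ge0// mulr_ge0// addr_ge0// mulr_ge0.
- exact: A_datum_well_formed.
- by apply: A_pair_bound => //=; lra.
Qed.

End AProcess.

Theorem theorem2 (R : realType) (k l : R) :
  exponent_pair (k, l) ->
  exponent_pair (k / (2 * (k + 1)), (k + l + 1) / (2 * (k + 1))) /\
  exponent_pair (l - 1 / 2, k + 1 / 2).
Proof.
case=> q qD [-> ->]; split.
  by have [q' q'D [<- <-]] := A_exponent_datum qD; exists q'.
by exists (B_datum q); first exact: B_exponent_datum.
Qed.
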